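(* Let $R$ be a commutative reduced ring with identity which is not an integral domain. If $AG(R)$ is toroidal, then there are an integer $n$ with $2\leq n\leq 3$ and rings $R_1,\dots,R_n$ such that $R\cong R_1\times\cdots\times R_n$ and, according to the value of $n$, the following holds. (1) If $n=3$, then $R\cong \mathbb{Z}_2\times\mathbb{Z}_2\times\mathbb{Z}_3$. (2) If $n=2$, then $R$ is isomorphic to one of the following rings: $$\mathbb{F}_7\times\mathbb{F}_4,\quad \mathbb{F}_5\times\mathbb{F}_5,\quad \mathbb{F}_5\times\mathbb{F}_4,\quad \mathbb{F}_4\times\mathbb{F}_4.$$ Also, $AG(\mathbb{Z}_2\times\mathbb{Z}_2\times\mathbb{Z}_3)$ is a toroidal graph.
   Context: All rings are nonzero, commutative, with identity. $\mathbb{F}_q$ denotes the finite field of order $q$. For a ring $R$, $Z(R)$ is the set of zero-divisors of $R$, $Z(R)^*=Z(R)\setminus\{0\}$, and $ann_R(x)=\{r\in R : rx=0\}$. The ring $R$ is reduced if it has no nonzero nilpotent element. The annihilator graph $AG(R)$ is the undirected simple graph with vertex set $Z(R)^*$ in which two distinct vertices $x,y$ are adjacent if and only if $ann_R(xy)\neq ann_R(x)\cup ann_R(y)$. The genus $\gamma(G)$ of a graph $G$ is the minimal integer $k\ge 0$ such that $G$ can be embedded in $S_k$, the sphere with $k$ handles. A graph is toroidal if its genus is exactly $1$. *)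

(* Defs.v *)
From HB Require Import structures.
From mathcomp Require Import all_boot all_order all_algebra all_field.
From mathcomp Require Import all_classical all_reals all_analysis.

Set Implicit Arguments.
Unset Strict Implicit.
Unset Printing Implicit Defensive.

Import Order.TTheory GRing.Theory Num.Theory.
Import numFieldNormedType.Exports.

Local Open Scope classical_set_scope.
Local Open Scope ring_scope.

Definition ring_iso (R S : pzRingType) : Prop :=
  exists f : {rmorphism R -> S}, bijective f.

Definition reduced (R : comNzRingType) : Prop :=
  forall (x : R) (n : nat), x ^+ n = 0 -> x = 0.

Definition integral_domain (R : comNzRingType) : Prop :=
  GRing.integral_domain_axiom R.

(* MathComp only provides the ring structure on non-dependent finite functions,
   i.e. on powers of a single ring. *)
Definition ring_prod (n : nat) (Rs : 'I_n -> comNzRingType) : Type :=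
  {dffun forall i : 'I_n, Rs i}.

Section RingProd.
Variables (n : nat) (Rs : 'I_n -> comNzRingType).
Implicit Types f g h : ring_prod Rs.

HB.instance Definition _ := Choice.on (ring_prod Rs).

Definition rp_zero : ring_prod Rs := [ffun i => 0 : Rs i].
Definition rp_one : ring_prod Rs := [ffun i => 1 : Rs i].
Definition rp_opp f : ring_prod Rs := [ffun i => - f i].
Definition rp_add f g : ring_prod Rs := [ffun i => f i + g i].
Definition rp_mul f g : ring_prod Rs := [ffun i => f i * g i].

Fact rp_addA : associative rp_add.
Proof. by move=> f g h; apply/ffunP => i; rewrite !ffunE addrA. Qed.
Fact rp_addC : commutative rp_add.
Proof. by move=> f g; apply/ffunP => i; rewrite !ffunE addrC. Qed.
Fact rp_add0 : left_id rp_zero rp_add.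
Proof. by move=> f; apply/ffunP => i; rewrite !ffunE add0r. Qed.
Fact rp_addN : left_inverse rp_zero rp_opp rp_add.
Proof. by move=> f; apply/ffunP => i; rewrite !ffunE addNr. Qed.

HB.instance Definition _ :=
  GRing.isZmodule.Build (ring_prod Rs) rp_addA rp_addC rp_add0 rp_addN.

Fact rp_mulA : associative rp_mul.
Proof. by move=> f g h; apply/ffunP => i; rewrite !ffunE mulrA. Qed.
Fact rp_mulC : commutative rp_mul.
Proof. by move=> f g; apply/ffunP => i; rewrite !ffunE mulrC. Qed.
Fact rp_mul1 : left_id rp_one rp_mul.
Proof. by move=> f; apply/ffunP => i; rewrite !ffunE mul1r. Qed.
Fact rp_mulD : left_distributive rp_mul (@GRing.add (ring_prod Rs)).
Proof. by move=> f g h; apply/ffunP => i; rewrite !ffunE mulrDl. Qed.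

(* Only a possibly trivial ring, because n may be 0. *)
HB.instance Definition _ :=
  GRing.Zmodule_isComPzRing.Build (ring_prod Rs)
    rp_mulA rp_mulC rp_mul1 rp_mulD.

End RingProd.

Definition F4 : finFieldType := s2val (@pPrimePowerField 2%N 2%N isT isT).

Fact card_F4 : #|F4| = 4%N.
Proof. exact: (s2valP' (@pPrimePowerField 2%N 2%N isT isT)). Qed.

(* Simple graphs, possibly infinite: the rings considered are arbitrary. *)
Record sgraph := SGraph {
  vertex :> Type;
  adj : vertex -> vertex -> Prop;
  adj_sym : forall x y, adj x y -> adj y x;
  adj_irr : forall x, ~ adj x x
}.

Section AnnihilatorGraph.
Variable R : comNzRingType.

Definition ann (x : R) : set R := [set r | r * x = 0].

Definition zero_divisor (x : R) : Prop := exists2 r : R, r != 0 & r * x = 0.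

Definition AG_vertex : Type := {x : R | zero_divisor x /\ x != 0}.

Definition AG_adj (u v : AG_vertex) : Prop :=
  let x := sval u in let y := sval v in
  x != y /\ ann (x * y) <> ann x `|` ann y.

Fact AG_adj_sym u v : AG_adj u v -> AG_adj v u.
Proof. by case=> ne h; split; rewrite 1?eq_sym // mulrC setUC. Qed.

Fact AG_adj_irr u : ~ AG_adj u u.
Proof. by case; rewrite eqxx. Qed.

Definition AG : sgraph := SGraph AG_adj_sym AG_adj_irr.

End AnnihilatorGraph.

Section Genus.
Variable K : realType.

(* A slab of size (2k+1) x 3 x 1 through which k square holes are drilled
   vertically, the i-th one (i < k) over ]2i+1, 2i+2[ x ]1, 2[. *)
Definition drilled_slab (k : nat) : set (K * K * K) :=
  [set p | let x := p.1.1 in let y := p.1.2 in let z := p.2 in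
     [/\ 0 <= x <= (2 * k + 1)%:R, 0 <= y <= 3, 0 <= z <= 1 &
         forall i : nat, (i < k)%N ->
           ~ ((2 * i + 1)%:R < x < (2 * i + 2)%:R /\ 1 < y < 2)]].

(* S_k, the sphere with k handles, realised in 3-space as the boundary of the
   slab: for k = 0 this is the surface of a box, i.e. a sphere, and each hole
   adds one handle (the bar running along one side of the hole).  Surfaces only
   matter up to homeomorphism here. *)
Definition sphere_with_handles (k : nat) : set (K * K * K) :=
  closure (drilled_slab k) `\` interior (drilled_slab k).

Definition simple_arc (a b : K * K * K) (c : K -> K * K * K) : Prop :=
  [/\ {within `[0, 1], continuous c}, set_inj `[0, 1] c, c 0 = a & c 1 = b].

(* G can be drawn in S without crossings: vertices are distinct points of S, and
   each edge is a simple arc of S whose interior contains no vertex and is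
   disjoint from the interiors of all the other edges.  An edge is parametrised
   in both directions, arc v u being the reverse of arc u v. *)
Definition embeds (G : sgraph) (S : set (K * K * K)) : Prop :=
  exists (pos : G -> K * K * K) (arc : G -> G -> K -> K * K * K),
    [/\ injective pos,
        forall v, S (pos v),
        forall u v, adj u v ->
          [/\ simple_arc (pos u) (pos v) (arc u v),
              arc u v @` `[0, 1] `<=` S &
              forall t, `[0, 1]%classic t -> arc v u t = arc u v (1 - t)],
        forall u v w t, adj u v -> `]0, 1[%classic t -> arc u v t <> pos w &
        forall u v u' v' t t', adj u v -> adj u' v' ->
          ~ ((u = u' /\ v = v') \/ (u = v' /\ v = u')) ->
          `]0, 1[%classic t -> `]0, 1[%classic t' -> arc u v t <> arc u' v' t'].

(* A graph that embeds in no S_k has no genus. *)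
Definition has_genus (G : sgraph) (g : nat) : Prop :=
  embeds G (sphere_with_handles g) /\
  forall k, embeds G (sphere_with_handles k) -> (g <= k)%N.

Definition toroidal (G : sgraph) : Prop := has_genus G 1.

End Genus.

(* Main.v *)
Require Import Defs.
From HB Require Import structures.
From mathcomp Require Import all_boot all_order all_algebra all_field.
From mathcomp Require Import all_classical all_reals all_analysis.
From mathcomp Require Import zify ring lra.

Set Implicit Arguments.
Unset Strict Implicit.
Unset Printing Implicit Defensive.

Import Order.TTheory GRing.Theory Num.Theory.
Import numFieldNormedType.Exports.

(** For a reduced ring R, two vertices of AG(R) are adjacent exactly when neither of
    their annihilators contains the other.  Orthogonal idempotents with enough
    multiples therefore produce large triangle-free subgraphs: complete bipartite
    ones from two idempotents, and extensions of K(4, 4) from three.  A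
    triangle-free graph with n vertices has at most 2 n edges if it embeds in the
    torus and, for n >= 3, at most 2 n - 4 if it embeds in the sphere.  Four
    subgraphs with 10 vertices and 21 edges ([bip_obstruction], [obstruction_113],
    [obstruction_122]) thus bound everything when AG(R) is toroidal.

    If a b = 0 with a and b nonzero, the ideals of a and b cannot both be large,
    and a nonzero finite ideal of a reduced ring contains an idempotent.  So as
    long as a corner eR is not a domain its unit e splits ([split_idempotent]).
    After one splitting of 1 either both corners are domains, or one of them
    splits again.  In the second case the obstructions leave Z/2 x Z/2 x Z/3 and
    Z/2 x Z/2 x Z/2, and the latter has a planar graph, a prism
    ([three_factors]).  In the first case AG(R) is complete bipartite, both
    corners have at least three nonzero elements since K(1, k) and K(2, k) are
    planar for every cardinal k for which they have room on a surface at all, and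
    K(3, 7) and K(4, 6) bound the corners from above ([two_domains]).

    The bounds on edges are obtained without the Jordan curve theorem.  The
    surfaces have arbitrarily fine covers by closed cells that are linked like a
    grid ([torus_tiled], [octahedron_tiled]).  A drawing meets the cells in
    connected sets, which makes the graph a minor of the grid
    ([drawing_bound]).  In the grid, cycles mod 2 that are killed by h
    functionals bound sets of faces, with h = 2 for the torus and h = 0 for the
    sphere; so the cycles of the minor, up to h dimensions, are spanned by the
    boundaries of the regions it cuts out.  Each edge lies on at most two of
    these and each of them has at least four edges, which gives the bound as in
    MacLane's planarity criterion ([minor_bound]).

    That some graphs do embed is shown by explicit drawings made of edges of the
    Freudenthal triangulation, where disjointness of curves reduces to
    disjointness of lists of lattice points, which is checked by computation
    ([lattice_embeds]).  For K(2, k) the edges are straight segments, and the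
    injection of space into an interval used to place the k vertices
    ([space_inj_unit]) exists because an embedded graph has at most continuum
    many vertices. *)

(** * Graph minors of a 2-complex and the cycle rank of planar and toroidal graphs *)

(** A closed surface cut into polygons.  Both endpoints of a link and the two
    faces on its sides are recorded; what happens around a cell is not, since
    mod 2 chains need nothing else. *)
Record complex := Complex {
  cell : finType;
  link : finType;
  face : finType;
  lsrc : link -> cell;
  ltgt : link -> cell;
  lleft : link -> face;
  lright : link -> face }.

Section Homology.
Local Open Scope ring_scope.
Variable C : complex.

Definition bd1 (c : link C -> 'F_2) (x : cell C) : 'F_2 :=
  \sum_d c d * ((lsrc d == x)%:R + (ltgt d == x)%:R).

Definition bd2 (S : face C -> 'F_2) (d : link C) : 'F_2 :=
  S (lleft d) + S (lright d).

Definition bd_bd := forall S x, bd1 (bd2 S) x = 0.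

(** The first Betti number mod 2 is at most h: the cycles that are killed by h
    suitable functionals bound.  Stating it through functionals avoids quotient
    spaces and is what the explicit grids below deliver. *)
Definition betti_le (h : nat) := exists Lam : link C -> 'I_h -> 'F_2,
  forall c : link C -> 'F_2, (forall x, bd1 c x = 0) ->
    (forall k, \sum_d c d * Lam d k = 0) -> exists S, c =1 bd2 S.

Lemma addF2 (x : 'F_2) : x + x = 0.
Proof. by rewrite -mulr2n -mulr_natl (_ : 2%:R = 0) ?mul0r //; apply/val_inj. Qed.

Lemma F2_telescope (a b c d : 'F_2) : a + b + (c + a + (b + d)) = c + d.
Proof.
have -> : a + b + (c + a + (b + d)) = (a + a) + (b + b) + (c + d) by ring.
by rewrite !addF2 !add0r.
Qed.

Lemma sum_delta (T : finType) (F : T -> 'F_2) (x : T) : \sum_y F y * (y == x)%:R = F x.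
Proof. by rewrite (bigD1 x) //= eqxx mulr1 big1 ?addr0 // => y /negPf ->; rewrite mulr0. Qed.

Lemma sum_eq1 (T : finType) (x : T) : \sum_y (x == y)%:R = 1 :> 'F_2.
Proof.
by rewrite -[RHS](sum_delta (fun=> 1) x); apply: eq_bigr => y _; rewrite mul1r eq_sym.
Qed.

Definition linked (x y : cell C) : bool :=
  [exists d : link C, (lsrc d == x) && (ltgt d == y) || (lsrc d == y) && (ltgt d == x)].

End Homology.

(** A graph with n vertices and m edges, given as a minor of the 1-skeleton of C:
    the cells labelled v are contracted to the vertex v, unlabelled cells are
    dropped, and gate e is a link that survives as the edge e.  The girth
    condition on the graph is stated on mod 2 cycles, the only form in which it
    is used. *)
Section Minor.
Local Open Scope ring_scope.
Variables (C : complex) (h n m : nat) (src tgt : 'I_m -> 'I_n).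
Hypothesis bdbdC : bd_bd C.
Hypothesis bettiC : betti_le C h.

Definition incident (e : 'I_m) (v : 'I_n) : 'F_2 := (src e == v)%:R + (tgt e == v)%:R.

Definition even_edges (z : 'I_m -> 'F_2) := forall v, \sum_e z e * incident e v = 0.

Hypothesis n_gt0 : (0 < n)%N.
Hypothesis girth4 : forall z : 'I_m -> 'F_2, even_edges z -> (exists e, z e != 0) ->
  (4 <= #|[pred e | z e != 0%R]|)%N.

Variable lab : cell C -> option 'I_n.
Variable gate : 'I_m -> link C.

Definition same_lab (x y : cell C) : bool :=
  [&& linked x y, lab x == lab y & lab x != None].

Hypothesis lab_conn : forall x y, lab x = lab y -> lab x != None -> connect same_lab x y.
Hypothesis lab_ex : forall v, exists x, lab x = Some v.
Hypothesis src_tgt : forall e, src e != tgt e.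
Hypothesis gateP : forall e,
  (lab (lsrc (gate e)), lab (ltgt (gate e))) = (Some (src e), Some (tgt e)) \/
  (lab (lsrc (gate e)), lab (ltgt (gate e))) = (Some (tgt e), Some (src e)).
Hypothesis gate_inj : injective gate.

Definition inside (d : link C) := (lab (lsrc d) == lab (ltgt d)) && (lab (lsrc d) != None).

Definition chain_of d : link C -> 'F_2 := fun d' => (d' == d)%:R.

Lemma bd1_chain_of d x : bd1 (chain_of d) x = (lsrc d == x)%:R + (ltgt d == x)%:R.
Proof.
rewrite /bd1 (bigD1 d) //= /chain_of eqxx mul1r big1 ?addr0 // => d' /negPf ->.
by rewrite mul0r.
Qed.

Lemma bd1D c c' x : bd1 (fun d : link C => c d + c' d) x = bd1 c x + bd1 c' x.
Proof. by rewrite /bd1 -big_split; apply: eq_bigr => d _; rewrite mulrDl. Qed.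

(** Contracted cells can be joined by a chain that stays inside their class. *)
Lemma inside_chain x y : connect same_lab x y ->
  exists c : link C -> 'F_2, (forall d, ~~ inside d -> c d = 0) /\
    forall z, bd1 c z = (x == z)%:R + (y == z)%:R.
Proof.
case/connectP => p; elim: p x => [|y' p IH] x /=.
  move=> _ ->; exists (fun=> 0); split=> // z.
  by rewrite addF2 /bd1 big1 // => d _; rewrite mul0r.
case/andP => /and3P [/existsP [d dxy] labxy labx] /IH {}IH /IH [c [cin bdc]].
exists (fun d' => chain_of d d' + c d'); split.
  move=> d' d'out; rewrite cin // addr0 /chain_of; case: eqP => // dd'.
  move: d'out; rewrite dd' /inside; case/orP: dxy => /andP [/eqP -> /eqP ->].
    by rewrite labxy labx.
  by rewrite eq_sym labxy -(eqP labxy) labx.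
move=> z; rewrite bd1D bd1_chain_of bdc.
case/orP: dxy => /andP [/eqP -> /eqP ->].
  by rewrite addrA -(addrA (_ == _)%:R) addF2 addr0.
by rewrite addrAC addrA addF2 add0r addrC.
Qed.

(** Fixing a root cell in each class, the edge e becomes a chain between roots
    which uses no gate but its own.  This lifts cycles of the graph to cycles of
    the complex. *)
Lemma edge_chain (root : 'I_n -> cell C) : (forall v, lab (root v) = Some v) ->
  forall e, exists c : link C -> 'F_2,
    [/\ c (gate e) = 1, forall d, ~~ inside d -> d != gate e -> c d = 0 &
      forall z, bd1 c z = (root (src e) == z)%:R + (root (tgt e) == z)%:R].
Proof.
move=> rootP e.
have gout : ~~ inside (gate e).
  rewrite /inside; case: (gateP e) => [] [-> ->]; rewrite andbT.
    by apply: contra (src_tgt e) => /eqP [->].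
  by apply: contra (src_tgt e) => /eqP [->].
have key a b : lab a = Some (src e) -> lab b = Some (tgt e) ->
   (forall z, (lsrc (gate e) == z)%:R + (ltgt (gate e) == z)%:R = (a == z)%:R + (b == z)%:R :> 'F_2) ->
   exists c : link C -> 'F_2,
    [/\ c (gate e) = 1, forall d, ~~ inside d -> d != gate e -> c d = 0 &
      forall z, bd1 c z = (root (src e) == z)%:R + (root (tgt e) == z)%:R].
  move=> la lb gab.
  have [|c1 [c1in bdc1]] := @inside_chain (root (src e)) a.
    by apply: lab_conn; rewrite rootP.
  have [|c2 [c2in bdc2]] := @inside_chain b (root (tgt e)).
    by apply: lab_conn; rewrite lb ?rootP.
  exists (fun d => chain_of (gate e) d + (c1 d + c2 d)); split.
  - by rewrite c1in // c2in // !addr0 /chain_of eqxx.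
  - by move=> d dout dg; rewrite c1in // c2in // !addr0 /chain_of (negPf dg).
  - move=> z; rewrite !bd1D bd1_chain_of gab bdc1 bdc2.
    exact: F2_telescope.
case: (gateP e) => [] [l1 l2].
  exact: (key _ _ l1 l2).
by apply: (key _ _ l2 l1) => z; rewrite addrC.
Qed.

(** The links traced by the minor; the faces of C fall into regions separated by
    them. *)
Definition wall d := inside d || [exists e, d == gate e].

Definition merged (f g : face C) :=
  [exists d : link C, ~~ wall d && ((lleft d == f) && (lright d == g) || (lleft d == g) && (lright d == f))].

Lemma merged_sym : connect_sym merged.
Proof.
apply: sym_connect_sym => f g; apply/existsP/existsP => -[d /andP [dw H]]; exists d;
  by rewrite dw orbC.
Qed.

Lemma gate_wall e : wall (gate e).
Proof. by apply/orP; right; apply/existsP; exists e. Qed.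

Definition region (f : face C) := fingraph.root merged f.

(** Regions are named by representative faces.  An edge with the same region on
    both sides does not count in the boundary of that region. *)
Definition region_bd (Q : face C) (e : 'I_m) : 'F_2 :=
  (region (lleft (gate e)) == Q)%:R + (region (lright (gate e)) == Q)%:R.

Lemma same_region d : ~~ wall d -> region (lleft d) = region (lright d).
Proof.
move=> dw; apply/eqP; rewrite (root_connect merged_sym); apply: connect1.
by apply/existsP; exists d; rewrite dw !eqxx.
Qed.

(** The boundary of a region as a set of faces is a cycle of C; summing its
    equations over the cells of one class leaves only the gates. *)
Lemma region_bd_even Q : even_edges (region_bd Q).
Proof.
move=> v; pose S f : 'F_2 := (region f == Q)%:R.
have := bdbdC S; move=> dd.
have : \sum_(x | lab x == Some v) bd1 (bd2 S) x = 0 by rewrite big1.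
rewrite /bd1 exchange_big /=.
under eq_bigr => d _ do rewrite -big_distrr /= big_split /=.
have aux (x : cell C) : \sum_(y | lab y == Some v) (x == y)%:R = (lab x == Some v)%:R :> 'F_2.
  case: (boolP (lab x == Some v)) => lx.
    rewrite (bigD1 x) //= eqxx big1 ?addr0 // => y /andP [_ /negPf].
    by rewrite eq_sym => ->.
  rewrite big1 // => y ly; case: eqP => // xy; by rewrite xy ly in lx.
under eq_bigr => d _ do rewrite !aux.
pose F d := bd2 S d * ((lab (lsrc d) == Some v)%:R + (lab (ltgt d) == Some v)%:R).
rewrite -[X in X = 0 -> _]/(\sum_d F d) => F0; rewrite -[RHS]F0 {F0}.
rewrite [RHS](bigID (fun d : link C => d \in codom gate)) /= [X in _ = _ + X]big1 ?addr0; last first.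
  move=> d dng; rewrite /F; case: (boolP (wall d)) => [|/same_region dw]; last first.
    by rewrite /bd2 /S dw addF2 mul0r.
  case/orP => [/andP [/eqP -> _]|/existsP [e /eqP de]]; first by rewrite addF2 mulr0.
  by rewrite de codom_f in dng.
transitivity (\sum_e F (gate e)).
  apply: eq_bigr => e _; rewrite /F /incident.
  by case: (gateP e) => [] [-> ->] //; rewrite [in RHS]addrC.
rewrite -(big_map gate predT F) big_uniq /=; last by rewrite map_inj_uniq ?index_enum_uniq.
apply: eq_bigl => d; apply/mapP/codomP => [[e _ ->]|[e ->]]; first by exists e.
by exists e; rewrite ?mem_index_enum.
Qed.

Lemma region_bd_neq0 Q e : region_bd Q e != 0 ->
  ((region (lleft (gate e)) == Q) + (region (lright (gate e)) == Q) >= 1)%N.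
Proof. by rewrite /region_bd; do 2 case: (_ == Q) => //. Qed.

Lemma sum_region_bd e : \sum_Q region_bd Q e = 0.
Proof.
by rewrite /region_bd big_split /= !sum_eq1 addF2.
Qed.

Definition essential := [pred Q | [exists e, region_bd Q e != 0]].

(** Each edge borders at most two regions, and each region with nonempty boundary
    has at least four edges on it. *)
Lemma essential_le : (4 * #|essential| <= 2 * m)%N.
Proof.
have -> : (4 * #|essential| = \sum_(Q in essential) 4)%N.
  by rewrite sum_nat_const mulnC.
have -> : (2 * m = \sum_(e < m) 2)%N by rewrite sum_nat_const card_ord mulnC.
apply: (@leq_trans (\sum_(Q in essential) \sum_(e < m) (region_bd Q e != 0%R))).
  apply: leq_sum => Q /existsP Qe.
  apply: leq_trans (girth4 (region_bd_even Q) Qe) _.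
  by rewrite -sum1_card big_mkcond /=; apply: leq_sum => e _; rewrite inE; case: (region_bd Q e != 0).
apply: (@leq_trans (\sum_Q \sum_(e < m) (region_bd Q e != 0%R))).
  by rewrite [leqRHS](bigID (mem essential)) /= leq_addr.
rewrite exchange_big /=; apply: leq_sum => e _.
have aux (f : face C) : (\sum_Q (f == Q : nat) = 1)%N.
  by rewrite (bigD1 f) //= eqxx big1 ?addn0 // => g /negPf; rewrite eq_sym => ->.
apply: (@leq_trans (\sum_Q ((region (lleft (gate e)) == Q) + (region (lright (gate e)) == Q)))).
  apply: leq_sum => Q _; case: (boolP (_ != 0)) => // /region_bd_neq0; done.
by rewrite big_split /= !aux.
Qed.

(** MacLane's criterion turned into a count.  The cycles of the graph that are
    killed by the h functionals form a space of dimension at least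
    [m - (n - 1) - h].  Lifted to C they bound a set of faces, which must be a
    union of regions, so they are spanned by the boundaries of regions.  At most
    [m / 2] of these are nonzero and their sum vanishes, so they span at most
    [m / 2 - 1] dimensions.  The second alternative is the case where all
    regions have empty boundary. *)
Lemma minor_bound : (m.+2 <= n + h + m./2)%N \/ (m < n + h)%N.
Proof.
have /fin_all_exists [root rootP] := lab_ex.
have /fin_all_exists [ch chP] := edge_chain rootP.
have [Lam LamP] := bettiC.
(* U is the space of cycles killed by the functionals, B lists the boundaries
   of the regions. *)
pose Inc : 'M['F_2]_(m, n) := \matrix_(e, v) incident e v.
pose Ld : 'M['F_2]_(m, h) := \matrix_(e, k) \sum_d ch e d * Lam d k.
pose U := kermx (row_mx Inc Ld).
pose B : 'M['F_2]_(#|face C|, m) := \matrix_(q, e) region_bd (enum_val q) e.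
have rkInc : (\rank Inc <= n.-1)%N.
  have : (const_mx 1 : 'rV['F_2]_n) != 0.
    apply/eqP => /matrixP /(_ 0 (Ordinal n_gt0)); rewrite !mxE => /eqP.
    by rewrite oner_eq0.
  move=> ne0.
  have Z : (const_mx 1 : 'rV['F_2]_n) *m Inc^T = 0.
    apply/matrixP => i e; rewrite !mxE.
    under eq_bigr => v _ do rewrite !mxE mul1r.
    rewrite big_split /=.
    by rewrite !sum_eq1 addF2.
  have := mxrankS (introT sub_kermxP Z); rewrite mxrank_ker mxrank_tr.
  have -> : \rank (const_mx 1 : 'rV['F_2]_n) = 1%N.
    by apply/eqP; rewrite rank_rV ne0.
  lia.
have rkU : (m - (n.-1 + h) <= \rank U)%N.
  rewrite mxrank_ker leq_sub2l //.
  have -> : row_mx Inc Ld = Inc *m row_mx 1%:M 0 + Ld *m row_mx 0 1%:M.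
    by rewrite !mul_mx_row !mulmx1 !mulmx0 add_row_mx addr0 add0r.
  apply: leq_trans (mxrank_add _ _) _; apply: leq_add.
    by apply: leq_trans rkInc; apply: mxrankM_maxl.
  by apply: leq_trans (rank_leq_col Ld); apply: mxrankM_maxl.
(* A cycle z lifts to the cycle c of C, which bounds a set S of faces; S is a
   union of regions and z reads off its boundary on the gates. *)
have UB : (U <= B)%MS.
  apply/rV_subP => z /sub_kermxP; rewrite mul_mx_row.
  rewrite -[X in _ = X]row_mx0 => /eq_row_mx [zI zL].
  pose c d := \sum_e z 0 e * ch e d.
  have bdc x : bd1 c x = 0.
    rewrite /bd1 /c.
    under eq_bigr => d _ do rewrite big_distrl /=.
    rewrite exchange_big /=.
    under eq_bigr => e _.
      under eq_bigr => d _ do rewrite -mulrA.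
      rewrite -big_distrr /=.
      have -> : \sum_d ch e d * ((lsrc d == x)%:R + (ltgt d == x)%:R) = bd1 (ch e) x by [].
      have [_ _ ->] := chP e.
      have -> : (root (src e) == x)%:R + (root (tgt e) == x)%:R =
         \sum_v incident e v * (root v == x)%:R.
        rewrite /incident; under [RHS]eq_bigr => v _ do rewrite mulrDl.
        rewrite big_split /=; congr (_ + _).
          rewrite (bigD1 (src e)) //= eqxx mul1r big1 ?addr0 // => v /negPf.
          by rewrite eq_sym => ->; rewrite mul0r.
        rewrite (bigD1 (tgt e)) //= eqxx mul1r big1 ?addr0 // => v /negPf.
        by rewrite eq_sym => ->; rewrite mul0r.
      rewrite big_distrr /=; over.
    rewrite exchange_big /= big1 // => v _.
    under eq_bigr => e _ do rewrite mulrA.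
    rewrite -big_distrl /=.
    have /matrixP /(_ 0 v) := zI; rewrite !mxE.
    move=> H; rewrite -[LHS]/((\sum_e z 0 e * incident e v) * _).
    by have -> : \sum_e z 0 e * incident e v = 0; rewrite ?mul0r // -[RHS]H; apply: eq_bigr => e _; rewrite mxE.
  have Lc k : \sum_d c d * Lam d k = 0.
    rewrite /c; under eq_bigr => d _ do rewrite big_distrl /=.
    rewrite exchange_big /=.
    have /matrixP /(_ 0 k) := zL; rewrite !mxE => L0; rewrite -[RHS]L0.
    apply: eq_bigr => e _; rewrite mxE big_distrr /=.
    by apply: eq_bigr => d _; rewrite mulrA.
  have [S cS] := LamP c bdc Lc.
  have Sopen d : ~~ wall d -> S (lleft d) = S (lright d).
    move=> dw; have : bd2 S d = 0.
      rewrite -cS /c big1 // => e _; have [_ ce0 _] := chP e.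
      rewrite ce0 ?mulr0 //; first by apply: contra dw => di; rewrite /wall di.
      by apply: contra dw => /eqP ->; exact: gate_wall.
    rewrite /bd2 => /eqP; rewrite addr_eq0 => /eqP ->.
    by apply/eqP; rewrite eq_sym -addr_eq0 addF2.
  have Sroot f : S (region f) = S f.
    have : connect merged f (region f) by exact: connect_root.
    case/connectP => p; elim: p f (region f) => [|g p IH] f r /=; first by move=> _ ->.
    case/andP => /existsP [d /andP [/Sopen Sd H]] /IH {}IH /IH ->.
    by case/orP: H => /andP [/eqP <- /eqP <-]; rewrite Sd.
  have zE : z = (\row_q S (enum_val q)) *m B.
    apply/rowP => e; rewrite !mxE.
    have -> : z 0 e = bd2 S (gate e).
      rewrite -cS /c (bigD1 e) //=; have [-> _ _] := chP e.
      rewrite mulr1 big1 ?addr0 // => e' ee'; have [_ ce0 _] := chP e'.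
      rewrite ce0 ?mulr0 //; last by apply: contra ee' => /eqP /gate_inj ->.
      rewrite /inside; case: (gateP e) => [] [-> ->]; rewrite andbT.
        by apply: contra (src_tgt e) => /eqP [->].
      by apply: contra (src_tgt e) => /eqP [->].
    rewrite /bd2 -(Sroot (lleft _)) -(Sroot (lright _)).
    under eq_bigr => q _ do rewrite !mxE mulrDr.
    rewrite big_split /=.
    have aux (f : face C) : \sum_(q < #|face C|) S (enum_val q) * (f == enum_val q)%:R = S f.
      rewrite (bigD1 (enum_rank f)) //= enum_rankK eqxx mulr1 big1 ?addr0 // => q qf.
      case: (eqVneq f (enum_val q)) => [fq|_]; last by rewrite mulr0.
      by rewrite fq enum_valK eqxx in qf.
    by rewrite !aux.
  by rewrite zE submxMl.
(* One nonzero boundary is redundant because the sum of all of them vanishes. *)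
have Brank : (#|essential| == 0)%N && (\rank B == 0)%N \/ (\rank B < #|essential|)%N.
  case: (posnP #|essential|) => [e0|].
    left; rewrite /= mxrank_eq0; apply/eqP/matrixP => q e; rewrite !mxE.
    apply/eqP; apply/negP => /negP H.
    have /card0_eq /(_ (enum_val q)) := e0; rewrite !inE => /negbT /existsP [].
    by exists e.
  case/card_gt0P => Q0 Q0e; right.
  pose rw (Q : face C) : 'rV['F_2]_m := \row_e region_bd Q e.
  have : (B <= \sum_(Q in [predD1 essential & Q0]) << rw Q >>)%MS.
    have sub Q : Q \in essential -> Q != Q0 -> (rw Q <= \sum_(Q in [predD1 essential & Q0]) << rw Q >>)%MS.
      move=> Qe QQ; by apply: (sumsmx_sup Q); rewrite ?genmxE // inE /= QQ.
    have sub0 Q : Q \notin essential -> rw Q = 0.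
      move=> Qe; apply/rowP => e; rewrite !mxE; apply/eqP; apply/negP => /negP H.
      by case/negP: Qe; apply/existsP; exists e.
    apply/row_subP => q.
    have -> : row q B = rw (enum_val q) by apply/rowP => e; rewrite !mxE.
    move: (enum_val q) => Q.
    case: (boolP (Q \in essential)) => [Qe|/sub0 ->]; last exact: sub0mx.
    case: (eqVneq Q Q0) => [->|]; last exact: sub.
    have -> : rw Q0 = - \sum_(Q | Q != Q0) rw Q.
      apply/eqP; rewrite -addr_eq0; apply/eqP.
      have -> : rw Q0 + \sum_(Q1 | Q1 != Q0) rw Q1 = \sum_Q1 rw Q1.
        by rewrite [RHS](bigD1 Q0).
      apply/rowP => e; rewrite summxE.
      by under eq_bigr => Q1 _ do rewrite mxE; rewrite sum_region_bd mxE.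
    rewrite eqmx_opp; apply: summx_sub => Q1 Q10.
    case: (boolP (Q1 \in essential)) => [Q1e|/sub0 ->]; last exact: sub0mx.
    exact: sub.
  move/mxrankS => rk; apply: leq_ltn_trans rk _.
  apply: leq_ltn_trans (mxrank_sum_leqif _).1 _ => /=.
  apply: (@leq_ltn_trans (\sum_(Q in [predD1 essential & Q0]) 1)).
    by apply: leq_sum => Q _; rewrite mxrank_gen; exact: rank_leq_row.
  rewrite sum1_card (cardD1 Q0 essential).
  have -> : (Q0 \in essential) = true by [].
  by rewrite add1n ltnS.
have rkUB := mxrankS UB; have ess := essential_le.
case: Brank => [/andP [/eqP e0 /eqP b0]|lt].
  right; move: rkU rkUB; rewrite b0; lia.
left; move: rkU rkUB lt ess; lia.
Qed.

End Minor.

(** * Concrete graphs as lists of edges *)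

Definition ordered_edges (n : nat) (es : seq (nat * nat)) :=
  all (fun e => e.1 < e.2 < n) es.

(** For ordered edges, the three edges of a triangle on a < b < c are (a, b),
    (b, c) and (a, c). *)
Definition no_triangle (es : seq (nat * nat)) :=
  all (fun e => all (fun e' => (e.2 == e'.1) ==> ((e.1, e'.2) \notin es)) es) es.

Section EdgeList.
Variables (n : nat) (es : seq (nat * nat)).
Hypothesis es_lt : ordered_edges n es.

Let m := size es.

Definition edge (e : 'I_m) : nat * nat := nth (0, 0) es e.

Lemma edge_in e : edge e \in es. Proof. exact: mem_nth. Qed.

Lemma edge_lt e : (edge e).1 < (edge e).2 < n.
Proof. exact: (allP es_lt _ (edge_in e)). Qed.

Lemma edge_lt1 e : (edge e).1 < n. Proof. by have := edge_lt e; lia. Qed.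
Lemma edge_lt2 e : (edge e).2 < n. Proof. by have := edge_lt e; lia. Qed.

Definition esrc e : 'I_n := Ordinal (edge_lt1 e).
Definition etgt e : 'I_n := Ordinal (edge_lt2 e).

Lemma esrc_etgt e : esrc e != etgt e.
Proof. by rewrite -val_eqE /=; have := edge_lt e; lia. Qed.

Definition touches e (v : 'I_n) := (esrc e == v) || (etgt e == v).

Lemma edge_ends e (u v : 'I_n) : u != v -> touches e u -> touches e v ->
  edge e = (minn u v, maxn u v).
Proof.
rewrite /touches -!val_eqE /= => uv eu ev.
by have := edge_lt e; move=> lt; apply: injective_projections => /=; lia.
Qed.

Hypothesis es_uniq : uniq es.
Hypothesis es_tri :
  no_triangle es.

Lemma edge_inj : injective edge.
Proof. by move=> e e' /eqP; rewrite nth_uniq // => /eqP /ord_inj. Qed.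

Lemma edges_triangle_free e1 e2 e3 (u v w : 'I_n) :
  u != v -> v != w -> u != w -> touches e1 u -> touches e1 v ->
  touches e2 v -> touches e2 w -> touches e3 u -> touches e3 w -> False.
Proof.
move=> uv vw uw u1 v1 v2 w2 u3 w3.
have tri a b c : edge a \in es -> (edge a).2 = (edge b).1 -> (edge c) = ((edge a).1, (edge b).2) -> False.
  move=> _ ab cab; have /allP /(_ _ (edge_in b)) := allP es_tri _ (edge_in a).
  by rewrite ab eqxx /= -cab edge_in.
have := edge_ends uv u1 v1; have := edge_ends vw v2 w2; have := edge_ends uw u3 w3.
move=> E3 E2 E1; move: uv vw uw; rewrite -!val_eqE => uv vw uw.
have mM a b : (minn a b, maxn a b) = (if (a < b)%N then (a, b) else (b, a)).
  by rewrite /minn /maxn; case: ifP.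
rewrite !mM in E1 E2 E3.
move: E1 E2 E3; case: ifP => c1; case: ifP => c2; case: ifP => c3 E1 E2 E3.
- by apply: (tri e1 e2 e3); rewrite ?edge_in ?E1 ?E2 ?E3.
- by clear - c1 c2 c3; lia.
- by apply: (tri e3 e2 e1); rewrite ?edge_in ?E1 ?E2 ?E3.
- by apply: (tri e3 e1 e2); rewrite ?edge_in ?E1 ?E2 ?E3.
- by apply: (tri e1 e3 e2); rewrite ?edge_in ?E1 ?E2 ?E3.
- by apply: (tri e2 e3 e1); rewrite ?edge_in ?E1 ?E2 ?E3.
- by clear - c1 c2 c3 uv vw uw; lia.
- by apply: (tri e2 e1 e3); rewrite ?edge_in ?E1 ?E2 ?E3.
Qed.

Local Open Scope ring_scope.

Lemma incident_touches e v : incident esrc etgt e v != 0 -> touches e v.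
Proof. by rewrite /incident /touches; case: (_ == v) => //; case: (_ == v). Qed.

Lemma touches_incident e v : touches e v -> incident esrc etgt e v = 1.
Proof.
rewrite /incident /touches; move: (esrc_etgt e).
by case: (eqVneq (esrc e) v) => [->|_]; case: (eqVneq (etgt e) v) => //=;
  rewrite ?addr0 ?add0r.
Qed.

Lemma even_next (z : 'I_m -> 'F_2) e v : even_edges esrc etgt z ->
  z e != 0 -> touches e v -> exists e', [/\ e' != e, z e' != 0 & touches e' v].
Proof.
move=> /(_ v) ev ze te.
case: (pickP (fun e' => [&& e' != e, z e' != 0 & touches e' v])) => [e' /and3P [*]|no].
  by exists e'.
move: ev; rewrite (bigD1 e) //= big1 ?addr0.
  by rewrite touches_incident // mulr1 => z0; rewrite z0 eqxx in ze.
move=> e' ee'; have := no e'; rewrite ee' /= => /negbT; rewrite negb_and negbK.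
case/orP => [/eqP -> | te']; first by rewrite mul0r.
by apply/eqP; rewrite mulf_eq0 -[X in _ || X]negbK (contra (@incident_touches e' v)) ?orbT.
Qed.

(** Follow an edge of the cycle in both directions: by evenness it continues at
    each end, and the path closes up with three edges only in a triangle. *)
Lemma edges_girth4 (z : 'I_m -> 'F_2) : even_edges esrc etgt z ->
  (exists e, z e != 0) -> (4 <= #|[pred e | z e != 0%R]|)%N.
Proof.
move=> ev [e0 z0]; set u := esrc e0; set v := etgt e0.
have uv : u != v := esrc_etgt e0.
have t0u : touches e0 u by rewrite /touches eqxx.
have t0v : touches e0 v by rewrite /touches eqxx orbT.
have [e1 [e10 z1 t1u]] := even_next ev z0 t0u.
have [e2 [e20 z2 t2v]] := even_next ev z0 t0v.
have same (e e' : 'I_m) (a b : 'I_n) : a != b -> touches e a -> touches e b ->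
    touches e' a -> touches e' b -> e = e'.
  move=> ab ea eb e'a e'b; apply: edge_inj.
  by rewrite (edge_ends ab ea eb) (edge_ends ab e'a e'b).
have e1v : ~~ touches e1 v.
  by apply: contra e10 => t1v; rewrite (same _ _ _ _ uv t1u t1v t0u t0v).
have [w t1w wu] : exists2 w, touches e1 w & w != u.
  have st := esrc_etgt e1; case/orP: (t1u) => /eqP tu.
    by exists (etgt e1); [rewrite /touches eqxx orbT | rewrite -tu eq_sym].
  by exists (esrc e1); [rewrite /touches eqxx | rewrite -tu].
have wv : w != v by apply: contra e1v => /eqP <-.
have [e3 [e31 z3 t3w]] := even_next ev z1 t1w.
have e30 : e3 != e0.
  apply/eqP => e30; move: t3w; rewrite e30 /touches -/u -/v.
  by rewrite eq_sym (negPf wu) eq_sym (negPf wv).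
have e32 : e3 != e2.
  apply/eqP => e32; rewrite e32 in t3w.
  by apply: (@edges_triangle_free e0 e2 e1 u v w); rewrite // eq_sym.
have e12 : e1 != e2 by apply: contra e1v => /eqP ->.
have : uniq [:: e0; e1; e2; e3].
  by rewrite /= !inE !negb_or !(eq_sym e0) (eq_sym e1 e3) (eq_sym e2 e3) e10 e20 e30 e12 e31 e32.
move/card_uniqP => /= <-; apply/subset_leq_card/fintype.subsetP => e.
by rewrite !inE => /or4P [] /eqP ->.
Qed.

End EdgeList.

(** * Grid decompositions of the torus and of the sphere *)

Section Grids.
Local Open Scope ring_scope.

Lemma ord_pred_inordS n j : (j.+1 < n.+1)%N -> ord_pred (inord j.+1 : 'I_n.+1) = inord j.
Proof.
move=> lt; have lt' := ltnW lt; apply/val_inj; rewrite /= !inordK //.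
by rewrite -[(j.+1 + n.+1).-1]/(j + n.+1)%N modnDr modn_small.
Qed.

Lemma ord_pred0 n : ord_pred (inord 0 : 'I_n.+1) = ord_max.
Proof. by apply/val_inj; rewrite /= inordK //= modn_small. Qed.

Variables N M : nat.
Local Notation I := ('I_N.+1).
Local Notation J := ('I_M.+1).

(** Cells are the vertices of a cyclic grid; a link with the flag true leads in the
    first direction.  The face (i, j) has its lowest corner at the cell (i, j). *)
Definition torus_grid : complex :=
  @Complex (I * J)%type (bool * (I * J))%type (I * J)%type
    (fun d => d.2)
    (fun d => if d.1 then (ordS d.2.1, d.2.2) else (d.2.1, ordS d.2.2))
    (fun d => d.2)
    (fun d => if d.1 then (d.2.1, ord_pred d.2.2) else (ord_pred d.2.1, d.2.2)).

Lemma sum_torus_link (F : link torus_grid -> 'F_2) :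
  \sum_d F d = \sum_(b : bool) \sum_i \sum_j F (b, (i, j)).
Proof.
transitivity (\sum_b \sum_x F (b, x)).
  by rewrite pair_bigA; apply: eq_bigr => -[].
by apply: eq_bigr => b _; rewrite pair_bigA; apply: eq_bigr => -[].
Qed.

Lemma torus_bd1E (c : link torus_grid -> 'F_2) i j : bd1 c (i, j) =
  c (true, (i, j)) + c (true, (ord_pred i, j)) + (c (false, (i, j)) + c (false, (i, ord_pred j))).
Proof.
rewrite /bd1; transitivity (\sum_(b : bool) \sum_x c (b, x) * ((x == (i, j))%:R +
   (x == if b then (ord_pred i, j) else (i, ord_pred j))%:R)).
  rewrite pair_bigA /=; apply: eq_bigr => -[b [i' j']] _ /=; congr (_ * (_ + _%:R)).
  have eqS n (k l : 'I_n) : (ordS k == l) = (k == ord_pred l).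
    by apply/eqP/eqP => [<-|->]; rewrite ?ordSK ?ord_predK.
  by case: b; rewrite !xpair_eqE eqS.
by rewrite big_bool /=; congr (_ + _);
  under eq_bigr => x _ do rewrite mulrDr; rewrite big_split /= !sum_delta.
Qed.

Lemma torus_bd_bd : bd_bd torus_grid.
Proof.
move=> S [i j]; rewrite torus_bd1E /bd2 /=.
move: (S (i, j)) (S (i, ord_pred j)) (S (ord_pred i, j)) (S (ord_pred i, ord_pred j)).
move=> a b c d.
have -> : a + b + (c + d) + (a + c + (b + d)) = (a + a) + (b + b) + (c + c) + (d + d) by ring.
by rewrite !addF2 ?addr0.
Qed.

Lemma addF2_eq (a b : 'F_2) : (a + b = 0) <-> (a = b).
Proof.
split=> [ab|->]; last exact: addF2.
by apply/eqP; rewrite -subr_eq0 (_ : - b = b) ?ab //; apply/eqP; rewrite eq_sym -addr_eq0 addF2.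
Qed.

Lemma F2_mid (a b : 'F_2) : a + b + a = b.
Proof. by rewrite addrAC addF2 add0r. Qed.

Lemma torus_step (t1 t2 s1 s2 a1 a2 b : 'F_2) :
  a1 + a2 + (b + (t1 + s1 + (t2 + s2))) = 0 -> b = t1 + (s1 + a1) + (t2 + (s2 + a2)).
Proof. by move=> E; apply/addF2_eq; rewrite -[RHS]E; ring. Qed.

(** The two functionals count the links crossing a fixed meridian and a fixed
    parallel.  If both counts are even, integrating the cycle from the corner
    gives a well defined set of faces. *)
Lemma torus_betti : betti_le torus_grid 2.
Proof.
exists (fun d k => if k == 0%R then (d.1 && (d.2.1 == (inord 0)))%:R else (~~ d.1 && (d.2.2 == (inord 0)))%:R).
move=> c cyc Lam0; pose a i j := c (true, (i, j)); pose b i j := c (false, (i, j)).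
have cycE i j : a i j + a (ord_pred i) j + (b i j + b i (ord_pred j)) = 0.
  by rewrite -[RHS](cyc (i, j)) torus_bd1E.
have La : \sum_j a (inord 0) j = 0.
  rewrite -[RHS](Lam0 0) /=.
  transitivity (\sum_(b : bool) \sum_(i : I) \sum_(j : J) c (b, (i, j)) * (b && (i == (inord 0)))%:R).
    rewrite big_bool /= [X in _ + X]big1 ?addr0; last first.
      by move=> i _; rewrite big1 // => j _; rewrite mulr0.
    rewrite [RHS](bigD1 (inord 0 : I)) //= [X in _ = _ + X]big1 ?addr0; last first.
      by move=> i /negPf ne; rewrite big1 // => j _; rewrite ne mulr0.
    by apply: eq_bigr => j _; rewrite eqxx mulr1.
  by rewrite sum_torus_link.
have Lb : \sum_i b i (inord 0) = 0.
  rewrite -[RHS](Lam0 1) /=.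
  transitivity (\sum_(b : bool) \sum_(i : I) \sum_(j : J) c (b, (i, j)) * (~~ b && (j == (inord 0)))%:R).
    rewrite big_bool /= [X in X + _]big1 ?add0r; last first.
      by move=> i _; rewrite big1 // => j _; rewrite mulr0.
    apply: eq_bigr => i _.
    rewrite [RHS](bigD1 (inord 0 : J)) //= [X in _ = _ + X]big1 ?addr0 ?eqxx ?mulr1 // => j /negPf ne.
    by rewrite ne mulr0.
  by rewrite sum_torus_link.
pose T i := \sum_(0 <= k < i.+1) b (inord k) (inord 0).
pose S (x : I * J) := T x.1 + \sum_(0 <= k < x.2) a x.1 (inord k.+1).
have TE (i : I) : T i + T (ord_pred i) = b i (inord 0).
  rewrite -(inord_val i); case: (val i) (ltn_ord i) => [_|k lt].
    rewrite ord_pred0 /T inordK // big_nat1.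
    have -> : \sum_(0 <= k < (ord_max : I).+1) b (inord k) (inord 0) = 0.
      by rewrite big_mkord -[RHS]Lb; apply: eq_bigr => k _; rewrite inord_val.
    by rewrite addr0.
  rewrite ord_pred_inordS // /T !inordK // ?(ltnW lt) //.
  by rewrite [X in X + _]big_nat_recr //= F2_mid.
have Sb i (j : nat) : (j < M.+1)%N -> b i (inord j) = S (i, inord j) + S (ord_pred i, inord j).
  elim: j => [|j IH] lt.
    by rewrite /S /= !inordK //= !big_geq // !addr0 TE.
  have := IH (ltnW lt); rewrite /S /= !inordK ?(ltnW lt) //.
  rewrite !big_nat_recr //= => E.
  have := cycE i (inord j.+1); rewrite ord_pred_inordS // E.
  exact: torus_step.
have La' i : \sum_j a i j = 0.
  rewrite -(inord_val i); elim: (val i) (ltn_ord i) => [_|k IH lt]; first exact: La.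
  rewrite -[LHS]addr0 -[X in _ + X](IH (ltnW lt)) -(ord_pred_inordS lt) -big_split /=.
  under eq_bigr => j _.
    have -> : a (inord k.+1) j + a (ord_pred (inord k.+1)) j =
       b (inord k.+1) j + b (inord k.+1) (ord_pred j) by apply/addF2_eq; exact: cycE.
    over.
  rewrite big_split /= addrC [X in X + _](_ : _ = \sum_j b (inord k.+1) j) ?addF2 //.
  rewrite [RHS](reindex_inj (can_inj (@ord_predK M.+1))) /=; by [].
exists S => -[[] [i j]]; rewrite /bd2 /=.
  rewrite -[c _]/(a i j) -(inord_val j); case: (val j) (ltn_ord j) => [_|k lt].
    rewrite ord_pred0 /S /= inordK // big_geq // addr0 addrA addF2 add0r.
    apply/addF2_eq; rewrite -[RHS](La' i) big_ord_recl big_mkord; congr (_ + _).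
      by congr (a i _); apply/val_inj; rewrite /= inordK.
    by apply: eq_bigr => k _; congr (a i _); apply/val_inj; rewrite /= inordK // ltnS ltn_ord.
  rewrite ord_pred_inordS // /S /= !inordK ?(ltnW lt) // big_nat_recr //=.
  apply/addF2_eq; move: (a _ _) (T _) (\sum_(0 <= _ < _) _) => x y z.
  have -> : x + (y + (z + x) + (y + z)) = (x + x) + (y + y) + (z + z) by ring.
  by rewrite !addF2 ?addr0.
by rewrite -[c _]/(b i j) -(inord_val j) Sb // inord_val.
Qed.

(** The faces in the first and in the last row of the grid below are wedges of a
    polar cap; merging each of these rows to one face caps the cylinder off. *)
Definition pole_merge (x : I * 'I_M.+2) : I * 'I_M.+2 :=
  if (x.2 == ord0) || (x.2 == ord_max) then (ord0, x.2) else x.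

(** A cylinder of parallels [inl] and meridians [inr], with a face beyond either
    end. *)
Definition sphere_grid : complex :=
  @Complex (I * J)%type (I * J + I * 'I_M)%type (I * 'I_M.+2)%type
    (fun d => match d with inl x => x | inr x => (x.1, inord x.2) end)
    (fun d => match d with inl x => (ordS x.1, x.2) | inr x => (x.1, inord x.2.+1) end)
    (fun d => match d with inl x => pole_merge (x.1, inord x.2)
                         | inr x => (x.1, inord x.2.+1) end)
    (fun d => match d with inl x => pole_merge (x.1, inord x.2.+1)
                         | inr x => (ord_pred x.1, inord x.2.+1) end).

Lemma sphere_bd1E (c : link sphere_grid -> 'F_2) i j : bd1 c (i, j) =
  c (inl (i, j)) + c (inl (ord_pred i, j)) +
   (\sum_(k < M | k == j :> nat) c (inr (i, k)) + \sum_(k < M | k.+1 == j :> nat) c (inr (i, k))).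
Proof.
rewrite /bd1 big_sumType /=; congr (_ + _).
  under eq_bigr => x _ do rewrite mulrDr.
  rewrite big_split /= sum_delta; congr (_ + _).
  rewrite -(sum_delta (fun x => c (inl x))); apply: eq_bigr => -[i' j'] _ /=.
  congr (_ * _%:R); rewrite !xpair_eqE; congr (_ && _).
  by apply/eqP/eqP => [<-|->]; rewrite ?ordSK ?ord_predK.
transitivity (\sum_i' \sum_k c (inr (i', k)) *
    (((i', inord k) == (i, j))%:R + ((i', inord k.+1) == (i, j))%:R)).
  by rewrite pair_bigA; apply: eq_bigr => -[].
rewrite (bigD1 i) //= [X in _ + X]big1 ?addr0; last first.
  by move=> i' /negPf ne; rewrite big1 // => k _; rewrite !xpair_eqE ne addr0 mulr0.
under eq_bigr => k _ do rewrite mulrDr !xpair_eqE eqxx /=.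
rewrite big_split /=; congr (_ + _); rewrite [RHS]big_mkcond; apply: eq_bigr => k _.
  rewrite -val_eqE /= inordK ?(leq_trans (ltn_ord k)) //.
  by case: eqP; rewrite ?mulr1 ?mulr0.
rewrite -val_eqE /= inordK ?ltnS //.
by case: eqP; rewrite ?mulr1 ?mulr0.
Qed.

Lemma sum_ord_eq (F : 'I_M -> 'F_2) (j : nat) (lt : (j < M)%N) :
  \sum_(k < M | k == j :> nat) F k = F (Ordinal lt).
Proof. by rewrite (big_pred1 (Ordinal lt)). Qed.

(** The set of faces is obtained by integrating along meridians from the first
    cap; it is compatible with the merging because its values in the first and in
    the last row do not depend on the longitude. *)
Lemma sphere_betti : betti_le sphere_grid 0.
Proof.
exists (fun _ _ => 0) => c cyc _.
pose a i j := c (inl (i, j)).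
pose b i j := \sum_(k < M | k.+1 == j :> nat) c (inr (i, k)).
have cycE i (j : J) : a i j + a (ord_pred i) j + (b i j.+1 + b i j) = 0.
  by rewrite -[RHS](cyc (i, j)) sphere_bd1E.
pose S (x : I * 'I_M.+2) := \sum_(0 <= k < x.2) a x.1 (inord k).
have Sb i (j : nat) : (j <= M.+1)%N ->
    \sum_(0 <= k < j) a i (inord k) + \sum_(0 <= k < j) a (ord_pred i) (inord k) = b i j.
  elim: j => [|j IH] lt; first by rewrite !big_geq // addr0 /b big_pred0.
  have := cycE i (inord j); rewrite inordK // !big_nat_recr //= => E.
  have {}IH := IH (ltnW lt).
  apply/addF2_eq; rewrite -[RHS]E -IH; ring.
have Sm (x : I * 'I_M.+2) : S (pole_merge x) = S x.
  rewrite /pole_merge; case: ifP => // pole.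
  have step i : S (i, x.2) = S (ord_pred i, x.2).
    apply/addF2_eq; rewrite /S Sb /=; last by rewrite -ltnS.
    rewrite /b big1 // => k; case/orP: pole => /eqP -> //= /eqP kM.
    by have := ltn_ord k; lia.
  rewrite [in RHS](surjective_pairing x) -[in RHS](inord_val x.1); elim: (val x.1) (ltn_ord x.1) => [_|k IH lt].
    by congr (S (_, x.2)); apply/val_inj; rewrite /= inordK.
  by rewrite IH ?(ltnW lt) // [RHS]step ord_pred_inordS.
exists S => -[[i j]|[i k]]; rewrite /bd2 /=.
  rewrite !Sm /S /= !inordK ?ltnS ?ltn_ord // ?(ltnW (ltn_ord _)) //; last by rewrite -ltnS.
  by rewrite big_nat_recr //= addrA addF2 add0r inord_val.
rewrite /S /= inordK ?ltnS ?(ltnW (ltn_ord _)) // Sb; last by rewrite ltnW // ltnS.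
by rewrite /b (eq_bigl (fun k' : 'I_M => k' == k :> nat)) // (sum_ord_eq _ (ltn_ord k)) (_ : Ordinal (ltn_ord k) = k) //; apply/val_inj.
Qed.

Lemma sphere_bd_bd : bd_bd sphere_grid.
Proof.
move=> S [i j]; rewrite sphere_bd1E /bd2 /=.
pose U i (j : nat) := S (pole_merge (i, inord j)).
have up : \sum_(k < M | k == j :> nat) (S (i, inord k.+1) + S (ord_pred i, inord k.+1)) =
   U i j.+1 + U (ord_pred i) j.+1.
  case: (ltnP j M) => jM.
    rewrite (sum_ord_eq _ jM) /= /U /pole_merge /= -!val_eqE /= inordK; last by lia.
    by have -> : (j.+1 == 0%N) || (j.+1 == M.+1) = false by lia.
  rewrite big_pred0; last by move=> k; have := ltn_ord k; lia.
  rewrite /U /pole_merge /= -!val_eqE /= inordK; last by have := ltn_ord j; lia.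
  have jM' : (j.+1 == 0%N) || (j.+1 == M.+1) by have := ltn_ord j; lia.
  by rewrite jM' addF2.
have dn : \sum_(k < M | k.+1 == j :> nat) (S (i, inord k.+1) + S (ord_pred i, inord k.+1)) =
   U i j + U (ord_pred i) j.
  case: (nat_of_ord j) (ltn_ord j) => [_|l lt].
    rewrite big_pred0 // /U /pole_merge /= -!val_eqE /= inordK //= addF2 //.
  have lM : (l < M)%N by lia.
  rewrite (eq_bigl (fun k' : 'I_M => k' == l :> nat)) // (sum_ord_eq _ lM) /=.
  rewrite /U /pole_merge /= -!val_eqE /= inordK; last by lia.
  by have -> : (l.+1 == 0%N) || (l.+1 == M.+1) = false by lia.
rewrite up dn -/(U i j) -/(U i j.+1) -/(U (ord_pred i) j) -/(U (ord_pred i) j.+1).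
by rewrite [X in X + _]addrACA [X in _ + X]addrC addF2.
Qed.

End Grids.

(** * From drawings to minors: covers by small closed cells *)

Section Covers.
Local Open Scope classical_set_scope.
Local Open Scope ring_scope.
Variables (K : realType) (T : normedModType K).

Lemma disjoint_compacts_apart (A B : set T) : compact A -> compact B ->
  A `&` B = set0 -> \forall e \near 0^'+, forall a b, A a -> B b -> ~ ball a e b.
Proof.
move=> cA cB AB0; move/compact_near_coveringP: cA => cA.
have near_cA : \forall e \near 0^'+, A `<=` [set a | forall b, B b -> ~ ball a e b].
  apply: (cA K (0^'+) (fun e a => forall b, B b -> ~ ball a e b)).
  move=> a Aa; have : nbhs a (~` B).
    apply: open_nbhs_nbhs; split.
      by apply: closed_openC; apply: compact_closed cB; exact: norm_hausdorff.
    by move=> Ba; have : (A `&` B) a by []; rewrite AB0.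
  move=> /nbhs_ballP [e /= e0 aB].
  exists (ball a (e / 2), [set d | d < e / 2]) => /=.
    by split; [apply: nbhsx_ballx; lra | apply: nbhs_right_lt; lra].
  move=> [x d] /= [ax de] b Bb xb; apply: (aB b) => //.
  have -> : e = e / 2 + e / 2 by lra.
  by apply: ball_triangle ax _; apply: le_ball xb; exact: ltW.
by apply: filterS near_cA => e H a b Aa; exact: H.
Qed.

Definition cell_rel (C : complex) (P : pred (cell C)) : rel (cell C) :=
  fun x y => [&& linked x y, P x & P y].

Lemma linked_sym (C : complex) (x y : cell C) : linked x y = linked y x.
Proof. by apply/existsP/existsP => -[d H]; exists d; rewrite orbC. Qed.

Lemma cell_rel_sym (C : complex) (P : pred (cell C)) : connect_sym (cell_rel P).
Proof.
by apply: sym_connect_sym => x y; rewrite /cell_rel linked_sym; congr (_ && _); rewrite andbC.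
Qed.

Lemma cell_rel_sub (C : complex) (P Q : pred (cell C)) x y : subpred P Q ->
  connect (cell_rel P) x y -> connect (cell_rel Q) x y.
Proof.
move=> PQ; apply: connect_sub => {}x {}y /and3P [xy Px Py].
by apply: connect1; apply/and3P; split; rewrite ?PQ.
Qed.

Lemma cell_rel_mem (C : complex) (P : pred (cell C)) x y :
  connect (cell_rel P) x y -> P x -> P y.
Proof.
case/connectP => p; elim: p x => [|z p IH] x /=; first by move=> _ ->.
by case/andP => /and3P [_ _ Pz] pz ly _; exact: IH ly Pz.
Qed.

Definition hit (C : complex) (A : cell C -> set T) (Q : set T) (x : cell C) : bool :=
  `[< exists2 p, Q p & A x p >].

(** Cells become closed subsets of the space, of diameter less than e on S.  The
    cells through one point must be connected by links among themselves, not
    pairwise linked: this lets four cells meet at a corner. *)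
Definition cell_cover (S : set T) (e : K) (C : complex) (A : cell C -> set T) :=
  [/\ forall x, closed (A x),
      forall p, S p -> exists x, A x p,
      forall p x y, S p -> A x p -> A y p -> connect (cell_rel (hit A [set p])) x y &
      forall x p q, A x p -> A x q -> S p -> S q -> ball p e q].

(** The only property of a surface that the bound on drawings needs. *)
Definition tiled_by (S : set T) (h : nat) := forall e : K, 0 < e ->
  exists (C : complex) (A : cell C -> set T),
    [/\ bd_bd C, betti_le C h & cell_cover S e A].

(** If the cells met by a connected set fell into two classes not linked to each
    other, the two unions of cells would cut the set into two closed parts. *)
Lemma connected_hit (S : set T) e (C : complex) (A : cell C -> set T) (Q : set T) x y :
  cell_cover S e A -> Q `<=` S -> connected Q -> hit A Q x -> hit A Q y ->
  connect (cell_rel (hit A Q)) x y.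
Proof.
move=> [Acl Acov Aloc _] QS cQ /asboolP [p Qp Axp] /asboolP [q Qq Ayq].
have sub r : Q r -> subpred (hit A [set r]) (hit A Q).
  by move=> Qr z /asboolP [_ -> Azr]; apply/asboolP; exists r.
pose X1 z := connect (cell_rel (hit A Q)) x z && hit A Q z.
pose X2 z := ~~ connect (cell_rel (hit A Q)) x z && hit A Q z.
pose U1 := \bigcup_(z in [set z | X1 z]) A z.
pose U2 := \bigcup_(z in [set z | X2 z]) A z.
have cl1 : closed U1 by apply: closed_bigcup => // ; exact: finite_finset.
have cl2 : closed U2 by apply: closed_bigcup => // ; exact: finite_finset.
have U12 r : Q r -> U1 r -> U2 r -> False.
  move=> Qr [z1 /= /andP [x1 _] A1] [z2 /= /andP [x2 _] A2].
  case/negP: x2; apply: connect_trans x1 _.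
  by apply: cell_rel_sub (Aloc _ _ _ (QS _ Qr) A1 A2); exact: sub.
have hitQ r z : Q r -> A z r -> hit A Q z by move=> ? ?; apply/asboolP; exists r.
have U12c r : Q r -> U1 r \/ U2 r.
  move=> Qr; have [z Az] := Acov _ (QS _ Qr).
  case: (boolP (connect (cell_rel (hit A Q)) x z)) => xz.
    by left; exists z => //=; rewrite /X1 xz (hitQ r).
  by right; exists z => //=; rewrite /X2 xz (hitQ r).
have QU1 : Q `&` U1 = Q.
  apply: cQ; first by exists p; split => //; exists x => //=; rewrite /X1 connect0 (hitQ p).
    exists (~` U2); first exact: closed_openC.
    rewrite eqEsubset; split=> r [Qr Ur]; split=> //; first by move=> /(U12 _ Qr Ur).
    by case: (U12c _ Qr).
  by exists U1.
have [_ [z /andP [xz _] Azq]] : (Q `&` U1) q by rewrite QU1.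
apply: connect_trans xz _.
by apply: cell_rel_sub (Aloc _ _ _ (QS _ Qq) Azq Ayq); exact: sub.
Qed.

End Covers.

(** A drawing in T of the graph with vertices 0, ..., n - 1 and edge list es; the
    points of S are covered by arbitrarily small cells.  Every arc is cut into
    thirds: the outer thirds, the stubs, are attached to the end vertices and
    form with them the stars, the middle thirds are kept apart from each other. *)
Section Drawing.
Local Open Scope classical_set_scope.
Local Open Scope ring_scope.
Variables (K : realType) (T : normedModType K) (n : nat) (es : seq (nat * nat)).
Hypothesis n_gt0 : (0 < n)%N.
Hypothesis es_lt : ordered_edges n es.
Hypothesis es_uniq : uniq es.
Hypothesis es_tri :
  no_triangle es.
Let m := size es.
Let src : 'I_m -> 'I_n := esrc es_lt.
Let tgt : 'I_m -> 'I_n := etgt es_lt.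

Variables (S : set T) (h : nat).
Hypothesis tiled : tiled_by S h.
Variables (pos : 'I_n -> T) (arc : 'I_m -> K -> T).
Hypothesis pos_inj : injective pos.
Hypothesis posS : forall v, S (pos v).
Hypothesis arc_cont : forall e, {within `[0, 1], continuous (arc e)}.
Hypothesis arcS : forall e (t : K), `[0, 1]%classic t -> S (arc e t).
Hypothesis arc_inj : forall e, set_inj `[0, 1] (arc e).
Hypothesis arc0 : forall e, arc e 0 = pos (src e).
Hypothesis arc1 : forall e, arc e 1 = pos (tgt e).
Hypothesis arc_pos : forall e (t : K) w, `]0, 1[%classic t -> arc e t <> pos w.
Hypothesis arc_arc : forall e e' (t t' : K), `]0, 1[%classic t -> `]0, 1[%classic t' ->
  arc e t = arc e' t' -> e = e'.

Definition third (b : bool) : set K := if b then `[2/3, 1]%classic else `[0, 1/3]%classic.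
Definition end_of (b : bool) (e : 'I_m) := if b then tgt e else src e.
Definition stub (eb : 'I_m * bool) : set T := arc eb.1 @` third eb.2.
Definition star (v : 'I_n) : set T :=
  \bigcup_(i in [set i : option ('I_m * bool) | if i is Some eb then end_of eb.2 eb.1 = v else True])
    if i is Some eb then stub eb else [set pos v].
Definition middle (e : 'I_m) : set T := arc e @` `[1/3, 2/3].

Lemma sub_itv_cont e (a b : K) : 0 <= a -> b <= 1 -> {within `[a, b], continuous (arc e)}.
Proof.
move=> a0 b1; have sub : (`[a, b]%classic : set K) `<=` (`[0, 1]%classic : set K).
  by move=> t /=; rewrite !in_itv /= => /andP [? ?]; apply/andP; split; lra.
exact: (continuous_subspaceW sub (@arc_cont e)).
Qed.

Lemma stub_compact eb : compact (stub eb).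
Proof.
by case: eb => e []; apply: continuous_compact; try exact: segment_compact;
  apply: sub_itv_cont; lra.
Qed.

Lemma stub_connected eb : connected (stub eb).
Proof.
by case: eb => e []; apply: connected_continuous_connected; try exact: segment_connected;
  apply: sub_itv_cont; lra.
Qed.

Lemma middle_compact e : compact (middle e).
Proof.
by apply: continuous_compact; [apply: sub_itv_cont; lra|exact: segment_compact].
Qed.

Lemma middle_connected e : connected (middle e).
Proof.
by apply: connected_continuous_connected; [exact: segment_connected|apply: sub_itv_cont; lra].
Qed.

Lemma stub_pos e b : stub (e, b) (pos (end_of b e)).
Proof.
case: b; rewrite /stub /=; [exists 1|exists 0] => //=; rewrite in_itv /=; lra.
Qed.

Lemma third_inj b b' t : third b t -> third b' t -> b = b'.
Proof.
by case: b b' => -[] //=; rewrite !in_itv /= => /andP [? ?] /andP [? ?]; exfalso; lra.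
Qed.

Lemma star_pos v : star v (pos v). Proof. by exists None. Qed.

Lemma star_stub e b p : stub (e, b) p -> star (end_of b e) p.
Proof. by exists (Some (e, b)). Qed.

Lemma star_compact v : compact (star v).
Proof.
rewrite /star -bigsetU_fset_set; last exact: finite_finset.
apply: bigsetU_compact => -[eb|] _; [exact: stub_compact|exact: compact_set1].
Qed.

Lemma star_connected v : connected (star v).
Proof.
apply: bigcup_connected.
  by exists (pos v) => -[[e b]|] //= <-; exact: stub_pos.
move=> [eb _|_]; [exact: stub_connected|exact: connected1].
Qed.

Lemma starP v p : star v p -> p = pos v \/
  exists e b t, [/\ end_of b e = v, third b t, `]0, 1[%classic t & p = arc e t].
Proof.
case=> -[[e b]|] /=; last by move=> _ ->; left.
move=> eb [t tb <-]; have t01 : `[0, 1]%classic t.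
  by case: b tb {eb} => /=; rewrite !in_itv /= => /andP [? ?]; apply/andP; split; lra.
case: (eqVneq t 0) => [t0|t0].
  left; move: eb tb; rewrite t0 arc0; case: b => /= [|->] //.
  by rewrite in_itv /= => _ /andP [? _]; exfalso; lra.
case: (eqVneq t 1) => [t1|t1].
  left; move: eb tb; rewrite t1 arc1; case: b => /= [->|] //.
  by rewrite in_itv /= => _ /andP [_ ?]; exfalso; lra.
right; exists e, b, t; split=> //.
move: t01; rewrite /= !in_itv /= => /andP [? ?].
by rewrite !lt_neqAle t1 eq_sym t0; apply/andP.
Qed.

Lemma middleP e p : middle e p -> exists t, [/\ 1/3 <= t <= 2/3, `]0, 1[%classic t & p = arc e t].
Proof.
case=> t /=; rewrite in_itv /= => t13 <-; exists t; split=> //.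
by rewrite in_itv /=; apply/andP; move/andP: t13 => [? ?]; split; lra.
Qed.

Lemma arc_arc_t e e' t t' : `]0, 1[%classic t -> `]0, 1[%classic t' ->
  arc e t = arc e' t' -> e = e' /\ t = t'.
Proof.
move=> t01 t01' E; have ee := arc_arc t01 t01' E; split=> //.
move: E; rewrite -ee => /(@arc_inj e); apply; rewrite inE /=; move: t01 t01';
  rewrite /= !in_itv /= => /andP [? ?] /andP [? ?]; apply/andP; split; exact: ltW.
Qed.

Lemma star_disjoint u v p : star u p -> star v p -> u = v.
Proof.
move=> /starP [->|[e [b [t [eb tb t01 ->]]]]] /starP [pe|[e' [b' [t' [eb' tb' t01' pe]]]]].
- exact: pos_inj.
- by case: (arc_pos t01' (esym pe)).
- by case: (arc_pos t01 pe).
have [ee tt] := arc_arc_t t01 t01' pe.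
rewrite -eb -eb' -ee; by congr end_of; apply: third_inj tb _; rewrite tt.
Qed.

Lemma middle_disjoint e e' p : middle e p -> middle e' p -> e = e'.
Proof.
by move=> /middleP [t [_ t01 ->]] /middleP [t' [_ t01' E]]; apply: arc_arc E.
Qed.

Lemma star_middle v e p : star v p -> middle e p -> v = src e \/ v = tgt e.
Proof.
move=> /starP [->|[e' [b [t [<- tb t01 ->]]]]] /middleP [t' [_ t01' E]].
  by case: (arc_pos t01' (esym E)).
by rewrite (arc_arc t01 t01' E); case: b {tb}; [right|left].
Qed.

Lemma starS v : star v `<=` S.
Proof.
move=> p /starP [->|[e [b [t [_ _ t01 ->]]]]]; first exact: posS.
by apply: arcS; move: t01; rewrite /= !in_itv /= => /andP [? ?]; apply/andP; split; exact: ltW.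
Qed.

Lemma middleS e : middle e `<=` S.
Proof.
move=> p /middleP [t [_ t01 ->]].
by apply: arcS; move: t01; rewrite /= !in_itv /= => /andP [? ?]; apply/andP; split; exact: ltW.
Qed.

(** All the sets that have to be disjoint are compact, so one positive distance
    separates them; cells smaller than that cannot confuse them. *)
Lemma apart_scale : exists2 e : K, 0 < e &
  [/\ forall u v p q, star u p -> star v q -> ball p e q -> u = v,
     forall a b p q, middle a p -> middle b q -> ball p e q -> a = b &
     forall v a p q, star v p -> middle a q -> ball p e q -> v = src a \/ v = tgt a].
Proof.
have disj (A B : set T) (P : Prop) : compact A -> compact B ->
    (forall p, A p -> B p -> P) ->
    \forall e \near 0^'+, forall a b, A a -> B b -> ball a e b -> P.
  move=> cA cB AB; have [HP|nP] := pselect P; first by near=> e.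
  have AB0 : A `&` B = set0 by rewrite -subset0 => p [Ap Bp]; exact/nP/AB/Bp.
  have := disjoint_compacts_apart cA cB AB0; apply: filterS => e H a b Aa Bb ab.
  by case: (H _ _ Aa Bb).
have nss : \forall e \near (0:K)^'+, forall u v p q, star u p -> star v q -> ball p e q -> u = v.
  apply: filter_forall => u; apply: filter_forall => v.
  by apply: disj; try exact: star_compact; exact: star_disjoint.
have nmm : \forall e \near (0:K)^'+, forall a b p q, middle a p -> middle b q -> ball p e q -> a = b.
  apply: filter_forall => a; apply: filter_forall => b.
  by apply: disj; try exact: middle_compact; exact: middle_disjoint.
have nsm : \forall e \near (0:K)^'+, forall v a p q, star v p -> middle a q -> ball p e q -> v = src a \/ v = tgt a.
  apply: filter_forall => v; apply: filter_forall => a.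
  by apply: disj; [exact: star_compact|exact: middle_compact|exact: star_middle].
have [e [e0 [H1 [H2 H3]]]] : exists e : K, 0 < e /\
  (forall u v p q, star u p -> star v q -> ball p e q -> u = v) /\
  (forall a b p q, middle a p -> middle b q -> ball p e q -> a = b) /\
  (forall v a p q, star v p -> middle a q -> ball p e q -> v = src a \/ v = tgt a).
  near (0:K)^'+ => e; exists e; split; last split; last split.
  - near: e; exact: nbhs_right_gt.
  - near: e; exact: nss.
  - near: e; exact: nmm.
  - near: e; exact: nsm.
by exists e.
Unshelve. all: end_near. Qed.

(** A fine cover makes the graph a minor of the complex: the class of a vertex
    consists of the cells met by its star and of the cells that lead from there
    along the middle thirds of outgoing edges, up to the star of the target. *)
Lemma drawing_bound : (m.+2 <= n + h + m./2)%N \/ (m < n + h)%N.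
Proof.
have [e e0 [SS MM SM]] := apart_scale.
have [C [A [bdC bettiC cov]]] := tiled e0.
have [Acl Acov Aloc Asmall] := cov.
pose HS v := hit A (star v).
pose HM a := hit A (middle a).
have HSS u v x : HS u x -> HS v x -> u = v.
  move=> /asboolP [p up Axp] /asboolP [q vq Axq]; apply: (SS _ _ _ _ up vq).
  by apply: Asmall Axp Axq _ _; [exact: starS up|exact: starS vq].
have HMM a b x : HM a x -> HM b x -> a = b.
  move=> /asboolP [p up Axp] /asboolP [q vq Axq]; apply: (MM _ _ _ _ up vq).
  by apply: Asmall Axp Axq _ _; [exact: middleS up|exact: middleS vq].
have HSM v a x : HS v x -> HM a x -> v = src a \/ v = tgt a.
  move=> /asboolP [p up Axp] /asboolP [q vq Axq]; apply: (SM _ _ _ _ up vq).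
  by apply: Asmall Axp Axq _ _; [exact: starS up|exact: middleS vq].
have st a : src a != tgt a := esrc_etgt es_lt a.
have i01 (t : K) : 1/3 <= t <= 2/3 -> `[0, 1]%classic t.
  by rewrite /= in_itv /= => /andP [? ?]; apply/andP; split; lra.
have /fin_all_exists [x0 x0P] : forall a, exists x, A x (arc a (1/3)).
  by move=> a; apply: Acov; apply: arcS; apply: i01; lra.
have /fin_all_exists [y1 y1P] : forall a, exists x, A x (arc a (2/3)).
  by move=> a; apply: Acov; apply: arcS; apply: i01; lra.
have x0S a : HS (src a) (x0 a).
  apply/asboolP; exists (arc a (1/3)) => //; apply: (@star_stub a false).
  by exists (1/3) => //=; rewrite in_itv /=; lra.
have y1S a : HS (tgt a) (y1 a).
  apply/asboolP; exists (arc a (2/3)) => //; apply: (@star_stub a true).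
  by exists (2/3) => //=; rewrite in_itv /=; lra.
have x0M a : HM a (x0 a).
  by apply/asboolP; exists (arc a (1/3)) => //; exists (1/3) => //=; rewrite in_itv /=; lra.
have y1M a : HM a (y1 a).
  by apply/asboolP; exists (arc a (2/3)) => //; exists (2/3) => //=; rewrite in_itv /=; lra.
(* The part Kp a of the middle third of a which is given to the source of a:
   what can be reached without touching the star of the target. *)
pose Y a x := HM a x && ~~ HS (tgt a) x.
have x0Y a : Y a (x0 a).
  by rewrite /Y x0M; apply: contra (st a) => /(HSS _ _ _ (x0S a)) ->.
pose Kp a x := connect (cell_rel (Y a)) (x0 a) x.
have KpY a x : Kp a x -> Y a x by move=> ax; exact: cell_rel_mem ax (x0Y a).
pose L v x := HS v x || [exists a, (src a == v) && Kp a x].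
have L_uniq u v x : L u x -> L v x -> u = v.
  have SK w a : HS w x -> Kp a x -> w = src a.
    move=> wx /KpY /andP [ax nax]; case: (HSM _ _ _ wx ax) => // wt.
    by rewrite wt in wx; rewrite wx in nax.
  case/orP => [ux|/existsP [a /andP [/eqP au ax]]];
    case/orP => [vx|/existsP [b /andP [/eqP bv bx]]].
  - exact: HSS ux vx.
  - by rewrite -bv; exact: SK.
  - by rewrite -au; apply/esym; exact: SK.
  - by rewrite -au -bv; congr src; case/andP: (KpY _ _ ax) (KpY _ _ bx) => ? _ /andP [? _];
      apply: HMM; eassumption.
pose lab x := [pick v | L v x].
have labP x v : (lab x == Some v) = L v x.
  rewrite /lab; case: pickP => [w Lw|no]; last by rewrite no.
  apply/eqP/idP => [[<-]//|Lv]; by rewrite (L_uniq _ _ _ Lw Lv).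
have sub_lab (P : pred (cell C)) v : subpred P (L v) -> forall x y,
    connect (cell_rel P) x y -> connect (same_lab lab) x y.
  move=> PL x y; apply: connect_sub => {}x {}y /and3P [xy /PL Px /PL Py].
  apply: connect1; move: Px Py; rewrite -!labP => /eqP lx /eqP ly.
  by rewrite /same_lab xy lx ly eqxx.
have to_root v x : L v x -> exists2 z, HS v z & connect (cell_rel (L v)) z x.
  case/orP => [vx|/existsP [a /andP [/eqP av ax]]]; first by exists x.
  exists (x0 a); first by rewrite -av.
  have KL : subpred (Kp a) (L v).
    by move=> z az; apply/orP; right; apply/existsP; exists a; rewrite av eqxx.
  apply: (cell_rel_sub KL); case/connectP: (ax) => p.
  have : Kp a (x0 a) by exact: connect0.
  elim: p (x0 a) => [|z p IH] w aw /=; first by move=> _ ->.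
  case/andP => wz pz lp; have az : Kp a z by apply: connect_trans aw _; exact: connect1.
  apply: (connect_trans (y := z)); last exact: IH.
  by apply: connect1; case/and3P: wz => wz _ _; rewrite /cell_rel wz aw az.
have L_conn v x y : L v x -> L v y -> connect (cell_rel (L v)) x y.
  move=> /to_root [x' x'S xx'] /to_root [y' y'S yy'].
  apply: connect_trans yy'; rewrite cell_rel_sym; apply: connect_trans xx'.
  rewrite cell_rel_sym; apply: (@cell_rel_sub _ (HS v)).
    by move=> z vz; apply/orP; left.
  exact: connected_hit cov (@starS v) (@star_connected v) x'S y'S.
(* Walking on along the middle third, some link must leave Kp a, and it can
   only enter the star of the target. *)
have gate_ex a : exists d : link C,
  (lab (lsrc d), lab (ltgt d)) = (Some (src a), Some (tgt a)) \/
  (lab (lsrc d), lab (ltgt d)) = (Some (tgt a), Some (src a)).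
  have [x [y [xy ax ay]]] : exists x y, [/\ linked x y, Kp a x & HS (tgt a) y].
    apply: contrapT => no.
    have : connect (cell_rel (HM a)) (x0 a) (y1 a).
      exact: connected_hit cov (@middleS a) (@middle_connected a) (x0M a) (y1M a).
    have aK0 : Kp a (x0 a) by exact: connect0.
    have step x y : Kp a x -> cell_rel (HM a) x y -> Kp a y.
      move=> ax /and3P [xy _ ya]; apply: (connect_trans (y := x)) => //; apply: connect1.
      rewrite /cell_rel xy (KpY _ _ ax) /= /Y ya /=.
      by apply/negP => yt; apply: no; exists x, y.
    case/connectP => p pp lp; have : Kp a (y1 a).
      rewrite lp; elim: p (x0 a) aK0 pp {lp} => [|z p IH] w aw //=.
      by case/andP => /(step _ _ aw) az; exact: IH.
    by move=> /KpY /andP []; rewrite y1S.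
  have lx : lab x = Some (src a).
    by apply/eqP; rewrite labP; apply/orP; right; apply/existsP; exists a; rewrite eqxx.
  have ly : lab y = Some (tgt a) by apply/eqP; rewrite labP; apply/orP; left.
  by case/existsP: xy => d /orP [] /andP [/eqP <- /eqP <-] in lx ly *; exists d; [left|right];
    rewrite lx ly.
have /fin_all_exists [gate gateP] := gate_ex.
apply: (@minor_bound C h n m src tgt bdC bettiC n_gt0 _ lab gate) => //.
- exact: edges_girth4.
- move=> x y xy; case E: (lab x) => [v|] // _.
  have Lx : L v x by rewrite -labP E.
  have Ly : L v y by rewrite -labP -xy E.
  exact: (sub_lab (L v) v (fun _ => id) _ _ (L_conn _ _ _ Lx Ly)).
- move=> v; have [x Ax] := Acov _ (posS v).
  exists x; apply/eqP; rewrite labP; apply/orP; left; apply/asboolP; exists (pos v) => //.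
  exact: star_pos.
- move=> a b ab; apply: (edge_inj es_uniq).
  have tab : touches es_lt a =1 touches es_lt b.
    move=> v; have Ga := gateP a; have Gb := gateP b; rewrite -ab in Gb.
    rewrite /touches -/src -/tgt.
    case: Ga => Ga; case: Gb; rewrite Ga => E; have /= E1 := congr1 (odflt v \o fst) E;
      have /= E2 := congr1 (odflt v \o snd) E; rewrite -/src -/tgt in E1 E2;
      by rewrite E1 E2 // orbC.
  by rewrite (edge_ends (st a)) ?(edge_ends (e := b) (st a)) -?tab /touches ?eqxx ?orbT.
Qed.

End Drawing.

(** * Cutting the plane into thin cones *)

Section Cones.
Local Open Scope classical_set_scope.
Local Open Scope ring_scope.
Variable K : realType.

(** Quarter turns moving quadrant s to the first one. *)
Definition rot (s : nat) (p : K * K) : K * K :=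
  match s with
  | 0%N => p
  | 1%N => (p.2, - p.1)
  | 2%N => (- p.1, - p.2)
  | _ => (- p.2, p.1)
  end.

(** In its quadrant, the sector is the cone over one of m equal pieces of the
    segment from (1, 0) to (0, 1).  There are 4 m sectors; dividing the l1 circle
    instead of the round one keeps everything piecewise linear. *)
Definition sector (m : nat) (i : nat) (p : K * K) : Prop :=
  let q := rot (i %/ m) p in
  [/\ 0 <= q.1, 0 <= q.2, (i %% m)%:R * (q.1 + q.2) <= m%:R * q.2 &
      m%:R * q.2 <= (i %% m).+1%:R * (q.1 + q.2)].

Variable m : nat.
Hypothesis m_gt0 : (0 < m)%N.

Lemma mR_gt0 : 0 < m%:R :> K. Proof. by rewrite ltr0n. Qed.

Lemma sector_cover p : exists2 i, (i < 4 * m)%N & sector m i p.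
Proof.
have [s s4 [q1 q2]] : exists2 s, (s < 4)%N & 0 <= (rot s p).1 /\ 0 <= (rot s p).2.
  case: p => a b; case: (lerP 0 a) => a0; case: (lerP 0 b) => b0.
  - by exists 0%N.
  - by exists 3%N => //=; split; lra.
  - by exists 1%N => //=; split; lra.
  - by exists 2%N => //=; split; lra.
set x := (rot s p).1 in q1; set y := (rot s p).2 in q2.
have mR := mR_gt0.
have ex : exists k, m%:R * y <= k.+1%:R * (x + y).
  by exists m.-1; rewrite prednK // ler_pM2l // lerDr.
case: (ex_minnP ex) => k kP kmin.
have km : (k < m)%N.
  rewrite -(prednK m_gt0) ltnS; apply: kmin; rewrite prednK // ler_pM2l //; lra.
exists (s * m + k)%N; first by move: s4 km; clear; nia.
rewrite /sector divnMDl // divn_small // addn0 modnMDl modn_small //.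
split=> //; case: k kP kmin km => [|k] kP kmin km; first by rewrite mul0r mulr_ge0 // ltW.
rewrite leNgt; apply/negP => /ltW /kmin; by rewrite ltnn.
Qed.

Lemma sector0 i : sector m i (0, 0).
Proof.
by rewrite /sector; case: (i %/ m)%N => [|[|[|s]]] /=; rewrite ?oppr0 addr0 !mulr0.
Qed.

(** A sector after rotation to the first quadrant. *)
Definition in_sec (k : nat) (x y : K) :=
  [/\ 0 <= x, 0 <= y, k%:R * (x + y) <= m%:R * y & m%:R * y <= k.+1%:R * (x + y)].

Lemma in_sec_same k k' x y : (x, y) != (0, 0) -> in_sec k x y -> in_sec k' x y ->
  (k <= k'.+1)%N /\ (k' <= k.+1)%N.
Proof.
move=> xy [x0 y0 h1 h2] [_ _ h3 h4].
have xy0 : 0 < x + y.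
  rewrite lt_neqAle addr_ge0 // andbT; apply/eqP => E; case/negP: xy.
  by rewrite xpair_eqE; apply/andP; split; apply/eqP; lra.
by split; rewrite -(ler_nat K) -(ler_pM2r xy0); [exact: le_trans h1 h4|exact: le_trans h3 h2].
Qed.

Lemma in_sec_next k k' x y : (k < m)%N -> (x, y) != (0, 0) ->
  in_sec k x y -> in_sec k' y (- x) -> k.+1 = m /\ k' = 0%N.
Proof.
move=> km xy [x0 y0 _ h2] [_ x0' h3 _].
have x00 : x = 0 by apply/eqP; rewrite eq_le x0 andbT; lra.
move: h2 h3; rewrite x00 add0r oppr0 addr0 mulr0.
have y_gt0 : 0 < y.
  rewrite lt_neqAle y0 andbT; apply/eqP => E; case/negP: xy.
  by rewrite xpair_eqE x00 -E !eqxx.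
rewrite ler_pM2r // ler_nat pmulr_lle0 // => h2 h3; split; first by apply/eqP; rewrite eqn_leq km.
by apply/eqP; rewrite -leqn0 -(ler_nat K).
Qed.

Lemma in_sec_opp k k' x y : in_sec k x y -> in_sec k' (- x) (- y) -> (x, y) = (0, 0).
Proof. by move=> [? ? _ _] [? ? _ _]; congr (_, _); lra. Qed.

(** Away from the apex two sectors meet only if they are consecutive in the cyclic
    order. *)
Lemma sector_meet i j p : p != (0, 0) -> (i < 4 * m)%N -> (j < 4 * m)%N ->
  sector m i p -> sector m j p ->
  [\/ i = j, j = (i.+1 %% (4 * m))%N | i = (j.+1 %% (4 * m))%N].
Proof.
case: p => a b p0 i4 j4.
have n0 (x y : K) : (x == 0) && (y == 0) = (a == 0) && (b == 0) -> (x, y) != (0, 0).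
  by rewrite xpair_eqE => ->; rewrite -xpair_eqE.
have stepI k l : (k < 4 * m)%N -> (l < 4 * m)%N -> (l = k.+1 \/ k.+1 = (4 * m)%N /\ l = 0%N) ->
    l = (k.+1 %% (4 * m))%N.
  by move=> k4 l4 [E|[-> ->]]; [rewrite -E modn_small|rewrite modnn].
have near k l : (k <= l.+1)%N /\ (l <= k.+1)%N -> [\/ k = l, l = k.+1 | k = l.+1].
  move=> [h1 h2]; case: (ltngtP k l) => kl; [constructor 2|constructor 3|constructor 1] => //; lia.
have := divn_eq i m; have := divn_eq j m; rewrite /sector.
have := ltn_pmod i m_gt0; have := ltn_pmod j m_gt0.
have : (i %/ m < 4)%N by rewrite ltn_divLR.
have : (j %/ m < 4)%N by rewrite ltn_divLR.
move: (i %/ m)%N (i %% m)%N (j %/ m)%N (j %% m)%N => s k s' k' s'4 s4 k'm km jE iE.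
move=> si sj.
have same x y : (x == 0) && (y == 0) = (a == 0) && (b == 0) -> s = s' -> in_sec k x y -> in_sec k' x y ->
  [\/ i = j, j = (i.+1 %% (4 * m))%N | i = (j.+1 %% (4 * m))%N].
  move=> xy ss h1 h2; case: (near _ _ (in_sec_same (n0 _ _ xy) h1 h2)) => E.
  - by constructor 1; rewrite iE jE ss E.
  - by constructor 2; apply: stepI => //; left; rewrite iE jE ss E addnS.
  - by constructor 3; apply: stepI => //; left; rewrite iE jE ss E addnS.
have next x y : (x == 0) && (y == 0) = (a == 0) && (b == 0) -> (s' = s.+1 \/ s = 3 /\ s' = 0)%N ->
   in_sec k x y -> in_sec k' y (- x) ->
  [\/ i = j, j = (i.+1 %% (4 * m))%N | i = (j.+1 %% (4 * m))%N].
  move=> xy ss h1 h2; have [E E'] := in_sec_next km (n0 _ _ xy) h1 h2.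
  constructor 2; apply: stepI => //; rewrite iE jE E' addn0 -addnS E.
  by case: ss => [->|[-> ->]]; [left; rewrite mulSn addnC|right; split => //; rewrite -mulSnr].
have prev x y : (x == 0) && (y == 0) = (a == 0) && (b == 0) -> (s = s'.+1 \/ s' = 3 /\ s = 0)%N ->
   in_sec k' x y -> in_sec k y (- x) ->
  [\/ i = j, j = (i.+1 %% (4 * m))%N | i = (j.+1 %% (4 * m))%N].
  move=> xy ss h1 h2; have [E E'] := in_sec_next k'm (n0 _ _ xy) h1 h2.
  constructor 3; apply: stepI => //; rewrite iE jE E' addn0 -addnS E.
  by case: ss => [->|[-> ->]]; [left; rewrite mulSn addnC|right; split => //; rewrite -mulSnr].
have opp x y : (x == 0) && (y == 0) = (a == 0) && (b == 0) -> in_sec k x y -> in_sec k' (- x) (- y) ->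
  [\/ i = j, j = (i.+1 %% (4 * m))%N | i = (j.+1 %% (4 * m))%N].
  by move=> xy h1 h2; have := n0 _ _ xy; rewrite (in_sec_opp h1 h2) eqxx.
have e0 : (a == 0) && (b == 0) = (a == 0) && (b == 0) by [].
have e1 : (b == 0) && (- a == 0) = (a == 0) && (b == 0) by rewrite oppr_eq0 andbC.
have e2 : (- a == 0) && (- b == 0) = (a == 0) && (b == 0) by rewrite !oppr_eq0.
have e3 : (- b == 0) && (a == 0) = (a == 0) && (b == 0) by rewrite oppr_eq0 andbC.
have [R0 [R1 [R2 R3]]] : rot 0 (a, b) = (a, b) /\ rot 1 (a, b) = (b, - a) /\
  rot 2 (a, b) = (- a, - b) /\ rot 3 (a, b) = (- b, a) by [].
case: s s4 iE si same next prev opp => [|[|[|[|//]]]] _ iE si same next prev opp;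
case: s' s'4 jE sj same next prev opp => [|[|[|[|//]]]] _ jE sj same next prev opp.
- exact: same e0 _ si sj.
- by apply: next e0 _ si sj; left.
- exact: opp e0 si sj.
- by apply: (prev _ _ e3 _ sj); [right|rewrite opprK].
- by apply: prev e0 _ sj si; left.
- exact: same e1 _ si sj.
- by apply: next e1 _ si sj; left.
- by apply: opp e1 si _; rewrite opprK.
- by apply: (opp _ _ e2 si); rewrite !opprK.
- by apply: prev e1 _ sj si; left.
- exact: same e2 _ si sj.
- by apply: (next _ _ e2 _ si); [left|rewrite opprK].
- by apply: (next _ _ e3 _ si); [right|rewrite opprK].
- by apply: (opp _ _ e3 si); rewrite opprK.
- by apply: (prev _ _ e2 _ sj); [left|rewrite opprK].
- exact: same e3 _ si sj.
Qed.

Lemma rot_norm1 s p : `|(rot s p).1| + `|(rot s p).2| = `|p.1| + `|p.2|.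
Proof. by case: s => [|[|[|s]]] //=; rewrite ?normrN // addrC. Qed.

Lemma rot_dist s p q (e : K) : `|(rot s p).1 - (rot s q).1| < e -> `|(rot s p).2 - (rot s q).2| < e ->
  `|p.1 - q.1| < e /\ `|p.2 - q.2| < e.
Proof.
by case: s => [|[|[|s]]] //=; rewrite -?opprD ?normrN; move=> h1 h2; split;
  rewrite // ?[_ - p.2]distrC // -normrN opprD opprK.
Qed.

(** Two points of a sector whose l1 norms are close are themselves close: the
    bound has one term for the norms and one for the width of the sector. *)
Lemma sector_small i p q (r e : K) : sector m i p -> sector m i q ->
  `|p.1| + `|p.2| <= 1 -> `|q.1| + `|q.2| <= 1 ->
  `|(`|p.1| + `|p.2|) - (`|q.1| + `|q.2|)| <= r ->
  r + r + m%:R^-1 < e -> `|p.1 - q.1| < e /\ `|p.2 - q.2| < e.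
Proof.
rewrite /sector -(rot_norm1 (i %/ m)%N p) -(rot_norm1 (i %/ m)%N q) => sp sq np nq npq re.
have := @rot_dist (i %/ m)%N p q e; move: sp sq np nq npq.
case: (rot _ p) (rot _ q) => [x y] [x' y'] /= [x0 y0 h1 h2] [x0' y0' h1' h2'].
rewrite (ger0_norm x0) (ger0_norm y0) (ger0_norm x0') (ger0_norm y0') => np nq npq.
have mR := mR_gt0.
have km : (i %% m < m)%N by rewrite ltn_pmod.
pose w : K := m%:R^-1; pose u : K := (i %% m)%:R * w.
have w0 : 0 < w by rewrite invr_gt0.
have u0 : 0 <= u by rewrite mulr_ge0 // ltW.
have u1 : u <= 1 by rewrite ler_pdivrMr // mul1r ler_nat ltnW.
have scale c z t : c * z <= m%:R * t -> c * w * z <= t.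
  by move=> h; rewrite mulrAC ler_pdivrMr // [t * _]mulrC.
have scale' c z t : m%:R * t <= c * z -> t <= c * w * z.
  by move=> h; rewrite mulrAC ler_pdivlMr // [t * _]mulrC.
have uw : (i %% m).+1%:R * w = u + w by rewrite -natr1 mulrDl mul1r.
move/scale: h1; move/scale': h2; move/scale: h1'; move/scale': h2'; rewrite uw -/u.
move: npq re; rewrite -/w ler_norml => /andP [r1 r2] re l4 l3 l2 l1.
by apply; rewrite ltr_norml; apply/andP; split; nra.
Qed.

End Cones.

(** * Polyhedral models of the two surfaces *)

Section Continuity.
Local Open Scope classical_set_scope.
Local Open Scope ring_scope.
Variables (K : realType) (X : topologicalType).
Implicit Types f g : X -> K.

Lemma closed_le_fun f g : continuous f -> continuous g -> closed [set x | f x <= g x].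
Proof.
move=> cf cg; have -> : [set x | f x <= g x] = (fun x => g x - f x) @^-1` [set y | 0 <= y].
  by apply/seteqP; split=> x /=; rewrite subr_ge0.
apply: closed_comp; last exact: closed_ge.
by move=> x _; apply: continuousB; [exact: cg|exact: cf].
Qed.

Lemma open_lt_fun f g : continuous f -> continuous g -> open [set x | f x < g x].
Proof.
move=> cf cg; have -> : [set x | f x < g x] = (fun x => g x - f x) @^-1` [set y | 0 < y].
  by apply/seteqP; split=> x /=; rewrite subr_gt0.
apply: open_comp; last exact: open_gt.
by move=> x _; apply: continuousB; [exact: cg|exact: cf].
Qed.

Lemma cont_cst (k : K) : continuous (fun _ : X => k).
Proof. by move=> x; exact: cst_continuous. Qed.

Lemma cont_add f g : continuous f -> continuous g -> continuous (fun x => f x + g x).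
Proof. by move=> cf cg x; apply: continuousD; [exact: cf|exact: cg]. Qed.

Lemma cont_opp f : continuous f -> continuous (fun x => - f x).
Proof. by move=> cf x; apply: continuousN; exact: cf. Qed.

Lemma cont_mul f g : continuous f -> continuous g -> continuous (fun x => f x * g x).
Proof. by move=> cf cg x; apply: continuousM; [exact: cf|exact: cg]. Qed.

Lemma fst_cont (Y Z : topologicalType) : continuous (fst : Y * Z -> Y).
Proof. by move=> x; exact: cvg_fst. Qed.

Lemma snd_cont (Y Z : topologicalType) : continuous (snd : Y * Z -> Z).
Proof. by move=> x; exact: cvg_snd. Qed.

Lemma closed_sector m i (f g : X -> K) : continuous f -> continuous g ->
  closed [set x | sector m i (f x, g x)].
Proof.
move=> cf cg; rewrite /sector; set s := (i %/ m)%N.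
have [c1 c2] : continuous (fun x => (rot s (f x, g x)).1) /\ continuous (fun x => (rot s (f x, g x)).2).
  case: s => [|[|[|s]]] /=; split; try exact: cf; try exact: cg;
    by apply: cont_opp; try exact: cf; try exact: cg.
set u := fun x => (rot s (f x, g x)).1 in c1.
set v := fun x => (rot s (f x, g x)).2 in c2.
have -> : [set x | [/\ 0 <= u x, 0 <= v x, (i %% m)%:R * (u x + v x) <= m%:R * v x &
    m%:R * v x <= (i %% m).+1%:R * (u x + v x)]] =
  ([set x | 0 <= u x] `&` [set x | 0 <= v x]) `&`
  ([set x | (i %% m)%:R * (u x + v x) <= m%:R * v x] `&` [set x | m%:R * v x <= (i %% m).+1%:R * (u x + v x)]).
  by apply/seteqP; split=> x /=; [case|case=> [[? ?] [? ?]]].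
have cuv (k : K) : continuous (fun x => k * (u x + v x)) := cont_mul (@cont_cst k) (cont_add c1 c2).
have cv (k : K) : continuous (fun x => k * v x) := cont_mul (@cont_cst k) c2.
have c0 := @cont_cst 0.
by apply: closedI; apply: closedI; [exact: closed_le_fun c0 c1|exact: closed_le_fun c0 c2
  |exact: closed_le_fun (@cuv _) (@cv _)|exact: closed_le_fun (@cv _) (@cuv _)].
Qed.

End Continuity.

Section Models.
Local Open Scope classical_set_scope.
Local Open Scope ring_scope.
Variable K : realType.

Definition torus_model : set ((K * K) * (K * K)) :=
  [set q | `|q.1.1| + `|q.1.2| = 1 /\ `|q.2.1| + `|q.2.2| = 1].

Definition octahedron : set (K * K * K) :=
  [set p | `|p.1.1| + `|p.1.2| + `|p.2| = 1].

Lemma ord_step n (i j : 'I_n) : j = (i.+1 %% n)%N :> nat -> ordS i = j.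
Proof. by move=> E; apply/val_inj. Qed.

(** Products of two sectors form a cyclic grid. *)
Lemma torus_tiled : tiled_by torus_model 2.
Proof.
move=> e e0.
have [m me] : exists m, (m.+1%:R)^-1 < e.
  exists (Num.bound e^-1); rewrite invf_plt ?posrE //.
  by apply: lt_trans (archi_boundP _) _; rewrite ?ltr_nat // invr_ge0 ltW.
pose N := (4 * m + 3)%N; have NE : N.+1 = (4 * m.+1)%N by rewrite /N; lia.
exists (torus_grid N N).
exists (fun x : 'I_N.+1 * 'I_N.+1 => [set q | sector m.+1 x.1 q.1 /\ sector m.+1 x.2 q.2]).
split; [exact: torus_bd_bd|exact: torus_betti|].
have n0 (p : K * K) : `|p.1| + `|p.2| = 1 -> p != (0, 0).
  by move=> p1; apply/eqP => p0; move: p1; rewrite p0 /= !normr0 addr0 => /eqP; rewrite eq_sym oner_eq0.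
split=> /=.
- move=> x; have -> : [set q : (K * K) * (K * K) | sector m.+1 x.1 q.1 /\ sector m.+1 x.2 q.2] =
    [set q | sector m.+1 x.1 (q.1.1, q.1.2)] `&` [set q | sector m.+1 x.2 (q.2.1, q.2.2)].
    by apply/seteqP; split=> -[[a b] [c d]].
  apply: closedI; apply: closed_sector => q.
  + by apply: (@continuous_comp _ _ _ fst fst); exact: fst_cont.
  + by apply: (@continuous_comp _ _ _ fst snd); [exact: fst_cont|exact: snd_cont].
  + by apply: (@continuous_comp _ _ _ snd fst); [exact: snd_cont|exact: fst_cont].
  + by apply: (@continuous_comp _ _ _ snd snd); exact: snd_cont.
- move=> q _; have [i iN qi] := @sector_cover K m.+1 isT q.1.
  have [j jN qj] := @sector_cover K m.+1 isT q.2.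
  rewrite -NE in iN jN; by exists (Ordinal iN, Ordinal jN).
- move=> q [i j] [i' j'] [q1 q2] [/= qi qj] [/= qi' qj'].
  pose P : pred ('I_N.+1 * 'I_N.+1) :=
    hit (C := torus_grid N N) (fun x : 'I_N.+1 * 'I_N.+1 => [set q | sector m.+1 x.1 q.1 /\ sector m.+1 x.2 q.2]) [set q].
  have PI (x : 'I_N.+1 * 'I_N.+1) : sector m.+1 x.1 q.1 -> sector m.+1 x.2 q.2 -> P x.
    by move=> ? ?; apply/asboolP; exists q.
  have stepc (x y : cell (torus_grid N N)) : linked x y -> P x -> P y ->
      connect (cell_rel (C := torus_grid N N) P) x y.
    by move=> xy Px Py; apply: connect1; rewrite /cell_rel xy Px Py.
  have lt4 (k : 'I_N.+1) : (k < 4 * m.+1)%N by rewrite -NE.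
  apply: (@connect_trans _ _ (i', j)).
    case: (sector_meet (isT : (0 < m.+1)%N) (n0 _ q1) (lt4 i) (lt4 i') qi qi'); rewrite -?NE.
    + by move=> /val_inj ->.
    + move=> /ord_step E; apply: stepc; try exact: PI.
      by apply/existsP; exists (true, (i, j)); rewrite /= E !eqxx.
    + move=> /ord_step E; apply: stepc; try exact: PI.
      by apply/existsP; exists (true, (i', j)); rewrite /= E !eqxx orbT.
  case: (sector_meet (isT : (0 < m.+1)%N) (n0 _ q2) (lt4 j) (lt4 j') qj qj'); rewrite -?NE.
  + by move=> /val_inj ->.
  + move=> /ord_step E; apply: stepc; try exact: PI.
    by apply/existsP; exists (false, (i', j)); rewrite /= E !eqxx.
  + move=> /ord_step E; apply: stepc; try exact: PI.
    by apply/existsP; exists (false, (i', j')); rewrite /= E !eqxx orbT.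
- move=> [i j] p q [/= pi pj] [/= qi qj] [p1 p2] [q1 q2].
  have small k (u v : K * K) : sector m.+1 k u -> sector m.+1 k v ->
      `|u.1| + `|u.2| = 1 -> `|v.1| + `|v.2| = 1 -> `|u.1 - v.1| < e /\ `|u.2 - v.2| < e.
    move=> uk vk u1 v1; apply: (@sector_small K m.+1 isT k u v 0) => //.
    + by rewrite u1.
    + by rewrite v1.
    + by rewrite u1 v1 subrr normr0.
    + by rewrite !add0r.
  by have [? ?] := small _ _ _ pi qi p1 q1; have [? ?] := small _ _ _ pj qj p2 q2.
Qed.

(** Sectors in longitude times bands in latitude.  At a pole all the sectors of
    one band meet; they form a cycle of links, which is why the grid has no cell
    for the pole itself. *)
Lemma octahedron_tiled : tiled_by octahedron 0.
Proof.
move=> e e0.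
have [m me] : exists m, 5 * (m.+1%:R)^-1 < e.
  exists (Num.bound (5 / e)).
  rewrite ltr_pdivrMr ?ltr0n // mulrC -ltr_pdivrMr //.
  by apply: lt_trans (archi_boundP _) _; rewrite ?ltr_nat // divr_ge0 // ltW.
have W0 : 0 < m.+1%:R :> K by rewrite ltr0n.
pose N := (4 * m + 3)%N; have NE : N.+1 = (4 * m.+1)%N by rewrite /N; lia.
pose band (j : nat) (c : K) := (2 * j)%:R <= m.+1%:R * (c + 1) <= (2 * j.+1)%:R.
exists (sphere_grid N m).
exists (fun x : 'I_N.+1 * 'I_m.+1 => [set p | sector m.+1 x.1 p.1 /\ band x.2 p.2]).
split; [exact: sphere_bd_bd|exact: sphere_betti|].
split=> /=.
- move=> x; have -> : [set p : K * K * K | sector m.+1 x.1 p.1 /\ band x.2 p.2] =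
    [set p | sector m.+1 x.1 (p.1.1, p.1.2)] `&`
    ([set p | (2 * x.2)%:R <= m.+1%:R * (p.2 + 1)] `&` [set p | m.+1%:R * (p.2 + 1) <= (2 * x.2.+1)%:R]).
    by apply/seteqP; split=> -[[a b] c] /=; [case=> ? /andP [? ?]|case=> ? [? ?]; split=> //; apply/andP].
  have cc : continuous (fun p : K * K * K => m.+1%:R * (p.2 + 1)).
    by apply: cont_mul; [exact: cont_cst|apply: cont_add; [exact: snd_cont|exact: cont_cst]].
  have cst := @cont_cst K (K * K * K)%type.
  apply: closedI; last by apply: closedI; apply: closed_le_fun.
  apply: closed_sector => p.
  + by apply: (@continuous_comp _ _ _ fst fst); exact: fst_cont.
  + by apply: (@continuous_comp _ _ _ fst snd); [exact: fst_cont|exact: snd_cont].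
- move=> p Op; have [i iN pi] := @sector_cover K m.+1 isT p.1.
  have : `|p.2| <= 1 by rewrite -Op lerDr addr_ge0.
  rewrite ler_norml => /andP [c1 c2].
  have ex : exists j, m.+1%:R * (p.2 + 1) <= (2 * j.+1)%:R.
    by exists m; rewrite natrM mulrC ler_pM2r //; lra.
  case: (ex_minnP ex) => j jP jmin.
  have jm : (j < m.+1)%N by rewrite ltnS; apply: jmin; rewrite natrM mulrC ler_pM2r //; lra.
  rewrite -NE in iN; exists (Ordinal iN, Ordinal jm); split=> //=.
  apply/andP; split=> //; case: j jP jmin jm => [|j] jP jmin jm.
    by rewrite muln0 mulr_ge0 //; lra.
  rewrite leNgt; apply/negP => /ltW /jmin; by rewrite ltnn.
- move=> p [i j] [i' j'] Op [/= pi /andP [pj1 pj2]] [/= pi' /andP [pj1' pj2']].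
  pose P : pred ('I_N.+1 * 'I_m.+1) :=
    hit (C := sphere_grid N m) (fun x : 'I_N.+1 * 'I_m.+1 => [set p | sector m.+1 x.1 p.1 /\ band x.2 p.2]) [set p].
  have PI (x : 'I_N.+1 * 'I_m.+1) : sector m.+1 x.1 p.1 -> band x.2 p.2 -> P x.
    by move=> ? ?; apply/asboolP; exists p.
  have bj : band j p.2 by apply/andP.
  have bj' : band j' p.2 by apply/andP.
  have stepc (x y : cell (sphere_grid N m)) : linked x y -> P x -> P y ->
      connect (cell_rel (C := sphere_grid N m) P) x y.
    by move=> xy Px Py; apply: connect1; rewrite /cell_rel xy Px Py.
  have lt4 (k : 'I_N.+1) : (k < 4 * m.+1)%N by rewrite -NE.
  have jj' : (j <= j'.+1)%N.
    by have := le_trans pj1 pj2'; rewrite ler_nat leq_mul2l.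
  have j'j : (j' <= j.+1)%N.
    by have := le_trans pj1' pj2; rewrite ler_nat leq_mul2l.
  case: (eqVneq p.1 (0, 0)) => [p0|p0].
    have -> : j' = j.
      move: Op; rewrite /octahedron /= p0 /= !normr0 !add0r => c1.
      have [c2|c2] : p.2 = 1 \/ p.2 = - 1.
        by move/eqP: c1; rewrite eqr_norml ler01 andbT => /orP [] /eqP; [left|right].
      - have h (k : 'I_m.+1) : band k p.2 -> k = m :> nat.
          move=> /andP [_]; rewrite c2 (_ : 1 + 1 = 2%:R) // mulrC -natrM ler_nat leq_mul2l /= ltnS => mk.
          by apply/eqP; rewrite eqn_leq mk andbT -ltnS ltn_ord.
        by apply/val_inj; rewrite /= h // h.
      have h (k : 'I_m.+1) : band k p.2 -> k = 0%N :> nat.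
        move=> /andP [+ _]; rewrite c2 addNr mulr0 (ler_nat _ _ 0) leqn0 muln_eq0 /=.
        by move/eqP.
      by apply/val_inj; rewrite /= h // h.
    have ring : forall k : 'I_N.+1, connect (cell_rel (C := sphere_grid N m) P) (ord0, j) (k, j).
      move=> k; rewrite -(inord_val k); elim: (val k) (ltn_ord k) => [_|l IH lt].
        by rewrite (_ : inord 0 = ord0) //; apply/val_inj; rewrite /= inordK.
      apply: connect_trans (IH (ltnW lt)) _; apply: stepc.
      + apply/existsP; exists (inl (inord l, j)) => /=.
        rewrite (_ : ordS (inord l) = inord l.+1) ?eqxx //.
        by apply/val_inj; rewrite /= !inordK ?(ltnW lt) // modn_small.
      + by apply: PI => //=; rewrite p0; exact: sector0.
      + by apply: PI => //=; rewrite p0; exact: sector0.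
    apply: connect_trans (ring i'); rewrite cell_rel_sym; exact: ring.
  apply: (@connect_trans _ _ (i', j)).
    case: (sector_meet (isT : (0 < m.+1)%N) p0 (lt4 i) (lt4 i') pi pi'); rewrite -?NE.
    + by move=> /val_inj ->.
    + move=> /ord_step E; apply: stepc; try exact: PI.
      by apply/existsP; exists (inl (i, j)); rewrite /= E !eqxx.
    + move=> /ord_step E; apply: stepc; try exact: PI.
      by apply/existsP; exists (inl (i', j)); rewrite /= E !eqxx orbT.
  case: (ltngtP j j') => jl.
  + have lt : (j < m)%N by rewrite -ltnS; exact: leq_ltn_trans jl (ltn_ord j').
    apply: stepc; try exact: PI; apply/existsP; exists (inr (i', Ordinal lt)) => /=.
    have -> : j' = inord j.+1.
      by apply/val_inj; rewrite /= inordK ?ltnS //; apply/eqP; rewrite eqn_leq j'j jl.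
    by rewrite inord_val !eqxx.
  + have lt : (j' < m)%N by rewrite -ltnS; exact: leq_ltn_trans jl (ltn_ord j).
    apply: stepc; try exact: PI; apply/existsP; exists (inr (i', Ordinal lt)) => /=.
    have -> : j = inord j'.+1.
      by apply/val_inj; rewrite /= inordK ?ltnS //; apply/eqP; rewrite eqn_leq jj' jl.
    by rewrite inord_val !eqxx orbT.
  + by rewrite (val_inj jl).
- move=> [i j] p q [/= pi /andP [pj1 pj2]] [/= qi /andP [qj1 qj2]] Op Oq.
  have w0 : 0 < m.+1%:R^-1 :> K by rewrite invr_gt0.
  have cc : `|p.2 - q.2| <= 2 * m.+1%:R^-1.
    rewrite ler_norml ler_pdivlMr // -mulNr ler_pdivrMr //.
    move: pj1 pj2 qj1 qj2; rewrite !natrM -!natr1 => *; apply/andP; split; lra.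
  have ss : `|(`|p.1.1| + `|p.1.2|) - (`|q.1.1| + `|q.1.2|)| <= 2 * m.+1%:R^-1.
    apply: le_trans cc.
    have -> : `|p.1.1| + `|p.1.2| = 1 - `|p.2| by rewrite -Op addrK.
    have -> : `|q.1.1| + `|q.1.2| = 1 - `|q.2| by rewrite -Oq addrK.
    rewrite (_ : _ - _ = `|q.2| - `|p.2|); last by ring.
    by rewrite [leRHS]distrC; exact: ler_dist_dist.
  have [] := @sector_small K m.+1 isT i p.1 q.1 (2 * m.+1%:R^-1) e pi qi _ _ ss _.
  + by rewrite -Op lerDl.
  + by rewrite -Oq lerDl.
  + by apply: le_lt_trans me; move: (m.+1%:R^-1) => w; lra.
  + by move=> h1 h2; split=> //; apply: le_lt_trans cc _; apply: le_lt_trans me; move: w0; move: (m.+1%:R^-1) => w w0; lra.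
Qed.

End Models.

(** * Bounds on graphs embedded in the sphere and in the torus *)

Section Transport.
Local Open Scope classical_set_scope.
Local Open Scope ring_scope.
Variable K : realType.

Lemma within_comp (T : normedModType K) (X : topologicalType) (A : set K) (c : K -> X) (Psi : X -> T) :
  {within A, continuous c} -> (forall t, A t -> {for c t, continuous Psi}) ->
  {within A, continuous (Psi \o c)}.
Proof.
move=> /subspace_continuousP cc cP; apply/subspace_continuousP => t At.
by apply: (@cvg_comp _ _ _ c Psi _ (nbhs (c t))); [exact: cc|exact: cP].
Qed.

(** A continuous injective map to a tiled set carries drawings over. *)
Lemma transport_bound (T : normedModType K) (S : set (K * K * K)) (S' : set T) (h : nat)
  (Psi : K * K * K -> T) (G : sgraph) (n : nat) (es : seq (nat * nat)) (f : 'I_n -> G) :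
  (forall p, S p -> {for p, continuous Psi}) ->
  (forall p q, S p -> S q -> Psi p = Psi q -> p = q) ->
  (forall p, S p -> S' (Psi p)) -> tiled_by S' h ->
  (0 < n)%N -> ordered_edges n es -> uniq es ->
  no_triangle es ->
  injective f -> (forall i j : 'I_n, ((i : nat), (j : nat)) \in es -> adj (f i) (f j)) ->
  embeds G S ->
  ((size es).+2 <= n + h + (size es)./2)%N \/ (size es < n + h)%N.
Proof.
move=> Pc Pi PS tiled n0 es_lt es_uniq es_tri f_inj f_adj [pos [arc [pos_inj posS arcP arc_pos arc_arc]]].
pose src := esrc es_lt; pose tgt := etgt es_lt.
have fadj e : adj (f (src e)) (f (tgt e)).
  by apply: f_adj; rewrite /= -surjective_pairing; exact: edge_in.
have i01 (t : K) : `]0, 1[%classic t -> `[0, 1]%classic t.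
  by rewrite /= !in_itv /= => /andP [? ?]; apply/andP; split; exact: ltW.
have arcS' e t : `[0, 1]%classic t -> S (arc (f (src e)) (f (tgt e)) t).
  by move=> t01; have [_ aS _] := arcP _ _ (fadj e); apply: aS; exists t.
apply: (@drawing_bound K T n es n0 es_lt es_uniq es_tri S' h tiled
  (Psi \o pos \o f) (fun e => Psi \o arc (f (src e)) (f (tgt e)))).
- by move=> u v /= /Pi E; apply/f_inj/pos_inj/E.
- by move=> v; exact/PS/posS.
- move=> e; have [[cc _ _ _] _ _] := arcP _ _ (fadj e).
  by apply: (within_comp cc) => t t01; apply: Pc; exact: arcS'.
- by move=> e t t01; apply/PS/arcS'.
- move=> e t t'; rewrite !inE /= => t01 t01' /Pi E.
  have [[_ ci _ _] _ _] := arcP _ _ (fadj e).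
  by apply: ci; rewrite ?inE //; apply: E; exact: arcS'.
- by move=> e; have [[_ _ c0 _] _ _] := arcP _ _ (fadj e); rewrite /= c0.
- by move=> e; have [[_ _ _ c1] _ _] := arcP _ _ (fadj e); rewrite /= c1.
- move=> e t w t01 /= /Pi E; apply: (arc_pos _ _ (f w) _ (fadj e) t01).
  by apply: E => //; apply: arcS'; exact: i01.
- move=> e e' t t' t01 t01' /= /Pi E; apply: contrapT => ee.
  apply: (arc_arc _ _ _ _ t t' (fadj e) (fadj e')) => //; last first.
    by apply: E; apply: arcS'; exact: i01.
  have lt x : (src x < tgt x)%N by have /andP [] := edge_lt es_lt x.
  case=> -[/f_inj s1 /f_inj s2].
    apply: ee; apply: (edge_inj es_uniq).
    apply: injective_projections; first exact: (congr1 val s1).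
    exact: (congr1 val s2).
  by have := lt e; have := lt e'; rewrite s1 s2 => l1 l2; have := ltn_trans l1 l2; rewrite ltnn.
Qed.

(** When a slab is squeezed between the open and the closed sublevel set of a
    function, its boundary lies on the level set. *)
Lemma boundary_level k (g : K * K * K -> K) (r : K) : continuous g ->
  (forall p, drilled_slab k p -> g p <= r) -> (forall p, g p < r -> drilled_slab k p) ->
  forall p, sphere_with_handles k p -> g p = r.
Proof.
move=> cg slab_le lt_slab p [clp nip].
have clr : closed [set p | g p <= r] by apply: closed_le_fun => //; exact: cont_cst.
have gr : g p <= r.
  have : closure [set p | g p <= r] p by apply: closureS clp => q /slab_le.
  by have /closure_id <- := clr.
apply/eqP; rewrite eq_le gr leNgt; apply/negP => lt; apply: nip.
apply: filterS (open_nbhs_nbhs (A := [set p | g p < r]) _); first by move=> q /lt_slab.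
by split=> //; apply: open_lt_fun => //; exact: cont_cst.
Qed.

Lemma cont_max (X : topologicalType) (f g : X -> K) : continuous f -> continuous g ->
  continuous (fun x => Num.max (f x) (g x)).
Proof. by move=> cf cg x; apply: continuous_max; [exact: cf|exact: cg]. Qed.

Lemma cont_abs (X : topologicalType) (f : X -> K) : continuous f -> continuous (fun x => `|f x|).
Proof. by move=> cf x; apply: cvg_norm; exact: cf. Qed.

Definition px (p : K * K * K) := p.1.1.
Definition py (p : K * K * K) := p.1.2.
Definition pz (p : K * K * K) := p.2.

Lemma px_cont : continuous px.
Proof. by move=> p; apply: (@continuous_comp _ _ _ fst fst); exact: fst_cont. Qed.

Lemma py_cont : continuous py.
Proof. by move=> p; apply: (@continuous_comp _ _ _ fst snd); [exact: fst_cont|exact: snd_cont]. Qed.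

Lemma pz_cont : continuous pz.
Proof. exact: snd_cont. Qed.

Lemma cont_div (X : topologicalType) (f g : X -> K) x : continuous f -> continuous g -> g x != 0 ->
  {for x, continuous (fun y => f y / g y)}.
Proof.
move=> cf cg gx; apply: continuousM; first exact: cf.
by apply: continuousV => //; exact: cg.
Qed.

Lemma for_pair (X Y Z : topologicalType) (f : X -> Y) (g : X -> Z) x :
  {for x, continuous f} -> {for x, continuous g} -> {for x, continuous (fun y => (f y, g y))}.
Proof. by move=> cf cg; apply: cvg_pair. Qed.

(** The boundary of the box is the unit sphere of the sup norm in the affine
    coordinates below; radial projection maps it to the unit sphere of the l1
    norm. *)
Definition box_x (p : K * K * K) := px p * 2 + -1.
Definition box_y (p : K * K * K) := py p * (2 / 3) + -1.
Definition box_z (p : K * K * K) := pz p * 2 + -1.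
Definition box_sum p := `|box_x p| + `|box_y p| + `|box_z p|.
Definition box_max p := Num.max (Num.max `|box_x p| `|box_y p|) `|box_z p|.
Definition box_map (p : K * K * K) : K * K * K := ((box_x p / box_sum p, box_y p / box_sum p), box_z p / box_sum p).

Lemma box_x_cont : continuous box_x.
Proof. by apply: cont_add; [apply: cont_mul; [exact: px_cont|exact: cont_cst]|exact: cont_cst]. Qed.
Lemma box_y_cont : continuous box_y.
Proof. by apply: cont_add; [apply: cont_mul; [exact: py_cont|exact: cont_cst]|exact: cont_cst]. Qed.
Lemma box_z_cont : continuous box_z.
Proof. by apply: cont_add; [apply: cont_mul; [exact: pz_cont|exact: cont_cst]|exact: cont_cst]. Qed.
Lemma box_sum_cont : continuous box_sum.
Proof.
by apply: cont_add; [apply: cont_add|]; apply: cont_abs; [exact: box_x_cont|exact: box_y_cont|exact: box_z_cont].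
Qed.
Lemma box_max_cont : continuous box_max.
Proof.
by apply: cont_max; [apply: cont_max|]; apply: cont_abs; [exact: box_x_cont|exact: box_y_cont|exact: box_z_cont].
Qed.

Lemma box_level p : sphere_with_handles 0 p -> box_max p = 1.
Proof.
apply: boundary_level; first exact: box_max_cont.
  move=> q [/andP [x0 x1] /andP [y0 y1] /andP [z0 z1] _].
  rewrite /box_max !ge_max !ler_norml /box_x /box_y /box_z /px /py /pz.
  by move: x1; rewrite muln0 add0n => x1; repeat (apply/andP; split); lra.
move=> q; rewrite /box_max !gt_max !ltr_norml /box_x /box_y /box_z /px /py /pz.
move=> /andP [/andP [/andP [? ?] /andP [? ?]] /andP [? ?]].
by split=> //; rewrite ?muln0 ?add0n; apply/andP; split; lra.
Qed.

Lemma max_norm_scale (s a b : K) : 0 <= s -> Num.max `|s * a| `|s * b| = s * Num.max `|a| `|b|.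
Proof. by move=> s0; rewrite !normrM (ger0_norm s0) maxr_pMr. Qed.

Lemma box_sum_gt0 p : box_max p = 1 -> 0 < box_sum p.
Proof.
move=> m1; have : box_max p <= box_sum p.
  rewrite /box_max /box_sum !ge_max; repeat (apply/andP; split);
    have := normr_ge0 (box_x p); have := normr_ge0 (box_y p); have := normr_ge0 (box_z p); lra.
by rewrite m1; apply: lt_le_trans.
Qed.

Lemma box_map_inj p q : box_max p = 1 -> box_max q = 1 -> box_map p = box_map q -> p = q.
Proof.
move=> p1 q1 E; have np := box_sum_gt0 p1; have nq := box_sum_gt0 q1.
have np0 := lt0r_neq0 np; have nq0 := lt0r_neq0 nq.
pose s := box_sum p / box_sum q; have s0 : 0 < s by rewrite divr_gt0.
have sc (u v : K) : u / box_sum p = v / box_sum q -> u = s * v.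
  by move=> H; rewrite /s mulrAC -mulrA -H mulrCA divff // mulr1.
have Ea : box_x p = s * box_x q by apply: sc; exact: (congr1 (fun t => t.1.1) E).
have Eb : box_y p = s * box_y q by apply: sc; exact: (congr1 (fun t => t.1.2) E).
have Ec : box_z p = s * box_z q by apply: sc; exact: (congr1 (fun t => t.2) E).
have s1 : s = 1.
  have : box_max p = s * box_max q.
    by rewrite /box_max maxr_pMr ?ltW // -max_norm_scale ?ltW // -[s * `|_|](ger0_norm (mulr_ge0 (ltW s0) (normr_ge0 _))) normrM normr_id -normrM -Ea -Eb -Ec.
  by rewrite p1 q1 mulr1.
move: Ea Eb Ec; rewrite s1 !mul1r /box_x /box_y /box_z /px /py /pz.
by case: p {p1 E np np0 sc s s0 s1} => [[x y] z]; case: q {q1 nq nq0} => [[x' y'] z'] /= *;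
  congr (_, _, _); lra.
Qed.

Lemma sphere_edge_bound (G : sgraph) (n : nat) (es : seq (nat * nat)) (f : 'I_n -> G) :
  (0 < n)%N -> ordered_edges n es -> uniq es ->
  no_triangle es ->
  injective f -> (forall i j : 'I_n, ((i : nat), (j : nat)) \in es -> adj (f i) (f j)) ->
  embeds G (@sphere_with_handles K 0) ->
  ((size es).+2 <= n + (size es)./2)%N \/ (size es < n)%N.
Proof.
move=> n0 lt un tri fi fa em.
suff : ((size es).+2 <= n + 0 + (size es)./2)%N \/ (size es < n + 0)%N by rewrite !addn0.
apply: (@transport_bound _ _ (@octahedron K) 0 box_map G n es f _ _ _ _ n0 lt un tri fi fa em).
- move=> p /box_level /box_sum_gt0 /lt0r_neq0 np; apply: for_pair; first apply: for_pair.
  + by apply: cont_div => //; [exact: box_x_cont|exact: box_sum_cont].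
  + by apply: cont_div => //; [exact: box_y_cont|exact: box_sum_cont].
  + by apply: cont_div => //; [exact: box_z_cont|exact: box_sum_cont].
- by move=> p q /box_level p1 /box_level q1; exact: box_map_inj.
- move=> p /box_level /box_sum_gt0 np; rewrite /octahedron /box_map /=.
  by rewrite !normrM normfV (gtr0_norm np) -!mulrDl divff // lt0r_neq0.
- exact: octahedron_tiled.
Qed.

(** The square ring is a torus of revolution for the sup norm: its core is the
    sup norm circle of radius 1 in the first two coordinates, and its cross
    section is a sup norm disc of radius 1/2 in the coordinates [tube_r] and
    [tube_z].  Both circles are then projected radially to l1 circles. *)
Definition ring_x p := px p + - (3 / 2).
Definition ring_y p := py p + - (3 / 2).
Definition ring_sum p := `|ring_x p| + `|ring_y p|.
Definition tube_r p := Num.max `|ring_x p| `|ring_y p| + -1.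
Definition tube_z p := pz p + - (1 / 2).
Definition tube_sum p := `|tube_r p| + `|tube_z p|.
Definition tube_max p := Num.max `|tube_r p| `|tube_z p|.
Definition torus_map (p : K * K * K) : (K * K) * (K * K) :=
  ((ring_x p / ring_sum p, ring_y p / ring_sum p), (tube_r p / tube_sum p, tube_z p / tube_sum p)).

Lemma ring_x_cont : continuous ring_x. Proof. by apply: cont_add; [exact: px_cont|exact: cont_cst]. Qed.
Lemma ring_y_cont : continuous ring_y. Proof. by apply: cont_add; [exact: py_cont|exact: cont_cst]. Qed.
Lemma tube_z_cont : continuous tube_z. Proof. by apply: cont_add; [exact: pz_cont|exact: cont_cst]. Qed.
Lemma ring_sum_cont : continuous ring_sum.
Proof. by apply: cont_add; apply: cont_abs; [exact: ring_x_cont|exact: ring_y_cont]. Qed.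
Lemma tube_r_cont : continuous tube_r.
Proof.
by apply: cont_add; [apply: cont_max; apply: cont_abs; [exact: ring_x_cont|exact: ring_y_cont]|exact: cont_cst].
Qed.
Lemma tube_sum_cont : continuous tube_sum.
Proof. by apply: cont_add; apply: cont_abs; [exact: tube_r_cont|exact: tube_z_cont]. Qed.
Lemma tube_max_cont : continuous tube_max.
Proof. by apply: cont_max; apply: cont_abs; [exact: tube_r_cont|exact: tube_z_cont]. Qed.

Lemma torus_level p : sphere_with_handles 1 p -> tube_max p = 1 / 2.
Proof.
apply: boundary_level; first exact: tube_max_cont.
  move=> q [/andP [x0 x1] /andP [y0 y1] /andP [z0 z1] /(_ 0%N isT) hole].
  move: x1 hole; rewrite muln1 muln0 !add0n => x1 hole.
  rewrite /tube_max ge_max ler_norml /tube_r /tube_z /ring_x /ring_y /px /py /pz; apply/andP; split; last first.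
    by rewrite ler_norml; apply/andP; split; lra.
  apply/andP; split; last first.
    have : Num.max `|q.1.1 - 3 / 2| `|q.1.2 - 3 / 2| <= 3 / 2.
      by rewrite ge_max !ler_norml; repeat (apply/andP; split); lra.
    by lra.
  suff : 1 / 2 <= Num.max `|q.1.1 - 3 / 2| `|q.1.2 - 3 / 2| by lra.
  rewrite leNgt gt_max !ltr_norml; apply/negP => /andP [/andP [? ?] /andP [? ?]].
  by apply: hole; split; apply/andP; split; lra.
move=> q; rewrite /tube_max gt_max /tube_r /tube_z => /andP [].
rewrite !ltr_norml => /andP [m1 m2] /andP [].
have {}m2 : Num.max `|ring_x q| `|ring_y q| < 3 / 2 by lra.
have {}m1 : 1 / 2 < Num.max `|ring_x q| `|ring_y q| by lra.
move: m2; rewrite gt_max !ltr_norml /ring_x /ring_y /px /py /pz => /andP [/andP [? ?] /andP [? ?]] ? ?.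
split; rewrite ?muln1; try by apply/andP; split; lra.
case=> // _ [/andP []]; rewrite muln0 !add0n => ? ? /andP [? ?].
move: m1; rewrite lt_max !/ring_x !/ring_y /px /py => /orP []; rewrite ltNge ler_norml => /negP []; apply/andP; split; lra.
Qed.

Lemma ring_max_gt0 p : tube_max p = 1 / 2 -> 0 < Num.max `|ring_x p| `|ring_y p|.
Proof.
move=> m1; have : `|tube_r p| <= 1 / 2 by rewrite -m1 le_max lexx.
by rewrite /tube_r ler_norml => /andP [? ?]; lra.
Qed.

Lemma max_le_sum (a b : K) : Num.max `|a| `|b| <= `|a| + `|b|.
Proof. by rewrite ge_max lerDl lerDr !normr_ge0. Qed.

Lemma scale2_inj (a b a' b' : K) : 0 < Num.max `|a| `|b| -> 0 < Num.max `|a'| `|b'| ->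
  a / (`|a| + `|b|) = a' / (`|a'| + `|b'|) -> b / (`|a| + `|b|) = b' / (`|a'| + `|b'|) ->
  exists2 s, 0 < s & a = s * a' /\ b = s * b'.
Proof.
move=> m0 m0' Ea Eb; have n0 := lt_le_trans m0 (max_le_sum a b).
have n0' := lt_le_trans m0' (max_le_sum a' b').
move: Ea Eb n0 n0'; set n := `|a| + _; set n' := `|a'| + _ => Ea Eb n0 n0'.
have sc (u v : K) : u / n = v / n' -> u = n / n' * v.
  by move=> H; rewrite mulrAC -mulrA -H mulrCA divff ?mulr1 // lt0r_neq0.
by exists (n / n'); [rewrite divr_gt0|split; exact: sc].
Qed.

Lemma torus_map_inj p q : tube_max p = 1 / 2 -> tube_max q = 1 / 2 -> torus_map p = torus_map q -> p = q.
Proof.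
move=> p1 q1 E.
have E1 := congr1 (fun t => t.1.1) E; have E2 := congr1 (fun t => t.1.2) E.
have E3 := congr1 (fun t => t.2.1) E; have E4 := congr1 (fun t => t.2.2) E.
have uniq_scale (s m r : K) : 0 < r -> m = r -> s * m = r -> s = 1.
  by move=> r0 -> /(canRL (mulfK (lt0r_neq0 r0))) ->; rewrite divff // lt0r_neq0.
have h0 : 0 < 1 / 2 :> K by lra.
have [||s s0 [Ec Ed]] := scale2_inj _ _ E3 E4; try by rewrite -/(tube_max _) ?p1 ?q1.
have s1 : s = 1.
  by apply: (uniq_scale _ (tube_max q) (1 / 2)) => //; rewrite /tube_max -max_norm_scale ?ltW // -Ec -Ed.
move: Ec Ed; rewrite s1 !mul1r => Ec Ed.
have mE : Num.max `|ring_x p| `|ring_y p| = Num.max `|ring_x q| `|ring_y q| by move: Ec; rewrite /tube_r; lra.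
have [||s' s0' [Ea Eb]] := scale2_inj _ _ E1 E2; try exact: ring_max_gt0.
have s1' : s' = 1.
  apply: (uniq_scale _ (Num.max `|ring_x q| `|ring_y q|) (Num.max `|ring_x q| `|ring_y q|)) => //; first exact: ring_max_gt0.
  by rewrite -max_norm_scale ?ltW // -Ea -Eb.
move: Ea Eb Ed; rewrite s1' !mul1r /ring_x /ring_y /tube_z /px /py /pz.
by clear; case: p => [[x y] z]; case: q => [[x' y'] z'] /= *; congr (_, _, _); lra.
Qed.

Lemma torus_edge_bound (G : sgraph) (n : nat) (es : seq (nat * nat)) (f : 'I_n -> G) :
  (0 < n)%N -> ordered_edges n es -> uniq es ->
  no_triangle es ->
  injective f -> (forall i j : 'I_n, ((i : nat), (j : nat)) \in es -> adj (f i) (f j)) ->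
  embeds G (@sphere_with_handles K 1) ->
  ((size es).+2 <= n + 2 + (size es)./2)%N \/ (size es < n + 2)%N.
Proof.
move=> n0 lt un tri fi fa em.
have tn0 p : tube_max p = 1 / 2 -> 0 < ring_sum p.
  by move=> /ring_max_gt0 /lt_le_trans; apply; exact: max_le_sum.
have tm0 p : tube_max p = 1 / 2 -> 0 < tube_sum p.
  move=> p1; have : 0 < tube_max p by rewrite p1; lra.
  by move=> /lt_le_trans; apply; exact: max_le_sum.
apply: (@transport_bound _ _ (@torus_model K) 2 torus_map G n es f _ _ _ _ n0 lt un tri fi fa em).
- move=> p /torus_level p1; have np := lt0r_neq0 (tn0 _ p1); have mp := lt0r_neq0 (tm0 _ p1).
  apply: for_pair; apply: for_pair.
  + by apply: cont_div => //; [exact: ring_x_cont|exact: ring_sum_cont].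
  + by apply: cont_div => //; [exact: ring_y_cont|exact: ring_sum_cont].
  + by apply: cont_div => //; [exact: tube_r_cont|exact: tube_sum_cont].
  + by apply: cont_div => //; [exact: tube_z_cont|exact: tube_sum_cont].
- by move=> p q /torus_level p1 /torus_level q1; exact: torus_map_inj.
- move=> p /torus_level p1; have np := tn0 _ p1; have mp := tm0 _ p1.
  rewrite /torus_model /torus_map /=.
  by rewrite !normrM !normfV (gtr0_norm np) (gtr0_norm mp) -!mulrDl !divff // lt0r_neq0.
- exact: torus_tiled.
Qed.

End Transport.

(** * Lattice polylines *)

Definition pt := (nat * nat * nat)%type.

(** The edges of the Freudenthal triangulation of space: diagonals of faces and of
    cubes are allowed, in one direction only, so that no two edges cross. *)
Definition up_step (p q : pt) : bool :=
  [&& p != q, p.1.1 <= q.1.1 <= p.1.1.+1, p.1.2 <= q.1.2 <= p.1.2.+1 & p.2 <= q.2 <= p.2.+1].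

Definition lattice_step (p q : pt) := up_step p q || up_step q p.

Section Polyline.
Local Open Scope classical_set_scope.
Local Open Scope ring_scope.
Variable K : realType.

Definition clamp (u : K) : K := Num.min 1 (Num.max 0 u).

(** The piecewise linear function with value xs k at k / L, written as one sum so
    that its continuity is immediate. *)
Definition poly1 (xs : nat -> K) (L : nat) (t : K) : K :=
  xs 0%N + \sum_(i < L) clamp (t * L%:R - i%:R) * (xs i.+1 - xs i).

Lemma cont_min (X : topologicalType) (f g : X -> K) : continuous f -> continuous g ->
  continuous (fun x => Num.min (f x) (g x)).
Proof. by move=> cf cg x; apply: continuous_min; [exact: cf|exact: cg]. Qed.

Lemma clamp_cont (f : K -> K) : continuous f -> continuous (fun x => clamp (f x)).
Proof.
move=> cf; apply: (cont_min (@cont_cst K K 1)).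
by apply: (cont_max (@cont_cst K K 0)).
Qed.

Lemma cont_sum (F : nat -> K -> K) n : (forall i, continuous (F i)) ->
  continuous (fun t => \sum_(i < n) F i t).
Proof.
move=> cF; elim: n => [|n IH].
  by under eq_fun do rewrite big_ord0; exact: cont_cst.
by under eq_fun do rewrite big_ord_recr /=; exact: cont_add.
Qed.

Lemma poly1_cont xs L : continuous (poly1 xs L).
Proof.
apply: cont_add; first exact: cont_cst.
have term i : continuous (fun t : K => clamp (t * L%:R - i%:R) * (xs i.+1 - xs i)).
  apply: cont_mul; last exact: cont_cst.
  apply: clamp_cont; apply: cont_add; last exact: cont_cst.
  by apply: cont_mul; [move=> t; exact: cvg_id|exact: cont_cst].
exact: (cont_sum (F := fun i t => clamp (t * L%:R - i%:R) * (xs i.+1 - xs i))).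
Qed.

Lemma poly1E xs L k t tau : (k < L)%N -> 0 <= tau <= 1 -> t * L%:R = k%:R + tau ->
  poly1 xs L t = xs k + tau * (xs k.+1 - xs k).
Proof.
move=> kL /andP [t0 t1] tE; rewrite /poly1 tE.
rewrite -(big_mkord xpredT (fun i => clamp (k%:R + tau - i%:R) * (xs i.+1 - xs i))).
rewrite (big_cat_nat (n := k)) //= ?(ltnW kL) //.
rewrite [X in _ + (_ + X)]big_ltn //.
rewrite [X in _ + (X + _)](_ : _ = xs k - xs 0%N); last first.
  rewrite -(telescope_sumr xs (leq0n k)); apply: eq_big_nat => i /andP [_ ik].
  have : i.+1%:R <= k%:R :> K by rewrite ler_nat.
  rewrite -natr1 => ik'; rewrite /clamp max_r ?min_l ?mul1r //; lra.
rewrite [X in _ + (_ + (_ + X))]big_nat_cond big1; last first.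
  move=> i /andP [/andP [ki _] _].
  have : k.+1%:R <= i%:R :> K by rewrite ler_nat.
  rewrite -natr1 => ik'; rewrite /clamp max_l ?min_r ?mul0r //; lra.
rewrite /clamp (_ : k%:R + tau - k%:R = tau); last by ring.
rewrite max_r // min_r //; ring.
Qed.

Lemma param_cases L (t : K) : (0 < L)%N -> 0 <= t <= 1 ->
  (exists2 k, (k <= L)%N & t * L%:R = k%:R) \/
  (exists k tau, [/\ (k < L)%N, 0 < tau < 1 & t * L%:R = k%:R + tau]).
Proof.
move=> L0 /andP [t0 t1]; have LR : 0 < L%:R :> K by rewrite ltr0n.
set u := t * L%:R; have u0 : 0 <= u by rewrite mulr_ge0.
have uL : u <= L%:R by rewrite -[leRHS]mul1r ler_pM2r.
have /andP [k1 k2] := truncn_itv u0; set k := Num.truncn u in k1 k2.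
have kL : (k <= L)%N by rewrite -(ler_nat K); exact: le_trans k1 uL.
case: (eqVneq u k%:R) => [E|ne]; first by left; exists k.
right; exists k, (u - k%:R); split; last by ring.
  rewrite ltn_neqAle kL andbT; apply: contra ne => /eqP kE.
  by rewrite eq_le k1 andbT kE.
rewrite subr_gt0 lt_neqAle k1 eq_sym ne /=.
by move: k2; rewrite -natr1; lra.
Qed.

Variable d : K.
Hypothesis d_gt0 : 0 < d.

Definition lp (p : pt) : K * K * K := (p.1.1%:R / d, p.1.2%:R / d, p.2%:R / d).

Definition seg (p q : pt) (tau : K) : K * K * K :=
  ((p.1.1%:R + tau * (q.1.1%:R - p.1.1%:R)) / d,
   (p.1.2%:R + tau * (q.1.2%:R - p.1.2%:R)) / d,
   (p.2%:R + tau * (q.2%:R - p.2%:R)) / d).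

Lemma div_inj (x y : K) : x / d = y / d -> x = y.
Proof. by move/mulIf; apply; rewrite invr_neq0 // lt0r_neq0. Qed.

Lemma lp_inj : injective lp.
Proof.
move=> [[a b] c] [[a' b'] c'] [] /div_inj /eqP; rewrite eqr_nat => /eqP ->.
by move=> /div_inj /eqP; rewrite eqr_nat => /eqP -> /div_inj /eqP; rewrite eqr_nat => /eqP ->.
Qed.

Lemma seg_rev p q tau : seg p q tau = seg q p (1 - tau).
Proof. by rewrite /seg; congr (_ / d, _ / d, _ / d); ring. Qed.

(** In one coordinate, interior points of two unit or degenerate steps agree only
    when the steps agree. *)
Lemma coord_open (a a' b b' : nat) (s t : K) : (a <= a' <= a.+1)%N -> (b <= b' <= b.+1)%N ->
  0 < s < 1 -> 0 < t < 1 ->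
  a%:R + s * (a'%:R - a%:R) = b%:R + t * (b'%:R - b%:R) ->
  [/\ a = b, a' = b' & a != a' -> s = t].
Proof.
move=> aa bb /andP [s0 s1] /andP [t0 t1].
have cases (x x' : nat) : (x <= x' <= x.+1)%N -> x' = x \/ x' = x.+1 by lia.
have lt (x y : nat) : x%:R < y%:R + 1 :> K -> (x <= y)%N.
  by rewrite natr1 ltr_nat ltnS.
have eqn (x y : nat) : x%:R < y%:R + 1 :> K -> y%:R < x%:R + 1 :> K -> x = y.
  by move=> /lt h1 /lt h2; apply/eqP; rewrite eqn_leq h1 h2.
have ne (x y : nat) (u : K) : 0 < u < 1 -> x%:R = y%:R + u -> False.
  move=> /andP [u0 u1] E; have : (x <= y)%N by apply: lt; lra.
  by rewrite -(ler_nat K); lra.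
case: (cases _ _ aa) => ->; case: (cases _ _ bb) => ->; rewrite -?natr1.
- rewrite !subrr !mulr0 !addr0 => /eqP; rewrite eqr_nat => /eqP ->; split=> //.
  by rewrite eqxx.
- rewrite subrr mulr0 addr0 [_ + 1 - _]addrAC subrr add0r mulr1 => E.
  by case: (ne a b t) => //; apply/andP.
- rewrite [RHS](_ : _ = b%:R); last by ring.
  rewrite [_ + 1 - _]addrAC subrr add0r mulr1 => E.
  by case: (ne b a s) => //; apply/andP.
- rewrite ![_ + 1 - _]addrAC !subrr !add0r !mulr1 => E.
  have ab : a = b by apply: eqn; lra.
  by rewrite ab in E *; split=> // _; lra.
Qed.

Lemma seg_open_up p q p' q' s t : up_step p q -> up_step p' q' -> 0 < s < 1 -> 0 < t < 1 ->
  seg p q s = seg p' q' t -> [/\ p = p', q = q' & s = t].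
Proof.
case: p q p' q' => [[a b] c] [[a1 b1] c1] [[a' b'] c'] [[a1' b1'] c1'].
move=> /and4P [/= ne h1 h2 h3] /and4P [/= _ h1' h2' h3'] s01 t01 [].
move=> /div_inj /(coord_open h1 h1' s01 t01) [E1 F1 G1].
move=> /div_inj /(coord_open h2 h2' s01 t01) [E2 F2 G2].
move=> /div_inj /(coord_open h3 h3' s01 t01) [E3 F3 G3].
split; rewrite ?E1 ?E2 ?E3 ?F1 ?F2 ?F3 //.
move: ne; rewrite !xpair_eqE !negb_and -orbA => /or3P []; auto.
Qed.

Lemma flip01 (s : K) : 0 < s < 1 -> 0 < 1 - s < 1.
Proof. by move=> /andP [? ?]; apply/andP; split; lra. Qed.

Lemma seg_open p q p' q' s t : lattice_step p q -> lattice_step p' q' ->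
  0 < s < 1 -> 0 < t < 1 -> seg p q s = seg p' q' t ->
  [/\ p = p', q = q' & s = t] \/ [/\ p = q', q = p' & s = 1 - t].
Proof.
move=> /orP [pq|qp] /orP [pq'|qp'] s01 t01.
- by move=> /(seg_open_up pq pq' s01 t01); left.
- by rewrite [X in _ = X]seg_rev => /(seg_open_up pq qp' s01 (flip01 t01)); right.
- rewrite seg_rev => /(seg_open_up qp pq' (flip01 s01) t01) [-> -> E].
  by right; split=> //; rewrite -E; ring.
- rewrite seg_rev [X in _ = X]seg_rev => /(seg_open_up qp qp' (flip01 s01) (flip01 t01)) [-> -> E].
  by left; split=> //; lra.
Qed.

Lemma seg_lp p q r s : lattice_step p q -> 0 < s < 1 -> seg p q s <> lp r.
Proof.
wlog pq : p q s / up_step p q.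
  move=> W /orP [pq|qp] s01; first by apply: W => //; rewrite /lattice_step pq.
  by rewrite seg_rev; apply: W; [|rewrite /lattice_step qp|exact: flip01].
move=> _ s01; case: p q r pq => [[a b] c] [[a1 b1] c1] [[x y] z] /and4P [/= ne h1 h2 h3].
have z01 (x0 : nat) : x0%:R = x0%:R + s * (x0%:R - x0%:R) :> K by ring.
move=> []; rewrite (z01 x) (z01 y) (z01 z).
have rr n : (n <= n <= n.+1)%N by rewrite leqnn leqnSn.
move=> /div_inj /(coord_open h1 (rr _) s01 s01) [E1 F1 _].
move=> /div_inj /(coord_open h2 (rr _) s01 s01) [E2 F2 _].
move=> /div_inj /(coord_open h3 (rr _) s01 s01) [E3 F3 _].
by case/negP: ne; rewrite E1 E2 E3 F1 F2 F3.
Qed.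

Definition polyline (s : seq pt) (t : K) : K * K * K :=
  let L := (size s).-1 in let x i := nth (0, 0, 0)%N s i in
  (poly1 (fun i => (x i).1.1%:R / d) L t, poly1 (fun i => (x i).1.2%:R / d) L t,
   poly1 (fun i => (x i).2%:R / d) L t).

Lemma polyline_cont s : continuous (polyline s).
Proof.
by move=> t; apply: for_pair; [apply: for_pair|]; exact: poly1_cont.
Qed.

Local Notation "s `[ i ]" := (nth (0, 0, 0)%N s i) (at level 3).

Lemma polyline_seg s k t tau : (k < (size s).-1)%N -> 0 <= tau <= 1 ->
  t * ((size s).-1)%:R = k%:R + tau -> polyline s t = seg s`[k] s`[k.+1] tau.
Proof.
move=> kL t01 tE; rewrite /polyline /seg.
by congr (_, _, _); rewrite (poly1E _ kL t01 tE); field; exact: lt0r_neq0.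
Qed.

Lemma polyline_lp s k t : (1 < size s)%N -> (k <= (size s).-1)%N ->
  t * ((size s).-1)%:R = k%:R -> polyline s t = lp s`[k].
Proof.
move=> s1 kL tE; case: (ltnP k (size s).-1) => [lt|ge].
  rewrite (@polyline_seg s k t 0) ?lexx ?ler01 ?addr0 //.
  by rewrite /seg /lp; congr (_, _, _); rewrite mul0r addr0.
have k0 : (k.-1.+1 = k)%N by apply: prednK; move: s1 ge; clear; lia.
have klt : (k.-1 < (size s).-1)%N by move: s1 kL; clear; lia.
rewrite (@polyline_seg s k.-1 t 1) ?lexx ?ler01 //; last by rewrite natr1 k0.
by rewrite /seg /lp k0; congr (_ / _, _ / _, _ / _); ring.
Qed.

End Polyline.

Lemma uniq_flatten_nth (T : eqType) (ss : seq (seq T)) (a b : nat) (x : T) :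
  uniq (flatten ss) -> x \in nth [::] ss a -> x \in nth [::] ss b -> a = b.
Proof.
elim: ss a b => [|s ss IH] [|a] [|b] //=; rewrite cat_uniq => /and3P [us dis uss].
- move=> xs xb; case/negP: dis; apply/hasP; exists x => //.
  by apply/flattenP; exists (nth [::] ss b) => //; apply: mem_nth; case: ltnP xb => // /(nth_default _) ->.
- move=> xa xs; case/negP: dis; apply/hasP; exists x => //.
  by apply/flattenP; exists (nth [::] ss a) => //; apply: mem_nth; case: ltnP xa => // /(nth_default _) ->.
- by move=> xa xb; rewrite (IH a b).
Qed.

(** * Checking a lattice drawing by computation *)

Section LatticeDrawing.
Local Open Scope classical_set_scope.
Local Open Scope ring_scope.
Variables (K : realType) (d : K) (S : set (K * K * K)).
Hypothesis d_gt0 : 0 < d.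
Variables (vs : seq pt) (es : seq ((nat * nat) * seq pt)) (ok : rel pt).
Hypothesis okS : forall p q (tau : K), ok p q -> 0 <= tau <= 1 -> S (seg d p q tau).

Local Notation o := (0, 0, 0)%N.
Local Notation "s `[ i ]" := (nth o s i) (at level 3).

(** A drawing lists the lattice points of the vertices and, for each edge (i, j)
    with i < j, the inner lattice points of its route.  That no lattice point is
    used twice and that consecutive points are neighbours suffices for the
    routes not to cross; the relation ok keeps the segments on the surface. *)
Definition drawing_ok := [&& uniq (vs ++ flatten (unzip2 es)), uniq (unzip1 es),
  all (fun p => ok p p) vs, all (fun e => (e.1.1 < e.1.2 < size vs)%N) es &
  all (fun e => path (fun p q => lattice_step p q && ok p q) vs`[e.1.1] (rcons e.2 vs`[e.1.2])) es].

Hypothesis check : drawing_ok.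

Definition inner (ij : nat * nat) : seq pt := nth [::] (unzip2 es) (index ij (unzip1 es)).
Definition route (ij : nat * nat) : seq pt := vs`[ij.1] :: rcons (inner ij) vs`[ij.2].

Lemma vs_uniq : uniq vs.
Proof. by case/and5P: check; rewrite cat_uniq => /and3P []. Qed.

Lemma key_in ij : ij \in unzip1 es -> (ij, inner ij) \in es.
Proof.
move=> ij_in; have lt : (index ij (unzip1 es) < size es)%N by rewrite -(size_map fst) index_mem.
have -> : (ij, inner ij) = nth (ij, [::]) es (index ij (unzip1 es)).
  rewrite [RHS]surjective_pairing /inner; congr (_, _).
    by rewrite -(nth_map _ ij fst) // nth_index.
  by rewrite (nth_map (ij, [::])).
exact: mem_nth.
Qed.

Lemma key_lt ij : ij \in unzip1 es -> (ij.1 < ij.2 < size vs)%N.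
Proof. by move=> /key_in ij_in; case/and5P: check => _ _ _ /allP /(_ _ ij_in). Qed.

Lemma inner_vs ij p : p \in inner ij -> p \notin vs.
Proof.
case/and5P: check; rewrite cat_uniq => /and3P [_ dis _] _ _ _ _ pm.
apply: contra dis => pvs; apply/hasP; exists p => //.
apply/flattenP; exists (inner ij) => //; apply: mem_nth.
by move: pm; rewrite /inner; case: ltnP => // /(nth_default _) ->.
Qed.

Lemma inner_inner ij ij' p : ij \in unzip1 es -> ij' \in unzip1 es ->
  p \in inner ij -> p \in inner ij' -> ij = ij'.
Proof.
case/and5P: check; rewrite cat_uniq => /and3P [_ _ fu] _ _ _ _ i_in i_in' pm pm'.
have E := uniq_flatten_nth fu pm pm'.
by rewrite -(nth_index ij i_in) E nth_index.
Qed.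

Lemma vs_in ij : ij \in unzip1 es -> vs`[ij.1] \in vs /\ vs`[ij.2] \in vs.
Proof.
move=> /key_lt /andP [h1 h2]; split; apply: mem_nth => //; exact: ltn_trans h1 h2.
Qed.

Lemma vs_neq ij : ij \in unzip1 es -> vs`[ij.1] != vs`[ij.2].
Proof.
move=> /key_lt /andP [h1 h2]; rewrite nth_uniq ?vs_uniq //; last exact: ltn_trans h1 h2.
by rewrite neq_ltn h1.
Qed.

Lemma route_uniq ij : ij \in unzip1 es -> uniq (route ij).
Proof.
move=> ij_in; have [v1 v2] := vs_in ij_in; have vv := vs_neq ij_in.
rewrite /route /= mem_rcons inE negb_or vv /= rcons_uniq.
have nm v : v \in vs -> v \notin inner ij by move=> vi; apply/negP => /inner_vs; rewrite vi.
rewrite !nm //=; case/and5P: check; rewrite cat_uniq => /and3P [_ _ fu] _ _ _ _.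
have : inner ij \in unzip2 es.
  by apply: mem_nth; rewrite size_map -(size_map fst) index_mem.
move: fu; elim: (unzip2 es) => [|s ss IH] //=; rewrite cat_uniq inE => /and3P [us _ uss].
by case/orP => [/eqP ->|/(IH uss)].
Qed.

Lemma route_size ij : (size (route ij)).-1 = (size (inner ij)).+1.
Proof. by rewrite /= size_rcons. Qed.

Lemma route_step ij k : ij \in unzip1 es -> (k < (size (route ij)).-1)%N ->
  lattice_step (route ij)`[k] (route ij)`[k.+1] && ok (route ij)`[k] (route ij)`[k.+1].
Proof.
move=> /key_in ij_in kL; case/and5P: check => _ _ _ _ /allP /(_ _ ij_in) /= /(pathP o).
by apply; rewrite size_rcons -ltnS -route_size prednK.
Qed.

Lemma route_ends ij : (route ij)`[0] = vs`[ij.1] /\ (route ij)`[(size (inner ij)).+1] = vs`[ij.2].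
Proof. by split=> //=; rewrite nth_rcons ltnn eqxx. Qed.

Lemma route_inner ij k : (0 < k <= size (inner ij))%N -> (route ij)`[k] \in inner ij.
Proof.
by case: k => // k /= km; rewrite nth_rcons km; exact: mem_nth.
Qed.

Lemma route_nth_cases ij k : ij \in unzip1 es -> (k <= (size (route ij)).-1)%N ->
  [\/ k = 0%N /\ (route ij)`[k] = vs`[ij.1], (route ij)`[k] \in inner ij |
      k = (size (inner ij)).+1 /\ (route ij)`[k] = vs`[ij.2] ].
Proof.
move=> ij_in; rewrite route_size => kL; have [e0 e1] := route_ends ij.
case: (posnP k) => [->|k0]; first by constructor 1.
case: (ltngtP k (size (inner ij)).+1) kL => // [kl _|-> _]; last by constructor 3.
by constructor 2; apply: route_inner; rewrite k0 -ltnS.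
Qed.

Lemma route_size1 ij : (1 < size (route ij))%N.
Proof. by rewrite /= size_rcons. Qed.

Lemma route_in_S ij t : ij \in unzip1 es -> 0 <= t <= 1 -> S (polyline d (route ij) t).
Proof.
move=> ij_in t01; have L0 : (0 < (size (route ij)).-1)%N by rewrite route_size.
have okk k : (k < (size (route ij)).-1)%N -> ok (route ij)`[k] (route ij)`[k.+1].
  by move=> kL; case/andP: (route_step ij_in kL).
case: (param_cases L0 t01) => [[k kL tE]|[k [tau [kL tau01 tE]]]]; last first.
  have tau01' : 0 <= tau <= 1 by case/andP: tau01 => /ltW -> /ltW ->.
  by rewrite (polyline_seg d_gt0 kL tau01' tE); apply: okS => //; exact: okk.
case: (ltnP k (size (route ij)).-1) => [lt|ge].
  rewrite (@polyline_seg K d d_gt0 _ k t 0) ?lexx ?ler01 ?addr0 //.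
  by apply: okS; rewrite ?lexx ?ler01 //; exact: okk.
have k0 : (k.-1.+1 = k)%N by apply: prednK; apply: leq_trans ge.
rewrite (@polyline_seg K d d_gt0 _ k.-1 t 1) ?lexx ?ler01 //; first by apply: okS; rewrite ?lexx ?ler01 //; apply: okk; rewrite k0.
  by rewrite k0.
by rewrite natr1 k0.
Qed.

Lemma interior_loc ij t : ij \in unzip1 es -> 0 < t < 1 ->
  (exists k, [/\ (k <= (size (route ij)).-1)%N, (route ij)`[k] \in inner ij & polyline d (route ij) t = lp d (route ij)`[k]]) \/
  (exists k tau, [/\ (k < (size (route ij)).-1)%N, 0 < tau < 1 & polyline d (route ij) t = seg d (route ij)`[k] (route ij)`[k.+1] tau]).
Proof.
move=> ij_in /andP [t0 t1]; have L0 : (0 < (size (route ij)).-1)%N by rewrite route_size.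
have LR : 0 < ((size (route ij)).-1)%:R :> K by rewrite ltr0n.
have t01 : 0 <= t <= 1 by rewrite !ltW.
case: (param_cases L0 t01) => [[k kL tE]|[k [tau [kL tau01 tE]]]]; last first.
  right; exists k, tau; split=> //; apply: polyline_seg => //.
  by case/andP: tau01 => /ltW -> /ltW ->.
left; exists k; split=> //; last by apply: polyline_lp => //; exact: route_size1.
have k0 : (0 < k)%N by rewrite -(ltr_nat K) -tE mulr_gt0.
apply: route_inner; rewrite k0 -ltnS -route_size -(ltr_nat K) -tE.
by rewrite -[ltRHS]mul1r ltr_pM2r.
Qed.

Lemma interior_avoids ij t p : ij \in unzip1 es -> 0 < t < 1 -> p \in vs ->
  polyline d (route ij) t <> lp d p.
Proof.
move=> ij_in t01 pvs; case: (interior_loc ij_in t01) => [[k [_ km ->]]|[k [tau [kL tau01 ->]]]].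
  by move=> /(lp_inj d_gt0) E; have := inner_vs km; rewrite E pvs.
by apply: seg_lp => //; case/andP: (route_step ij_in kL).
Qed.

(** Routes of different edges could still share an open segment, if both consisted
    of this single segment; but then they would join the same two vertices. *)
Lemma interior_disjoint ij ij' t t' : ij \in unzip1 es -> ij' \in unzip1 es ->
  0 < t < 1 -> 0 < t' < 1 -> polyline d (route ij) t = polyline d (route ij') t' -> ij = ij'.
Proof.
move=> i_in i_in' t01 t01'.
case: (interior_loc i_in t01) => [[k [kL km ->]]|[k [tau [kL tau01 ->]]]];
case: (interior_loc i_in' t01') => [[k' [kL' km' ->]]|[k' [tau' [kL' tau01' ->]]]].
- by move=> /(lp_inj d_gt0) E; apply: (inner_inner i_in i_in' km); rewrite E.
- by move=> /esym E; case/andP: (route_step i_in' kL') => st _; case: (seg_lp d_gt0 st tau01' E).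
- by move=> E; case/andP: (route_step i_in kL) => st _; case: (seg_lp d_gt0 st tau01 E).
case/andP: (route_step i_in kL) => st _; case/andP: (route_step i_in' kL') => st' _.
move=> /(seg_open d_gt0 st st' tau01 tau01') E; apply: contrapT => ne.
have nm a b : (a <= (size (route ij)).-1)%N -> (b <= (size (route ij')).-1)%N ->
    (route ij)`[a] = (route ij')`[b] -> (route ij)`[a] \in vs.
  move=> aL bL ab; have [v1 v2] := vs_in i_in; have [v1' v2'] := vs_in i_in'.
  case: (route_nth_cases i_in aL) => [[_ ->]|am|[_ ->]] //.
  case: (route_nth_cases i_in' bL) => [[_ bE]|bm|[_ bE]]; rewrite ?ab ?bE //.
  by case: ne; apply: (inner_inner i_in i_in' am); rewrite ab.
have both (ij0 : nat * nat) a : ij0 \in unzip1 es -> (a < (size (route ij0)).-1)%N ->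
    (route ij0)`[a] \in vs -> (route ij0)`[a.+1] \in vs ->
    (route ij0)`[a] = vs`[ij0.1] /\ (route ij0)`[a.+1] = vs`[ij0.2].
  move=> in0 aL av av'.
  split.
    case: (route_nth_cases in0 (ltnW aL)) => [[_ ->]|am|[aE _]] //.
      by case/negP: (inner_vs am).
    by move: aL; rewrite route_size aE ltnn.
  case: (route_nth_cases in0 aL) => [[//]|am|[_ ->]] //.
  by case/negP: (inner_vs am).
have vinj a b : (a < size vs)%N -> (b < size vs)%N -> vs`[a] = vs`[b] -> a = b.
  by move=> al bl /eqP; rewrite nth_uniq ?vs_uniq // => /eqP.
have /andP [h1 h2] := key_lt i_in; have /andP [h1' h2'] := key_lt i_in'.
have h0 := ltn_trans h1 h2; have h0' := ltn_trans h1' h2'.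
case: E => [[E1 E2 _]|[E1 E2 _]].
  have m1 := nm _ _ (ltnW kL) (ltnW kL') E1; have m2 := nm _ _ kL kL' E2.
  have [F1 F2] := both _ _ i_in kL m1 m2.
  have [F1' F2'] : (route ij')`[k'] = vs`[ij'.1] /\ (route ij')`[k'.+1] = vs`[ij'.2].
    by apply: both => //; rewrite -?E1 -?E2.
  apply: ne; apply: injective_projections; apply: vinj => //.
    by rewrite -F1 -F1'.
  by rewrite -F2 -F2'.
have m1 := nm _ _ (ltnW kL) kL' E1; have m2 := nm _ _ kL (ltnW kL') E2.
have [F1 F2] := both _ _ i_in kL m1 m2.
have [F1' F2'] : (route ij')`[k'] = vs`[ij'.1] /\ (route ij')`[k'.+1] = vs`[ij'.2].
  by apply: both => //; rewrite -?E1 -?E2.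
have G1 : ij.1 = ij'.2 by apply: vinj => //; rewrite -F1 -F2'.
have G2 : ij.2 = ij'.1 by apply: vinj => //; rewrite -F2 -F1'.
by move: h1; rewrite G1 G2 ltnNge ltnW.
Qed.

Lemma route_inj ij t t' : ij \in unzip1 es -> 0 <= t <= 1 -> 0 <= t' <= 1 ->
  polyline d (route ij) t = polyline d (route ij) t' -> t = t'.
Proof.
move=> ij_in t01 t01'; have L0 : (0 < (size (route ij)).-1)%N by rewrite route_size.
have LR : ((size (route ij)).-1)%:R != 0 :> K by rewrite pnatr_eq0 -lt0n.
have s1 := route_size1 ij.
have ninj a b : (a <= (size (route ij)).-1)%N -> (b <= (size (route ij)).-1)%N ->
    (route ij)`[a] = (route ij)`[b] -> a = b.
  move=> al bl /eqP; rewrite nth_uniq ?route_uniq //; [by move/eqP|rewrite -(prednK (ltnW s1)) ltnS..].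
have st k : (k < (size (route ij)).-1)%N -> lattice_step (route ij)`[k] (route ij)`[k.+1].
  by move=> /(route_step ij_in) /andP [].
have cl (tau : K) : 0 < tau < 1 -> 0 <= tau <= 1 by case/andP => /ltW -> /ltW ->.
case: (param_cases L0 t01) => [[k kL tE]|[k [tau [kL tau01 tE]]]];
case: (param_cases L0 t01') => [[k' kL' tE']|[k' [tau' [kL' tau01' tE']]]].
- rewrite (polyline_lp d_gt0 s1 kL tE) (polyline_lp d_gt0 s1 kL' tE') => /(lp_inj d_gt0) E.
  by apply: (mulIf LR); rewrite tE tE' (ninj _ _ kL kL' E).
- rewrite (polyline_lp d_gt0 s1 kL tE) (polyline_seg d_gt0 kL' (cl _ tau01') tE') => /esym E.
  by case: (seg_lp d_gt0 (st _ kL') tau01' E).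
- rewrite (polyline_lp d_gt0 s1 kL' tE') (polyline_seg d_gt0 kL (cl _ tau01) tE) => E.
  by case: (seg_lp d_gt0 (st _ kL) tau01 E).
rewrite (polyline_seg d_gt0 kL (cl _ tau01) tE) (polyline_seg d_gt0 kL' (cl _ tau01') tE').
move=> /(seg_open d_gt0 (st _ kL) (st _ kL') tau01 tau01') [[E1 _ E]|[E1 E2 _]].
  by apply: (mulIf LR); rewrite tE tE' E (ninj _ _ (ltnW kL) (ltnW kL') E1).
have k1 := ninj _ _ (ltnW kL) kL' E1; have k2 := ninj _ _ kL (ltnW kL') E2.
by exfalso; move: k1 k2; clear; lia.
Qed.

(* The drawing may have more vertices and edges than G. *)
Variables (G : sgraph) (code : G -> nat).
Hypothesis code_inj : injective code.
Hypothesis code_lt : forall v, (code v < size vs)%N.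
Hypothesis adj_key : forall u v : G, adj u v -> (code u < code v)%N -> (code u, code v) \in unzip1 es.

Lemma lattice_embeds : embeds G S.
Proof.
pose pos (v : G) := lp d vs`[code v].
pose arc (u v : G) (t : K) := if (code u < code v)%N then polyline d (route (code u, code v)) t
  else polyline d (route (code v, code u)) (1 - t).
have orient (u v : G) : adj u v -> (code u < code v)%N \/ (code v < code u)%N.
  move=> uv; case: (ltngtP (code u) (code v)) => [?|?|/code_inj E]; [by left|by right|].
  by rewrite E in uv; case: (adj_irr uv).
have v_in (v : G) : vs`[code v] \in vs by exact: mem_nth.
have end0 ij : polyline d (route ij) 0 = lp d vs`[ij.1].
  by rewrite (@polyline_lp K d d_gt0 _ 0) ?mul0r //; exact: route_size1.
have end1 ij : polyline d (route ij) 1 = lp d vs`[ij.2].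
  rewrite (@polyline_lp K d d_gt0 _ (size (route ij)).-1) ?mul1r //; last exact: route_size1.
  by rewrite route_size; have [_ ->] := route_ends ij.
have cont ij : {within (`[0, 1]%classic : set K), continuous (polyline d (route ij))}.
  by apply: continuous_subspaceT => t; exact: polyline_cont.
have cont' ij : {within (`[0, 1]%classic : set K), continuous (fun t => polyline d (route ij) (1 - t))}.
  have flip_cont : continuous (fun t : K => 1 - t).
    by apply: cont_add; [exact: cont_cst|apply: cont_opp => x; exact: cvg_id].
  have -> : (fun t => polyline d (route ij) (1 - t)) = polyline d (route ij) \o (fun t => 1 - t) by [].
  apply: continuous_subspaceT => t; apply: continuous_comp; first exact: flip_cont.
  exact: polyline_cont.
have flip (t : K) : 0 <= t <= 1 -> 0 <= 1 - t <= 1.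
  by move=> /andP [? ?]; apply/andP; split; lra.
have openi (t : K) : `]0, 1[%classic t -> 0 < t < 1 by rewrite /= in_itv.
exists pos, arc; split.
- move=> u v /(lp_inj d_gt0) /eqP; rewrite nth_uniq ?vs_uniq ?code_lt // => /eqP; exact: code_inj.
- move=> v; rewrite /pos.
  have -> : lp d vs`[code v] = seg d vs`[code v] vs`[code v] 0.
    by rewrite /seg /lp; congr (_, _, _); rewrite mul0r addr0.
  by apply: okS; rewrite ?lexx ?ler01 //; case/and5P: check => _ _ /allP /(_ _ (v_in v)).
- move=> u v uv; case: (orient _ _ uv) => lt.
    have key := adj_key uv lt.
    have ngt : (code v < code u)%N = false by rewrite ltnNge ltnW.
    rewrite /arc lt ngt; split.
    + split; [exact: cont| |exact: end0|exact: end1].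
      by move=> t t'; rewrite !inE /= !in_itv /=; exact: route_inj.
    + by move=> _ [t /= t01 <-]; apply: route_in_S => //; move: t01; rewrite in_itv.
    + by [].
  have key := adj_key (adj_sym uv) lt.
  have ngt : (code u < code v)%N = false by rewrite ltnNge ltnW.
  rewrite /arc lt ngt; split.
  + split; [exact: cont'| |by rewrite subr0; exact: end1|by rewrite subrr; exact: end0].
    move=> t t'; rewrite !inE /= !in_itv /= => /flip t01 /flip t01' E.
    by have := route_inj key t01 t01' E; lra.
  + by move=> _ [t /= t01 <-]; apply: route_in_S => //; apply: flip; move: t01; rewrite in_itv.
  + by move=> t _; rewrite subKr.
- move=> u v w t uv /openi t01; rewrite /arc; case: (orient _ _ uv) => lt.
    by rewrite lt; apply: interior_avoids => //; exact: adj_key.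
  have ngt : (code u < code v)%N = false by rewrite ltnNge ltnW.
  by rewrite ngt; apply: interior_avoids => //; [exact: adj_key (adj_sym uv) lt|exact: flip01].
- have norm (u v : G) t : adj u v -> 0 < t < 1 -> exists ij t1,
    [/\ ij \in unzip1 es, 0 < t1 < 1, arc u v t = polyline d (route ij) t1 &
        ij = (code u, code v) \/ ij = (code v, code u)].
    move=> uv t01; rewrite /arc; case: (orient _ _ uv) => lt.
      by rewrite lt; exists (code u, code v), t; split=> //; [exact: adj_key|left].
    have ngt : (code u < code v)%N = false by rewrite ltnNge ltnW.
    rewrite ngt; exists (code v, code u), (1 - t); split=> //.
    + exact: adj_key (adj_sym uv) lt.
    + exact: flip01.
    + by right.
  move=> u v u' v' t t' uv uv' ne /openi t01 /openi t01'.
  have [ij [t1 [i_in t1P -> iE]]] := norm _ _ _ uv t01.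
  have [ij' [t2 [i_in' t2P -> iE']]] := norm _ _ _ uv' t01'.
  move=> /(interior_disjoint i_in i_in' t1P t2P) E; apply: ne.
  by case: iE iE' E => -> [] -> [] /code_inj -> /code_inj ->; auto.
Qed.

End LatticeDrawing.

(** * Two explicit drawings *)

(** The annihilator graph of Z/2 x Z/2 x Z/3 on the boundary of the drilled slab,
    in units of 1/2.  The triple (a, b, c) is the vertex a + 2 b + 4 c; the
    numbers 0 and 7 belong to zero and to a unit and get no edges. *)
Definition torus_vs : seq pt := [:: (0,0,0); (3,4,2); (6,2,1); (2,0,0); (2,4,1); (4,4,1); (6,4,0); (0,0,1); (1,6,0); (5,0,0); (3,2,2)]%N.

Definition torus_es : seq ((nat * nat) * seq pt) := [::
  ((1,2), [:: (4,5,2); (5,5,2); (5,4,2); (5,3,2); (5,2,2); (6,2,2)]);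
  ((1,4), [:: ]);
  ((1,6), [:: (3,4,1); (3,4,0); (4,5,0); (5,5,0); (6,5,0)]);
  ((1,8), [:: (3,5,2); (3,6,2); (2,6,1)]);
  ((1,10), [:: (2,4,2); (2,3,2); (2,2,2)]);
  ((2,4), [:: (6,3,1); (6,4,1); (6,5,1); (6,6,1); (5,6,0); (4,6,0); (3,5,0); (2,4,0)]);
  ((2,5), [:: (6,1,1); (6,1,2); (5,1,2); (4,1,2); (4,2,2); (4,3,2); (4,4,2)]);
  ((2,8), [:: (6,3,2); (6,4,2); (6,5,2); (6,6,2); (5,6,1); (4,6,1); (3,6,0); (2,6,0)]);
  ((2,9), [:: (6,1,0)]);
  ((3,4), [:: (2,1,0); (2,2,0); (2,3,0)]);
  ((3,5), [:: (3,1,0); (4,2,0); (4,3,0)]);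
  ((3,6), [:: (3,0,0); (4,1,0); (5,2,0); (5,3,0)]);
  ((3,8), [:: (1,0,0); (1,1,0); (1,2,0); (1,3,0); (1,4,0); (1,5,0)]);
  ((3,9), [:: (3,0,1); (4,0,1); (4,0,0)]);
  ((3,10), [:: (2,0,1); (2,0,2); (2,1,2)]);
  ((5,6), [:: (4,4,0); (5,4,0)]);
  ((5,10), [:: (4,3,1); (4,2,1); (3,2,1)]);
  ((6,9), [:: (6,3,0); (6,2,0); (5,1,0)]);
  ((9,10), [:: (5,0,1); (5,0,2); (4,0,2); (3,0,2); (3,1,2)])]%N.

(** A triangular prism, which is the annihilator graph of a product of three
    fields with two elements, in one face of the box.  A vertex is the set of
    factors with nonzero component, read as a binary number. *)
Definition prism_vs : seq pt := [:: (0,0,0); (0,5,1); (0,6,1); (0,2,0); (0,4,0); (0,4,2); (0,4,1)]%N.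

Definition prism_es : seq ((nat * nat) * seq pt) := [::
  ((1,2), [:: ]);
  ((1,4), [:: ]);
  ((1,6), [:: ]);
  ((2,4), [:: (0,5,0)]);
  ((2,5), [:: (0,6,2); (0,5,2)]);
  ((3,4), [:: (0,3,0)]);
  ((3,5), [:: (0,2,1); (0,3,2)]);
  ((3,6), [:: (0,3,1)]);
  ((5,6), [:: ])]%N.

Section Surfaces.
Local Open Scope classical_set_scope.
Local Open Scope ring_scope.
Variable K : realType.

Lemma ball3 (x y z x' y' z' e : K) : `|x - x'| < e -> `|y - y'| < e -> `|z - z'| < e ->
  ball ((x, y), z) e ((x', y'), z').
Proof. by move=> h1 h2 h3; split=> //=; split. Qed.

(** A point is not interior when points outside come arbitrarily close to it along
    some curve q. *)
Lemma not_interior k (x y z : K) (q : K -> K * K * K) :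
  (forall delta, 0 < delta < 1 -> ~ drilled_slab k (q delta)) ->
  (forall delta, 0 < delta < 1 -> [/\ `|x - (q delta).1.1| <= delta, `|y - (q delta).1.2| <= delta &
     `|z - (q delta).2| <= delta]) ->
  ~ interior (drilled_slab k) ((x, y), z).
Proof.
move=> out close /nbhs_ballP [e /= e0 sub].
pose delta := Num.min (e / 2) (1 / 2).
have d01 : 0 < delta < 1 by rewrite /delta lt_min gt_min; apply/andP; split; [apply/andP; split|apply/orP; right]; lra.
have de : delta < e by rewrite /delta gt_min; apply/orP; left; lra.
have [h1 h2 h3] := close _ d01; apply: (out _ d01); apply: sub.
case: (q delta) h1 h2 h3 => [[x' y'] z'] /= h1 h2 h3.
by apply: ball3; exact: le_lt_trans de.
Qed.

Lemma face_in_sphere (y z : K) : 0 <= y <= 3 -> 0 <= z <= 1 -> sphere_with_handles 0 (0, y, z).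
Proof.
move=> y03 z01; split.
  by apply: subset_closure; split=> //=; rewrite lexx ler0n.
apply: (not_interior (q := fun delta => (- delta, y, z))) => delta /andP [d0 d1] /=.
  by case=> /= /andP [h _]; lra.
by rewrite sub0r opprK !subrr normr0 (gtr0_norm d0) lexx (ltW d0).
Qed.

(** The disjunctions say that the point is not in the open hole, and that it lies
    on an outer side, on the bottom or the top, or on the wall of the hole. *)
Lemma in_torus (x y z : K) : 0 <= x <= 3 -> 0 <= y <= 3 -> 0 <= z <= 1 ->
  [\/ x <= 1, 2 <= x, y <= 1 | 2 <= y] ->
  [\/ x = 0, x = 3, y = 0 | y = 3] \/ [\/ z = 0, z = 1 | 1 <= x <= 2 /\ 1 <= y <= 2] ->
  sphere_with_handles 1 (x, y, z).
Proof.
move=> x03 y03 z01 free bd; split.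
  apply: subset_closure; split; rewrite ?muln1 //= => i; rewrite ltnS leqn0 => /eqP ->.
  rewrite muln0 => -[/andP [? ?] /andP [? ?]].
  by case: free => ?; lra.
have dd (t : K) : 0 < t < 1 -> `|t| = t by move=> /andP [? _]; rewrite gtr0_norm.
have mv (q : K -> K * K * K) : (forall t, 0 < t < 1 -> ~ drilled_slab 1 (q t)) ->
  (forall t, 0 < t < 1 -> [/\ - t <= x - (q t).1.1 <= t, - t <= y - (q t).1.2 <= t &
     - t <= z - (q t).2 <= t]) -> ~ interior (drilled_slab 1) ((x, y), z).
  move=> out close; apply: (not_interior out) => t t01.
  by have [? ? ?] := close t t01; rewrite !ler_norml.
case: bd => [[E|E|E|E]|[E|E|[/andP [x1 x2] /andP [y1 y2]]]].
- apply: (mv (fun t => (- t, y, z))) => t /andP [t0 t1] /=; first by case=> /= /andP [? _]; lra.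
  by split; apply/andP; split; lra.
- apply: (mv (fun t => (3 + t, y, z))) => t /andP [t0 t1] /=; first by case=> /= /andP [_]; rewrite muln1 => ?; lra.
  by split; apply/andP; split; lra.
- apply: (mv (fun t => (x, - t, z))) => t /andP [t0 t1] /=; first by case=> /= _ /andP [? _]; lra.
  by split; apply/andP; split; lra.
- apply: (mv (fun t => (x, 3 + t, z))) => t /andP [t0 t1] /=; first by case=> /= _ /andP [_ ?]; lra.
  by split; apply/andP; split; lra.
- apply: (mv (fun t => (x, y, - t))) => t /andP [t0 t1] /=; first by case=> /= _ _ /andP [? _]; lra.
  by split; apply/andP; split; lra.
- apply: (mv (fun t => (x, y, 1 + t))) => t /andP [t0 t1] /=; first by case=> /= _ _ /andP [_ ?]; lra.
  by split; apply/andP; split; lra.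
apply: (mv (fun t => (x + t * (3 / 2 - x), y + t * (3 / 2 - y), z))) => t /andP [t0 t1] /=.
  case=> /= _ _ _ /(_ 0%N isT); rewrite muln0 !add0n; apply.
  by split; apply/andP; split; nra.
by split; apply/andP; split; nra.
Qed.

Lemma comb_le (a b c : nat) (t : K) : 0 <= t <= 1 -> (a <= c)%N -> (b <= c)%N ->
  (a%:R + t * (b%:R - a%:R)) / 2%:R <= c%:R / 2%:R.
Proof.
rewrite -!(ler_nat K) => /andP [t0 t1] ac bc; rewrite ler_pM2r ?invr_gt0 ?ltr0n //; nra.
Qed.

Lemma comb_ge (a b c : nat) (t : K) : 0 <= t <= 1 -> (c <= a)%N -> (c <= b)%N ->
  c%:R / 2%:R <= (a%:R + t * (b%:R - a%:R)) / 2%:R.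
Proof.
rewrite -!(ler_nat K) => /andP [t0 t1] ac bc; rewrite ler_pM2r ?invr_gt0 ?ltr0n //; nra.
Qed.

(** Both endpoints lie on a common flat piece of the surface, so the segment does
    as well. *)
Definition torus_ok (p q : pt) : bool :=
  let x c := (p.1.1 <= c)%N && (q.1.1 <= c)%N in let x' c := (c <= p.1.1)%N && (c <= q.1.1)%N in
  let y c := (p.1.2 <= c)%N && (q.1.2 <= c)%N in let y' c := (c <= p.1.2)%N && (c <= q.1.2)%N in
  let z c := (p.2 <= c)%N && (q.2 <= c)%N in let z' c := (c <= p.2)%N && (c <= q.2)%N in
  [&& x 6%N, y 6%N, z 2%N, [|| x 2%N, x' 4%N, y 2%N | y' 4%N] &
   [|| x 0%N, x' 6%N, y 0%N | y' 6%N] || [|| z 0%N, z' 2%N | [&& x' 2%N, x 4%N, y' 2%N & y 4%N]]].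

Lemma torus_okS p q (t : K) : torus_ok p q -> 0 <= t <= 1 -> sphere_with_handles 1 (seg 2%:R p q t).
Proof.
case: p q => [[a b] c] [[a' b'] c'] chk t01.
have le (r : K) (w : nat) : w%:R / 2%:R = r -> forall u v : nat,
    (u <= w)%N && (v <= w)%N -> (u%:R + t * (v%:R - u%:R)) / 2%:R <= r.
  by move=> <- u v /andP [? ?]; exact: comb_le.
have ge (r : K) (w : nat) : w%:R / 2%:R = r -> forall u v : nat,
    (w <= u)%N && (w <= v)%N -> r <= (u%:R + t * (v%:R - u%:R)) / 2%:R.
  by move=> <- u v /andP [? ?]; exact: comb_ge.
have e0 : 0%:R / 2%:R = 0 :> K by rewrite mul0r.
have e1 : 2%:R / 2%:R = 1 :> K by rewrite divff // pnatr_eq0.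
have e2 : 4%:R / 2%:R = 2 :> K by lra.
have e3 : 6%:R / 2%:R = 3 :> K by lra.
have g0 (u v : nat) : 0 <= (u%:R + t * (v%:R - u%:R)) / 2%:R by exact: ge e0 _ _ isT.
move: chk => /and5P [/(le _ _ e3) x6 /(le _ _ e3) y6 /(le _ _ e1) z2 free bd].
rewrite /seg /=; apply: in_torus.
- by rewrite g0.
- by rewrite g0.
- by rewrite g0.
- case/or4P: free => [/(le _ _ e1)|/(ge _ _ e2)|/(le _ _ e1)|/(ge _ _ e2)] h;
    [constructor 1|constructor 2|constructor 3|constructor 4]; exact: h.
have anti (u v : K) : u <= v -> v <= u -> u = v by move=> ? ?; apply/eqP; rewrite eq_le; apply/andP.
case/orP: bd => [/or4P [/(le _ _ e0)|/(ge _ _ e3)|/(le _ _ e0)|/(ge _ _ e3)] h|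
  /or3P [/(le _ _ e0) h|/(ge _ _ e1) h|/and4P [/(ge _ _ e1) h1 /(le _ _ e2) h2 /(ge _ _ e1) h3 /(le _ _ e2) h4]]].
- by left; constructor 1; exact: anti.
- by left; constructor 2; exact: anti.
- by left; constructor 3; exact: anti.
- by left; constructor 4; exact: anti.
- by right; constructor 1; exact: anti.
- by right; constructor 2; exact: anti.
- by right; constructor 3; split; apply/andP.
Qed.

Definition face_ok (p q : pt) : bool :=
  [&& p.1.1 == 0%N, q.1.1 == 0%N, (p.1.2 <= 6)%N, (q.1.2 <= 6)%N, (p.2 <= 2)%N & (q.2 <= 2)%N].

Lemma face_okS p q (t : K) : face_ok p q -> 0 <= t <= 1 -> sphere_with_handles 0 (seg 2%:R p q t).
Proof.
case: p q => [[a b] c] [[a' b'] c'] /and5P [/= /eqP -> /eqP -> b6 b6' /andP [c2 c2']] t01.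
have g0 (u v : nat) : 0 <= (u%:R + t * (v%:R - u%:R)) / 2%:R.
  by have := @comb_ge u v 0%N t t01 isT isT; rewrite mul0r.
rewrite /seg /= subrr mulr0 addr0 mul0r; apply: face_in_sphere; rewrite g0 /=.
  by apply: le_trans (comb_le t01 b6 b6') _; lra.
by apply: le_trans (comb_le t01 c2 c2') _; lra.
Qed.

Lemma torus_drawing_ok : drawing_ok torus_vs torus_es torus_ok.
Proof. by vm_compute. Qed.

Lemma prism_drawing_ok : drawing_ok prism_vs prism_es face_ok.
Proof. by vm_compute. Qed.

Lemma torus_embeds (G : sgraph) (code : G -> nat) : injective code ->
  (forall v, (code v < 11)%N) ->
  (forall u v : G, adj u v -> (code u < code v)%N -> (code u, code v) \in unzip1 torus_es) ->
  embeds G (@sphere_with_handles K 1).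
Proof.
move=> ci cl ca.
by apply: (@lattice_embeds K 2%:R _ _ torus_vs torus_es torus_ok _ torus_drawing_ok G code ci cl ca); [rewrite ltr0n|exact: torus_okS].
Qed.

Lemma prism_embeds (G : sgraph) (code : G -> nat) : injective code ->
  (forall v, (code v < 7)%N) ->
  (forall u v : G, adj u v -> (code u < code v)%N -> (code u, code v) \in unzip1 prism_es) ->
  embeds G (@sphere_with_handles K 0).
Proof.
move=> ci cl ca.
by apply: (@lattice_embeds K 2%:R _ _ prism_vs prism_es face_ok _ prism_drawing_ok G code ci cl ca); [rewrite ltr0n|exact: face_okS].
Qed.

End Surfaces.

(** * Drawing complete bipartite graphs with two vertices on one side *)

Section Continuum.
Local Open Scope classical_set_scope.
Local Open Scope ring_scope.
Variable K : realType.

(** A real number as a sequence of bits, by its Dedekind cut in an enumeration of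
    the rational numbers. *)
Definition rat_cut (x : K) (n : nat) : bool := if unpickle n is Some q then ratr q < x else false.

Lemma rat_cut_inj : injective rat_cut.
Proof.
have lt (x y : K) : x < y -> rat_cut x = rat_cut y -> False.
  move=> xy E; have [q /=] := rat_in_itvoo xy; rewrite in_itv /= => /andP [q1 q2].
  have := congr1 (fun f => f (pickle q)) E; rewrite /= /rat_cut pickleK q2 => qx.
  by have := lt_trans q1 qx; rewrite ltxx.
move=> x y E; case: (ltgtP x y) => // [/lt|/lt] H; [by case: (H E)|by case: (H (esym E))].
Qed.

Definition interleave (f : nat -> nat -> bool) (n : nat) : bool := f (n %% 3)%N (n %/ 3)%N.

Lemma interleave_nth f k n : (k < 3)%N -> interleave f (n * 3 + k) = f k n.
Proof. by move=> k3; rewrite /interleave modnMDl modn_small // divnMDl // divn_small // addn0. Qed.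

(** Partial sums of the ternary expansion with digits 0 and 1.  Those digits make
    the expansion unique, unlike in base 2. *)
Definition tern (f : nat -> bool) (n : nat) : K := \sum_(i < n) (f i)%:R / 3 ^+ i.+1.

Lemma tern_nondecr f m n : (m <= n)%N -> tern f m <= tern f n.
Proof.
move=> mn; rewrite -(subnKC mn); elim: (n - m)%N => [|k IH]; first by rewrite addn0.
rewrite addnS /tern big_ord_recr /=; apply: le_trans IH _.
by rewrite lerDl divr_ge0 // exprn_ge0.
Qed.

(** The bound is the geometric series of the remaining digits. *)
Lemma tern_tail f n k : tern f (n + k) <= tern f n + (3 ^- n - 3 ^- (n + k)) / 2.
Proof.
elim: k => [|k IH]; first by rewrite addn0 subrr mul0r addr0.
rewrite addnS /tern big_ord_recr /= -/(tern f (n + k)) -/(tern f n).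
have p : 0 < 3 ^- (n + k) :> K by rewrite invr_gt0 exprn_gt0.
have -> : 3 ^- (n + k).+1 = 3 ^- (n + k) / 3 :> K by rewrite exprS invfM mulrC.
apply: le_trans (lerD IH (_ : _ <= 3 ^- (n + k) / 3)) _.
  by case: (f _); rewrite ?mul1r ?mul0r // divr_ge0 // ltW.
move: (3 ^- (n + k)) (3 ^- n) (tern f n) => u w s; lra.
Qed.

Lemma tern_le f n : tern f n <= 1 / 2.
Proof.
have := tern_tail f 0 n; rewrite add0n {2}/tern big_ord0 add0r expr0 invr1.
have : 0 < 3 ^- n :> K by rewrite invr_gt0 exprn_gt0.
by move=> ? h; apply: le_trans h _; lra.
Qed.

Definition cantor (f : nat -> bool) : K := sup (range (tern f)).

Lemma tern_ub f c : (forall n, tern f n <= c) -> cantor f <= c.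
Proof. by move=> h; apply: ge_sup; [exists (tern f 0), 0%N|move=> _ [n _ <-]]. Qed.

Lemma le_cantor f n : tern f n <= cantor f.
Proof.
apply: ub_le_sup; last by exists n.
by exists (1 / 2) => _ [m _ <-]; exact: tern_le.
Qed.

Lemma cantor_bounds f : 0 <= cantor f <= 1 / 2.
Proof.
rewrite (tern_ub (tern_le f)) andbT.
by apply: le_trans (le_cantor f 0); rewrite /tern big_ord0.
Qed.

Lemma cantor_lt (f g : nat -> bool) n : (forall i, (i < n)%N -> f i = g i) -> f n -> ~~ g n -> cantor g < cantor f.
Proof.
move=> fg fn gn; have E : tern g n = tern f n.
  by apply: eq_bigr => i _; rewrite fg.
have gS : tern g n.+1 = tern f n by rewrite /tern big_ord_recr /= (negPf gn) mul0r addr0.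
have fS : tern f n.+1 = tern f n + 3 ^- n.+1 by rewrite /tern big_ord_recr /= fn mul1r.
apply: (@le_lt_trans _ _ (tern f n + 3 ^- n.+1 / 2)); last first.
  apply: lt_le_trans (le_cantor f n.+1); rewrite fS ltrD2l.
  have : 0 < 3 ^- n.+1 :> K by rewrite invr_gt0 exprn_gt0.
  lra.
apply: tern_ub => m; rewrite -gS; case: (leqP m n.+1) => mn.
  apply: le_trans (tern_nondecr g mn) _; rewrite lerDl.
  by rewrite divr_ge0 // invr_ge0 exprn_ge0.
rewrite -(subnKC (ltnW mn)); apply: le_trans (tern_tail _ _ _) _; rewrite lerD2l.
by rewrite ler_pM2r ?invr_gt0 // gerBl invr_ge0 exprn_ge0.
Qed.

Lemma cantor_inj : injective cantor.
Proof.
move=> f g E; apply: contrapT => ne.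
have ex : exists n, f n != g n.
  apply: contrapT => no; apply: ne; apply/funext => n.
  by apply: contrapT => /eqP fgn; apply: no; exists n.
case: (ex_minnP ex) => k fgk kmin.
have fg i : (i < k)%N -> f i = g i.
  by move=> ik; apply/eqP/negPn/negP => /kmin; rewrite leqNgt ik.
have gf i : (i < k)%N -> g i = f i by move=> /fg.
case: (boolP (f k)) fgk => fk; case: (boolP (g k)) => gk // _.
- by have := cantor_lt fg fk gk; rewrite E ltxx.
- by have := cantor_lt gf gk fk; rewrite E ltxx.
Qed.

(** Space has no more points than the unit interval.  An embedded graph has at most
    that many vertices, which is all that is known about a possibly infinite
    one. *)
Lemma space_inj_unit : exists2 phi : K * K * K -> K, injective phi & forall p, 0 < phi p < 1.
Proof.
pose cuts3 (p : K * K * K) (k : nat) := match k with 0%N => rat_cut p.1.1 | 1%N => rat_cut p.1.2 | _ => rat_cut p.2 end.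
exists (fun p => cantor (interleave (cuts3 p)) + 1 / 4).
  move=> [[x y] z] [[x' y'] z'] /addIr /cantor_inj E.
  have H k n : (k < 3)%N -> cuts3 (x, y, z) k n = cuts3 (x', y', z') k n.
    by move=> k3; rewrite -(interleave_nth (cuts3 (x, y, z)) n k3) E interleave_nth.
  have -> : x = x' by apply/rat_cut_inj/funext => n; exact: (H 0%N).
  have -> : y = y' by apply/rat_cut_inj/funext => n; exact: (H 1%N).
  by have -> : z = z' by apply/rat_cut_inj/funext => n; exact: (H 2%N).
by move=> p; have /andP [? ?] := cantor_bounds (interleave (cuts3 p)); apply/andP; split; lra.
Qed.

End Continuum.

(** The poles are (1, 1/2) and (2, 1/2) in the face x = 0 of the box, and the other
    vertices lie on the segment between them at y = 3/2, at the height lvl.  All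
    edges are straight. *)
Section TwoPoles.
Local Open Scope classical_set_scope.
Local Open Scope ring_scope.
Variables (K : realType) (G : sgraph) (is_pole : G -> bool) (pole : G -> bool) (lvl : G -> K).
Hypothesis adj_pole : forall u v : G, adj u v -> is_pole u = ~~ is_pole v.
Hypothesis pole_inj : forall u v, is_pole u -> is_pole v -> pole u = pole v -> u = v.
Hypothesis lvl_inj : forall u v, ~~ is_pole u -> ~~ is_pole v -> lvl u = lvl v -> u = v.
Hypothesis lvl01 : forall u, 0 < lvl u < 1.

Definition ray (b : bool) (r t : K) : K * K * K :=
  (0, 1 + b%:R + t * (1 / 2 - b%:R), 1 / 2 + t * (r - 1 / 2)).

Lemma ray_inS b r t : 0 < r < 1 -> 0 <= t <= 1 -> sphere_with_handles 0 (ray b r t).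
Proof.
move=> /andP [r0 r1] /andP [t0 t1]; apply: face_in_sphere; last by apply/andP; split; nra.
by case: b => /=; apply/andP; split; nra.
Qed.

Lemma ray_inj b b' r r' t t' : 0 < t < 1 -> 0 < t' < 1 -> ray b r t = ray b' r' t' ->
  [/\ b = b', r = r' & t = t'].
Proof.
move=> /andP [t0 t1] /andP [t0' t1'] [].
have fin (s : K) : 0 < s -> 1 / 2 + s * (r - 1 / 2) = 1 / 2 + s * (r' - 1 / 2) -> r = r'.
  by move=> s0 /addrI /(mulfI (lt0r_neq0 s0)); lra.
case: b b' => [] [] /= E.
- have tt : t = t' by lra.
  by rewrite -tt => /(fin _ t0).
- by exfalso; lra.
- by exfalso; lra.
- have tt : t = t' by lra.
  by rewrite -tt => /(fin _ t0).
Qed.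

Lemma ray_cont b r : continuous (ray b r).
Proof.
have id_cont : continuous (fun t : K => t) by move=> t; exact: cvg_id.
have affine (a c : K) : continuous (fun t : K => a + t * c).
  by apply: cont_add; [exact: cont_cst|apply: cont_mul; [exact: id_cont|exact: cont_cst]].
have pair2 : continuous (fun t : K => ((0 : K), 1 + b%:R + t * (1 / 2 - b%:R))).
  by move=> t; apply: (@for_pair _ _ _ (fun=> 0) _ t); [exact: cst_continuous|exact: affine].
by move=> t; apply: (@for_pair _ _ _ _ _ t (@pair2 t)); exact: affine.
Qed.

Definition pole_pos (u : G) : K * K * K :=
  if is_pole u then ray (pole u) (1 / 2) 0 else (0, 3 / 2, lvl u).

Lemma ray0 b r r' : ray b r 0 = ray b r' 0.
Proof. by rewrite /ray !mul0r. Qed.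

Lemma ray1 b r : ray b r 1 = (0, 3 / 2, r).
Proof. by rewrite /ray; case: b => /=; congr (_, _, _); lra. Qed.

Lemma two_poles_embeds : embeds G (@sphere_with_handles K 0).
Proof.
pose arc (u v : G) (t : K) := if is_pole u then ray (pole u) (lvl v) t else ray (pole v) (lvl u) (1 - t).
have flip (t : K) : 0 <= t <= 1 -> 0 <= 1 - t <= 1.
  by move=> /andP [? ?]; apply/andP; split; lra.
have openi (t : K) : `]0, 1[%classic t -> 0 < t < 1 by rewrite /= in_itv.
have closi (t : K) : `[0, 1]%classic t -> 0 <= t <= 1 by rewrite /= in_itv.
have injc b r (t t' : K) : 0 <= t <= 1 -> 0 <= t' <= 1 -> ray b r t = ray b r t' -> t = t'.
  by case: b => /andP [? ?] /andP [? ?] [] /= E _; lra.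
exists pole_pos, arc; split.
- move=> u v; rewrite /pole_pos; case: ifP => su; case: ifP => sv.
  + move=> /(congr1 (fun p => p.1.2)) /=; rewrite !mul0r !addr0 => E.
    apply: pole_inj; rewrite ?su ?sv //.
    by move: E; case: (pole u) (pole v) => -[] //= E; exfalso; lra.
  + move=> /(congr1 (fun p => p.1.2)) /=; rewrite mul0r => E; exfalso; move: E.
    by case: (pole u) => /= E; lra.
  + move=> /(congr1 (fun p => p.1.2)) /=; rewrite mul0r => E; exfalso; move: E.
    by case: (pole v) => /= E; lra.
  + by move=> /(congr1 snd) /= E; apply: lvl_inj; rewrite ?su ?sv.
- move=> u; rewrite /pole_pos; case: ifP => _.
    by apply: ray_inS; rewrite ?lexx ?ler01 //; apply/andP; split; lra.
  by rewrite -(ray1 true); apply: ray_inS; rewrite ?lexx ?ler01.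
- move=> u v uv; have uv' := adj_pole uv.
  have cc b r : {within (`[0, 1]%classic : set K), continuous (ray b r)}.
    by apply: continuous_subspaceT; exact: ray_cont.
  have cc' b r : {within (`[0, 1]%classic : set K), continuous (fun t => ray b r (1 - t))}.
    have flip_cont : continuous (fun t : K => 1 - t).
      by apply: cont_add; [exact: cont_cst|apply: cont_opp => x; exact: cvg_id].
    have -> : (fun t => ray b r (1 - t)) = ray b r \o (fun t => 1 - t) by [].
    by apply: continuous_subspaceT => t; apply: continuous_comp; [exact: flip_cont|exact: ray_cont].
  rewrite /arc /pole_pos; case: (boolP (is_pole u)) uv' => su /esym uv'.
    have -> : is_pole v = false by case: (is_pole v) uv'.
    split.
    + split; [exact: cc| |exact: ray0|exact: ray1].
      by move=> t t'; rewrite !inE => /closi t01 /closi t01'; exact: injc.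
    + by move=> _ [t /closi t01 <-]; exact: ray_inS.
    + by move=> t _ /=.
  have -> : is_pole v = true by case: (is_pole v) uv'.
  split.
  + split; [exact: cc'| |by rewrite subr0 ray1|by rewrite subrr; exact: ray0].
    move=> t t'; rewrite !inE => /closi /flip t01 /closi /flip t01' E.
    by have := injc _ _ _ _ t01 t01' E; lra.
  + by move=> _ [t /closi /flip t01 <-]; exact: ray_inS.
  + by move=> t _; rewrite subKr.
- have off b r (t : K) w : 0 < t < 1 -> ray b r t <> pole_pos w.
    move=> /andP [t0 t1]; rewrite /pole_pos; case: ifP => _; case=> E _; move: E; rewrite ?mul0r.
      by case: (b) (pole w) => -[] /=; lra.
    by case: (b) => /=; lra.
  move=> u v w t uv /openi t01; rewrite /arc; case: ifP => su; first exact: off.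
  by apply: off; exact: flip01.
- have norm (u v : G) (t : K) : adj u v -> 0 < t < 1 -> exists x y t1,
    [/\ is_pole x /\ ~~ is_pole y, 0 < t1 < 1, arc u v t = ray (pole x) (lvl y) t1 &
        (x = u /\ y = v) \/ (x = v /\ y = u)].
    move=> uv t01; have uv' := adj_pole uv; rewrite /arc; case: ifP uv' => su /esym uv'.
      by exists u, v, t; split=> //; left.
    exists v, u, (1 - t); split=> //; [|exact: flip01|by right].
    by rewrite su; split=> //; move/negbFE: uv'.
  move=> u v u' v' t t' uv uv' ne /openi t01 /openi t01'.
  have [x [y [t1 [[sx sy] t1P -> xy]]]] := norm _ _ _ uv t01.
  have [x' [y' [t2 [[sx' sy'] t2P -> xy']]]] := norm _ _ _ uv' t01'.
  move=> /(ray_inj t1P t2P) [/(pole_inj sx sx') E1 /(lvl_inj sy sy') E2 _]; apply: ne.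
  by move: xy xy'; rewrite E1 E2 => -[] [-> ->] [] [-> ->]; auto.
Qed.

End TwoPoles.

(** * The annihilator graph of a reduced ring *)

Section Adjacency.
Local Open Scope classical_set_scope.
Local Open Scope ring_scope.
Variable R : comNzRingType.

(** In a reduced ring this characterizes adjacency: it says that neither
    annihilator contains the other. *)
Definition incomparable (x y : R) :=
  (exists2 r, r * x = 0 & r * y != 0) /\ (exists2 s, s * y = 0 & s * x != 0).

Lemma incomparable_sym x y : incomparable x y -> incomparable y x.
Proof. by case. Qed.

(** With r and s witnessing the two noninclusions, r + s kills the product but
    neither factor. *)
Lemma incomparable_ann x y : incomparable x y -> x != y /\ ann (x * y) <> ann x `|` ann y.
Proof.
move=> [[r rx ry] [s sy sx]]; split; first by apply: contra ry => /eqP <-; rewrite rx.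
move=> E; have : ann (x * y) (r + s).
  by rewrite /ann /= mulrDl !mulrA rx mul0r add0r mulrAC sy mul0r.
rewrite E => -[]; rewrite /ann /= mulrDl.
  by rewrite rx add0r => sx0; rewrite sx0 eqxx in sx.
by rewrite sy addr0 => ry0; rewrite ry0 eqxx in ry.
Qed.

Lemma incomparable_adj (u v : AG R) : incomparable (sval u) (sval v) -> adj u v.
Proof. exact: incomparable_ann. Qed.

Lemma incomparable_vertex x y : incomparable x y -> zero_divisor x /\ x != 0.
Proof.
case=> [[r rx ry] [s sy sx]]; split.
  by exists r => //; apply: contra ry => /eqP ->; rewrite mul0r.
by apply: contra sx => /eqP ->; rewrite mulr0.
Qed.

Lemma AG_sval_inj (u v : AG R) : sval u = sval v -> u = v.
Proof.
case: u v => [x xP] [y yP] /= E; rewrite E in xP *.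
by congr exist; exact: Prop_irrelevance.
Qed.

Hypothesis redR : reduced R.

Lemma sqr_eq0 (x : R) : x * x = 0 -> x = 0.
Proof. by move=> xx; apply: (redR (n := 2)); rewrite expr2. Qed.

(** If r kills x y then r y kills x, hence also y, so r y is nilpotent. *)
Lemma ann_sub_mul (x y : R) : ann x `<=` ann y -> ann (x * y) = ann x `|` ann y.
Proof.
move=> sub; apply/seteqP; split=> r; rewrite /ann /=.
  move=> rxy; right; apply: sqr_eq0.
  have /sub : ann x (r * y) by rewrite /ann /= mulrAC -mulrA.
  by rewrite /ann /= => ryy; rewrite mulrACA -mulrA [r * (y * y)]mulrA ryy mulr0.
by case=> h; [rewrite mulrA h mul0r|rewrite mulrCA h mulr0].
Qed.

Lemma ann_sub_nadj (u v : AG R) : ann (sval u) `<=` ann (sval v) -> ~ adj u v.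
Proof. by move=> /ann_sub_mul E [_]; rewrite /= E. Qed.

Lemma multiple_nadj (u v : AG R) w : sval v = sval u * w -> ~ adj u v /\ ~ adj v u.
Proof.
move=> E; have na : ~ adj u v.
  by apply: ann_sub_nadj => r; rewrite /ann /= E => ru; rewrite mulrA ru mul0r.
by split=> // /adj_sym.
Qed.

End Adjacency.

(** * Triangle-free subgraphs that are too large *)

Section Subgraph.
Local Open Scope ring_scope.
Variables (K : realType) (R : comNzRingType).

(** The last condition excludes isolated vertices, so that each listed element is
    known to be a vertex of the annihilator graph. *)
Definition good_edges (n : nat) (es : seq (nat * nat)) : bool :=
  [&& (0 < n)%N, ordered_edges n es, uniq es,
    no_triangle es &
    all (fun i => has (fun e => (e.1 == i) || (e.2 == i)) es) (iota 0 n)].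

Lemma subgraph_vertices (s : seq R) (es : seq (nat * nat)) :
  uniq s -> good_edges (size s) es ->
  all (fun e => `[< incomparable s`_e.1 s`_e.2 >]) es ->
  exists2 f : 'I_(size s) -> AG R, injective f &
    forall i j : 'I_(size s), ((i : nat), (j : nat)) \in es -> adj (f i) (f j).
Proof.
move=> us /and5P [_ lt _ _ cov] inc.
have /fin_all_exists [f fP] : forall i : 'I_(size s), exists v : AG R, sval v = s`_i.
  move=> i; have /hasP [e e_in ei] : has (fun e => (e.1 == i :> nat) || (e.2 == i :> nat)) es.
    by apply: (allP cov); rewrite mem_iota /= ltn_ord.
  have /asboolP ie := allP inc _ e_in.
  have : zero_divisor s`_i /\ s`_i != 0.
    case/orP: ei => /eqP <-; first exact: incomparable_vertex ie.
    exact: incomparable_vertex (incomparable_sym ie).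
  by move=> vP; exists (exist _ s`_i vP).
exists f.
  move=> i j fij; have : s`_i == s`_j by rewrite -!fP fij.
  by rewrite nth_uniq // => /eqP/val_inj.
by move=> i j ij; apply: incomparable_adj; rewrite !fP; have /asboolP := allP inc _ ij.
Qed.

(** A triangle-free graph with 10 vertices and 21 edges violates m <= 2 n, the
    bound on the torus. *)
Lemma torus_obstruction (s : seq R) (es : seq (nat * nat)) :
  uniq s -> size s = 10%N -> size es = 21%N -> good_edges 10 es ->
  all (fun e => `[< incomparable s`_e.1 s`_e.2 >]) es ->
  ~ embeds (AG R) (@sphere_with_handles K 1).
Proof.
move=> us s10 es21 good inc em; have good' : good_edges (size s) es by rewrite s10.
have [f fi fa] := subgraph_vertices us good' inc.
have /and5P [n0 lt un tri _] := good'.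
by have := torus_edge_bound n0 lt un tri fi fa em; rewrite es21 s10 => -[].
Qed.

Lemma sphere_obstruction (s : seq R) (es : seq (nat * nat)) :
  uniq s -> size s = 6%N -> size es = 9%N -> good_edges 6 es ->
  all (fun e => `[< incomparable s`_e.1 s`_e.2 >]) es ->
  ~ embeds (AG R) (@sphere_with_handles K 0).
Proof.
move=> us s6 es9 good inc em; have good' : good_edges (size s) es by rewrite s6.
have [f fi fa] := subgraph_vertices us good' inc.
have /and5P [n0 lt un tri _] := good'.
by have := sphere_edge_bound n0 lt un tri fi fa em; rewrite es9 s6 => -[].
Qed.

Definition bip (m n : nat) : seq (nat * nat) := [seq (i, (m + j)%N) | i <- iota 0 m, j <- iota 0 n].

(** Elements of A and B with zero products span a complete bipartite graph.  The
    graph K(3, 7) has 21 edges, and K(4, 6) keeps enough after dropping some. *)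
Lemma bip_obstruction (A B : seq R) : reduced R -> uniq A -> uniq B ->
  (forall x, x \in A -> x != 0) -> (forall y, y \in B -> y != 0) ->
  (forall x y, x \in A -> y \in B -> x * y = 0) ->
  (3 <= size A)%N -> (7 <= size B)%N || (4 <= size A)%N && (6 <= size B)%N ->
  ~ embeds (AG R) (@sphere_with_handles K 1).
Proof.
move=> red uA uB A0 B0 AB sA sB.
have main m n : (m <= size A)%N -> (n <= size B)%N -> (m + n = 10)%N ->
    good_edges 10 (take 21 (bip m n)) ->
    size (take 21 (bip m n)) = 21%N -> all (fun e => (e.1 < m <= e.2)%N) (take 21 (bip m n)) ->
    ~ embeds (AG R) (@sphere_with_handles K 1).
  move=> mA nB mn good s21 cross; have sm : size (take m A) = m by rewrite size_takel.
  have sn : size (take n B) = n by rewrite size_takel.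
  have iA x : x \in take m A -> x \in A by exact: mem_take.
  have iB x : x \in take n B -> x \in B by exact: mem_take.
  apply: (@torus_obstruction (take m A ++ take n B) _ _ _ s21 good).
  - rewrite cat_uniq !take_uniq // andbT /=; apply/hasPn => x /iB xB; apply/negP => /iA xA.
    by have /(sqr_eq0 red) x0 := AB _ _ xA xB; have := A0 _ xA; rewrite x0 eqxx.
  - by rewrite size_cat sm sn.
  apply/allP => e e_in; have /andP [e1 e2] := allP cross _ e_in.
  have e2n : (e.2 - m < n)%N.
    by have /and5P [_ /allP /(_ _ e_in) /andP [_ lt] _ _ _] := good; rewrite ltn_subLR // mn.
  rewrite !nth_cat sm e1 ltnNge e2 /=; apply/asboolP.
  have xA : (take m A)`_e.1 \in A by apply/iA/mem_nth; rewrite sm.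
  have yB : (take n B)`_(e.2 - m) \in B by apply/iB/mem_nth; rewrite sn.
  have xy := AB _ _ xA yB.
  split; [exists (take n B)`_(e.2 - m); rewrite 1?mulrC //|exists (take m A)`_e.1 => //].
    by apply/eqP => /(sqr_eq0 red) y0; have := B0 _ yB; rewrite y0 eqxx.
  by apply/eqP => /(sqr_eq0 red) y0; have := A0 _ xA; rewrite y0 eqxx.
case/orP: sB => [sB|/andP [sA' sB]]; [apply: (main 3 7)|apply: (main 4 6)] => //; by vm_compute.
Qed.

End Subgraph.

(** Elements are given by their components under three orthogonal idempotents.
    Whether two of them are adjacent follows from the sets of nonzero
    components, so the subgraphs below are checked by computation. *)
Section ThreeIdempotents.
Local Open Scope ring_scope.
Variables (K : realType) (R : comNzRingType) (e1 e2 e3 : R).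
Hypothesis e11 : e1 * e1 = e1.
Hypothesis e22 : e2 * e2 = e2.
Hypothesis e33 : e3 * e3 = e3.
Hypothesis e12 : e1 * e2 = 0.
Hypothesis e13 : e1 * e3 = 0.
Hypothesis e23 : e2 * e3 = 0.

Definition tsum (t : R * R * R) : R := t.1.1 + t.1.2 + t.2.
Definition split3 (t : R * R * R) := [/\ e1 * t.1.1 = t.1.1, e2 * t.1.2 = t.1.2 & e3 * t.2 = t.2].
Definition tsupp (t : R * R * R) : bool * bool * bool := (t.1.1 != 0, t.1.2 != 0, t.2 != 0).
Definition nle3 (u v : bool * bool * bool) := [|| u.1.1 && ~~ v.1.1, u.1.2 && ~~ v.1.2 | u.2 && ~~ v.2].

Lemma tsum_proj t : split3 t -> [/\ e1 * tsum t = t.1.1, e2 * tsum t = t.1.2 & e3 * tsum t = t.2].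
Proof.
case: t => [[a b] c] [/= h1 h2 h3]; rewrite /tsum /=.
rewrite -h1 -h2 -h3 !mulrDr !mulrA e11 e22 e33 e12 e13 e23 ![e2 * e1]mulrC ![e3 * _]mulrC e12 e13 e23.
by rewrite !mul0r !addr0 !add0r.
Qed.

Lemma tsum_inj t t' : split3 t -> split3 t' -> tsum t = tsum t' -> t = t'.
Proof.
move=> /tsum_proj [a b c] /tsum_proj [a' b' c'] E.
apply: injective_projections; last by rewrite -c E c'.
by apply: injective_projections; [rewrite -a E a'|rewrite -b E b'].
Qed.

Lemma nle3_ann t t' : split3 t -> split3 t' -> nle3 (tsupp t) (tsupp t') ->
  exists2 r, r * tsum t' = 0 & r * tsum t != 0.
Proof.
move=> /tsum_proj [a b c] /tsum_proj [a' b' c'] /or3P [] /= /andP [h /negPn /eqP h'].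
- by exists e1; rewrite ?a' ?a.
- by exists e2; rewrite ?b' ?b.
- by exists e3; rewrite ?c' ?c.
Qed.

Lemma nle3_incomparable t t' : split3 t -> split3 t' ->
  nle3 (tsupp t) (tsupp t') -> nle3 (tsupp t') (tsupp t) -> incomparable (tsum t) (tsum t').
Proof. by move=> st st' h h'; split; apply: nle3_ann. Qed.

Lemma triples_ok (ts : seq (R * R * R)) (es : seq (nat * nat)) :
  (forall t, t \in ts -> split3 t) -> uniq ts -> all (fun e => (e.1 < e.2 < size ts)%N) es ->
  all (fun e => nle3 (nth (false, false, false) (map tsupp ts) e.1) (nth (false, false, false) (map tsupp ts) e.2) &&
    nle3 (nth (false, false, false) (map tsupp ts) e.2) (nth (false, false, false) (map tsupp ts) e.1)) es ->
  uniq (map tsum ts) /\ all (fun e => `[< incomparable (map tsum ts)`_e.1 (map tsum ts)`_e.2 >]) es.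
Proof.
move=> sp uts lt inc; split.
  by rewrite map_inj_in_uniq // => t t' /sp st /sp st'; exact: tsum_inj.
apply/allP => e e_in; have /andP [l1 l2] := allP lt _ e_in.
have l0 := ltn_trans l1 l2.
have /andP [h h'] := allP inc _ e_in; apply/asboolP.
rewrite !(nth_map (0, 0, 0)) //; apply: nle3_incomparable; try (by apply/sp/mem_nth);
by rewrite !(nth_map (0, 0, 0)) in h h'.
Qed.

(** The sums of e1 or e2 with 0 or some x_i form a K(4, 4); the elements e1 + e2
    and e3 contribute five further edges. *)
Lemma obstruction_113 (x1 x2 x3 : R) : e1 != 0 -> e2 != 0 -> e3 != 0 ->
  uniq [:: 0; x1; x2; x3] -> e3 * x1 = x1 -> e3 * x2 = x2 -> e3 * x3 = x3 ->
  ~ embeds (AG R) (@sphere_with_handles K 1).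
Proof.
move=> n1 n2 n3 ux h1 h2 h3.
pose ts := [:: (e1, 0, x1); (e1, 0, x2); (e1, 0, x3); (e1, 0, 0);
  (0, e2, x1); (0, e2, x2); (0, e2, x3); (0, e2, 0); (e1, e2, 0); (0, 0, e3)].
pose es := bip 4 4 ++ [:: (0, 8); (1, 8); (2, 8); (3, 9); (8, 9)]%N.
move: ux; rewrite /= !inE !negb_or ![0 == _]eq_sym andbT => /and3P [/and3P [z1 z2 z3] /andP [d12 d13] d23].
have sp t : t \in ts -> split3 t.
  rewrite !inE; do 9 (case/orP; first by move/eqP ->; split; rewrite /= ?mulr0).
  by move/eqP ->; split; rewrite /= ?mulr0.
have z0 : (0 == 0 :> R) = true by rewrite eqxx.
have ut : uniq ts.
  rewrite /= !inE !xpair_eqE !eqxx /= ![0 == _]eq_sym.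
  by rewrite (negPf n1) (negPf n2) (negPf n3) (negPf z1) (negPf z2) (negPf z3) (negPf d12) (negPf d13) (negPf d23).
have supp : map tsupp ts = [:: (true, false, true); (true, false, true); (true, false, true); (true, false, false);
  (false, true, true); (false, true, true); (false, true, true); (false, true, false); (true, true, false); (false, false, true)].
  by rewrite /= /tsupp /= n1 n2 n3 z1 z2 z3 eqxx.
have [|u inc] := @triples_ok ts es sp ut isT; first by rewrite supp; vm_compute.
by apply: (torus_obstruction u _ _ _ inc) => //; vm_compute.
Qed.

(** Multiples of e2 and of e3, with or without e1 added, form a K(4, 4); the
    elements e1 and e2 + e3 contribute five further edges. *)
Lemma obstruction_122 (y1 y2 z1 z2 : R) : e1 != 0 -> e2 != 0 -> e3 != 0 ->
  uniq [:: 0; y1; y2] -> uniq [:: 0; z1; z2] -> e2 * y1 = y1 -> e2 * y2 = y2 ->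
  e3 * z1 = z1 -> e3 * z2 = z2 ->
  ~ embeds (AG R) (@sphere_with_handles K 1).
Proof.
move=> n1 n2 n3 uy uz h1 h2 h3 h4.
pose ts := [:: (0, y1, 0); (0, y2, 0); (e1, y1, 0); (e1, y2, 0);
  (0, 0, z1); (0, 0, z2); (e1, 0, z1); (e1, 0, z2); (e1, 0, 0); (0, e2, e3)].
pose es := bip 4 4 ++ [:: (0, 8); (1, 8); (2, 9); (3, 9); (8, 9)]%N.
move: uy; rewrite /= !inE !negb_or ![0 == _]eq_sym andbT => /andP [/andP [p1 p2] p12].
move: uz; rewrite /= !inE !negb_or ![0 == _]eq_sym andbT => /andP [/andP [q1 q2] q12].
have sp t : t \in ts -> split3 t.
  rewrite !inE; do 9 (case/orP; first by move/eqP ->; split; rewrite /= ?mulr0).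
  by move/eqP ->; split; rewrite /= ?mulr0.
have ut : uniq ts.
  rewrite /= !inE !xpair_eqE !eqxx /= ![0 == _]eq_sym.
  by rewrite (negPf n1) (negPf n2) (negPf n3) (negPf p1) (negPf p2) (negPf q1) (negPf q2) (negPf p12) (negPf q12) /= ?andbF.
have supp : map tsupp ts = [:: (false, true, false); (false, true, false); (true, true, false); (true, true, false);
  (false, false, true); (false, false, true); (true, false, true); (true, false, true); (true, false, false); (false, true, true)].
  by rewrite /= /tsupp /= n1 n2 n3 p1 p2 q1 q2 eqxx.
have [|u inc] := @triples_ok ts es sp ut isT; first by rewrite supp; vm_compute.
by apply: (torus_obstruction u _ _ _ inc) => //; vm_compute.
Qed.

(** The sums of e1 or e2 with 0, x1 or x2 form a K(3, 3). *)
Lemma obstruction_112_sphere (x1 x2 : R) : e1 != 0 -> e2 != 0 ->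
  uniq [:: 0; x1; x2] -> e3 * x1 = x1 -> e3 * x2 = x2 ->
  ~ embeds (AG R) (@sphere_with_handles K 0).
Proof.
move=> n1 n2 ux h1 h2.
pose ts := [:: (e1, 0, x1); (e1, 0, x2); (e1, 0, 0); (0, e2, x1); (0, e2, x2); (0, e2, 0)].
move: ux; rewrite /= !inE !negb_or ![0 == _]eq_sym andbT => /andP [/andP [z1 z2] d12].
have sp t : t \in ts -> split3 t.
  rewrite !inE; do 5 (case/orP; first by move/eqP ->; split; rewrite /= ?mulr0).
  by move/eqP ->; split; rewrite /= ?mulr0.
have ut : uniq ts.
  rewrite /= !inE !xpair_eqE !eqxx /= ![0 == _]eq_sym.
  by rewrite (negPf n1) (negPf n2) (negPf z1) (negPf z2) (negPf d12).
have supp : map tsupp ts = [:: (true, false, true); (true, false, true); (true, false, false);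
  (false, true, true); (false, true, true); (false, true, false)].
  by rewrite /= /tsupp /= n1 n2 z1 z2 eqxx.
have [|u inc] := @triples_ok ts (bip 3 3) sp ut isT; first by rewrite supp; vm_compute.
by apply: (sphere_obstruction u _ _ _ inc) => //; vm_compute.
Qed.

End ThreeIdempotents.

(** * Integral domains with few elements *)

Section RingIso.
Local Open Scope ring_scope.

Lemma mk_ring_iso (R S : pzRingType) (g : R -> S) (h : S -> R) :
  cancel g h -> cancel h g -> (forall x y, g (x + y) = g x + g y) ->
  (forall x y, g (x * y) = g x * g y) -> g 1 = 1 -> ring_iso R S.
Proof.
move=> gh hg gD gM g1.
have gB : {morph g : x y / x - y}.
  by move=> x y; apply: (addIr (g y)); rewrite -gD !subrK.
pose gA := GRing.isZmodMorphism.Build R S g gB.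
pose gMM := GRing.isMonoidMorphism.Build R S g (conj g1 gM).
pose g' : {rmorphism R -> S} := HB.pack g gA gMM.
by exists g'; exists h.
Qed.

Lemma ring_isoP (R S : pzRingType) : ring_iso R S -> exists (g : R -> S) (h : S -> R),
  [/\ cancel g h, cancel h g, forall x y, g (x + y) = g x + g y,
      forall x y, g (x * y) = g x * g y & g 1 = 1].
Proof.
by case=> f [h fh hf]; exists f, h; split=> //; [exact: rmorphD|exact: rmorphM|exact: rmorph1].
Qed.

Lemma ring_iso_sym (R S : pzRingType) : ring_iso R S -> ring_iso S R.
Proof.
move=> /ring_isoP [g [h [gh hg gD gM g1]]].
apply: (mk_ring_iso hg gh) => [x y|x y|]; last by rewrite -g1 gh.
  by rewrite -[in LHS](hg x) -[in LHS](hg y) -gD gh.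
by rewrite -[in LHS](hg x) -[in LHS](hg y) -gM gh.
Qed.

Lemma ring_iso_trans (R S T : pzRingType) : ring_iso R S -> ring_iso S T -> ring_iso R T.
Proof.
move=> /ring_isoP [g [h [gh hg gD gM g1]]] /ring_isoP [g' [h' [gh' hg' gD' gM' g1']]].
apply: (@mk_ring_iso R T (g' \o g) (h \o h')) => [x|x|x y|x y|] /=.
- by rewrite gh' gh.
- by rewrite hg hg'.
- by rewrite gD gD'.
- by rewrite gM gM'.
- by rewrite g1 g1'.
Qed.

Lemma ring_iso_prod (A A' B B' : pzRingType) : ring_iso A A' -> ring_iso B B' ->
  ring_iso (A * B)%type (A' * B')%type.
Proof.
move=> /ring_isoP [g [h [gh hg gD gM g1]]] /ring_isoP [g' [h' [gh' hg' gD' gM' g1']]].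
apply: (@mk_ring_iso _ _ (fun p : A * B => (g p.1, g' p.2)) (fun p => (h p.1, h' p.2))).
- by move=> [x y]; rewrite /= gh gh'.
- by move=> [x y]; rewrite /= hg hg'.
- by move=> [x y] [z t]; congr (_, _); [exact: gD|exact: gD'].
- by move=> [x y] [z t]; congr (_, _); [exact: gM|exact: gM'].
- by congr (_, _).
Qed.

Lemma mk_ring_iso_inv (R S : pzRingType) (g : R -> S) :
  injective g -> (forall y, exists x, g x = y) -> (forall x y, g (x + y) = g x + g y) ->
  (forall x y, g (x * y) = g x * g y) -> g 1 = 1 -> ring_iso S R.
Proof.
move=> gi gs gD gM g1; apply: ring_iso_sym.
have /choice [h hP] := gs.
by apply: (@mk_ring_iso R S g h) => // x; apply: gi.
Qed.

End RingIso.

(** Finite rings are given by a list of all their elements, since a corner of an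
    arbitrary ring carries no structure of finite type. *)
Section SmallRings.
Local Open Scope ring_scope.
Variables (C : comNzRingType) (s : seq C).
Hypothesis us : uniq s.
Hypothesis alls : forall x, x \in s.

(** Adding 1 permutes the elements, so it does not change their sum. *)
Lemma size_natr0 : (size s)%:R = 0 :> C.
Proof.
have pm : perm_eq [seq x + 1 | x <- s] s.
  apply: uniq_perm; rewrite ?map_inj_uniq //; first exact: addIr.
  by move=> x; rewrite alls; apply/mapP; exists (x - 1); rewrite ?alls ?subrK.
have : \sum_(x <- s) (x + 1) = \sum_(x <- s) x by rewrite -[RHS](perm_big _ pm) big_map.
rewrite big_split /= -[X in _ = X -> _]addr0 => /addrI.
by rewrite big_const_seq count_predT iter_addr_0.
Qed.

Lemma full_list (t : seq C) : uniq t -> size t = size s -> t =i s.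
Proof.
move=> ut st; apply: (uniq_min_size ut (fun x _ => alls x) _).2.
by rewrite st.
Qed.

(** A Bezout relation makes the prime ring a copy of 'F_p, and there is no room
    for more. *)
Lemma prime_ring_iso p : prime p -> size s = p -> ring_iso C 'F_p.
Proof.
move=> pp sp; have p0 : p%:R = 0 :> C by rewrite -sp size_natr0.
have cast := Fp_cast pp; have q0 := p0; rewrite -cast in q0.
set q := (Zp_trunc (pdiv p)).+2 in cast q0.
have modq n : (n %% q)%:R = n%:R :> C.
  by rewrite [in RHS](divn_eq n q) natrD natrM q0 mulr0 add0r.
pose g (x : 'F_p) : C := (x : nat)%:R.
have lt (x y : 'F_p) : (x < y)%N -> g x = g y -> False.
  move=> xy E; have k0 : (y - x)%:R = 0 :> C by rewrite natrB ?(ltnW xy) // -/(g x) -/(g y) E subrr.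
  have yp : (y < p)%N by rewrite -[X in (_ < X)%N]cast.
  have k_gt0 : (0 < y - x)%N by rewrite subn_gt0.
  have : coprime (y - x) p.
    by rewrite coprime_sym prime_coprime //; apply/negP => /(dvdn_leq k_gt0); lia.
  case/(coprimeP _ k_gt0) => -[u v] /= uv; have : (u * (y - x) = v * p + 1)%N by lia.
  move/(congr1 (fun n => n%:R : C)); rewrite natrM natrD natrM k0 p0 !mulr0 add0r => /eqP.
  by rewrite eq_sym oner_eq0.
have gi : injective g.
  move=> x y E; apply/val_inj; case: (ltngtP x y) => // [/lt|/lt] H; [by case: (H E)|by case: (H (esym E))].
apply: (@mk_ring_iso_inv _ _ g gi).
- move=> y; have : y \in [seq g x | x <- enum 'F_p].
    rewrite full_list ?alls //; first by rewrite map_inj_uniq ?enum_uniq.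
    by rewrite size_map -cardE card_Fp.
  by case/mapP => x _ ->; exists x.
- by move=> x y; rewrite /g /= modq natrD.
- by move=> x y; rewrite /g /= modq natrM.
- by rewrite /g /= modq.
Qed.

Hypothesis domC : forall x y : C, x * y = 0 -> x = 0 \/ y = 0.

(** Multiplication by x permutes the nonzero elements, so it does not change their
    product. *)
Lemma unit_order (x : C) : x != 0 -> x ^+ (size s).-1 = 1.
Proof.
move=> x0; pose t := rem 0 s.
have ut : uniq t by exact: rem_uniq.
have memt y : (y \in t) = (y != 0) by rewrite mem_rem_uniq // inE alls andbT.
have mulI y z : x * y = x * z -> y = z.
  move=> E; have : x * (y - z) = 0 by rewrite mulrBr E subrr.
  by case/domC => [x00|/subr0_eq //]; rewrite x00 eqxx in x0.
have pm : perm_eq [seq x * y | y <- t] t.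
  have um : uniq [seq x * y | y <- t] by rewrite map_inj_uniq.
  have sub : {subset [seq x * y | y <- t] <= t}.
    move=> _ /mapP [y yt ->]; rewrite memt; apply/eqP => /domC [] E.
      by rewrite E eqxx in x0.
    by move: yt; rewrite memt E eqxx.
  apply: uniq_perm => //; apply: (uniq_min_size um sub _).2; by rewrite size_map.
pose P := \prod_(y <- t) y.
have P0 : P <> 0.
  rewrite /P; have : all (fun y => y != 0) t by apply/allP => y; rewrite memt.
  elim: (t) => [_|y r IH /= /andP [y0 /IH r0]]; first by rewrite big_nil; apply/eqP/oner_neq0.
  by rewrite big_cons => /domC [E|//]; rewrite E eqxx in y0.
have : P = x ^+ size t * P.
  rewrite {1}/P -(perm_big _ pm) big_map big_split /= -/P; congr (_ * _).
  by rewrite big_const_seq count_predT iter_mulr_1.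
rewrite size_rem ?alls // => E.
have : (x ^+ (size s).-1 - 1) * P = 0 by rewrite mulrBl mul1r -E subrr.
by case/domC => [/subr0_eq //|].
Qed.

(** In a domain with six elements 2 or 3 vanishes, and every nonzero element has
    fifth power 1.  In characteristic 3 this fails for -1.  In characteristic 2,
    comparing the fifth powers of x and of 1 + x gives x ^ 2 (1 + x) = 0. *)
Lemma not_size6 : size s <> 6%N.
Proof.
move=> s6; have /= := size_natr0; rewrite s6 (_ : 6 = 2 * 3)%N // natrM => /domC.
have ord x := @unit_order x; rewrite s6 /= in ord.
have one_ne0 : 1 <> 0 :> C by apply/eqP/oner_neq0.
case=> [two0|three0].
- have [x [x0 x1]] : exists x : C, x != 0 /\ x != 1.
    case: s s6 us => [|a [|b [|c r]]] //= _; rewrite !inE !negb_or => /and4P [/and3P [ab ac _] /andP [bc _] _ _].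
    case: (boolP ((a != 0) && (a != 1))) => [/andP [? ?]|]; first by exists a.
    case: (boolP ((b != 0) && (b != 1))) => [/andP [? ?]|]; first by exists b.
    case: (boolP ((c != 0) && (c != 1))) => [/andP [? ?]|]; first by exists c.
    rewrite !negb_and !negbK => /orP [] /eqP c0 /orP [] /eqP b0 /orP [] /eqP a0;
      by move: ab ac bc; rewrite ?a0 ?b0 ?c0 eqxx.
  have x5 := ord _ x0.
  have y0 : 1 + x != 0.
    apply: contra x1 => /eqP E; apply/eqP; apply: (addrI 1); rewrite E.
    by rewrite -[1 + 1]/(2%:R) two0.
  have y5 := ord _ y0.
  have geo : x ^+ 4 + x ^+ 3 + x ^+ 2 + x + 1 = 0.
    have : (x - 1) * (x ^+ 4 + x ^+ 3 + x ^+ 2 + x + 1) = 0.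
      by rewrite (_ : _ * _ = x ^+ 5 - 1); [rewrite x5 subrr|ring].
    by case/domC => // /subr0_eq E; rewrite E eqxx in x1.
  have : x * x * (1 + x) = 0.
    have -> : x * x * (1 + x) = (x ^+ 4 + x ^+ 3 + x ^+ 2 + x + 1) - ((1 + x) ^+ 5 - 1) +
        (x ^+ 5 - 1) + 2%:R * (2 * x + 5 * x ^+ 2 + 5 * x ^+ 3 + 2 * x ^+ 4) by ring.
    by rewrite geo y5 x5 two0 !subrr mul0r !addr0.
  case/domC => [/domC [] E|E]; [by rewrite E eqxx in x0|by rewrite E eqxx in x0|by rewrite E eqxx in y0].
- have n1 : - 1 != 0 :> C by rewrite oppr_eq0 oner_neq0.
  have := ord _ n1; rewrite -signr_odd /= expr1 => E; apply: one_ne0.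
  have -> : (1 : C) = 3%:R + (- 1 - 1) by ring.
  by rewrite three0 -{2}E subrr addr0.
Qed.

(** The elements are 0, 1, w, w + 1, and w ^ 2 can only be the last one. *)
Lemma four_elements : size s = 4%N -> exists w : C,
  [/\ 1 + 1 = 0 :> C, w * w = w + 1, uniq [:: 0; 1; w; w + 1] & forall x, x \in [:: 0; 1; w; w + 1]].
Proof.
move=> s4; have two0 : 1 + 1 = 0 :> C.
  by have := size_natr0; rewrite s4 (_ : 4 = 2 * 2)%N // natrM => /domC [].
have nn (x : C) : - x = x by apply/eqP; rewrite eq_sym -addr_eq0 -mulr2n -mulr_natl -[2%:R]/(1 + 1) two0 mul0r.
have [w [w0 w1]] : exists x : C, x != 0 /\ x != 1.
  case: s s4 us => [|a [|b [|c r]]] //= _; rewrite !inE !negb_or => /and4P [/and3P [ab ac _] /andP [bc _] _ _].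
  case: (boolP ((a != 0) && (a != 1))) => [/andP [? ?]|]; first by exists a.
  case: (boolP ((b != 0) && (b != 1))) => [/andP [? ?]|]; first by exists b.
  case: (boolP ((c != 0) && (c != 1))) => [/andP [? ?]|]; first by exists c.
  rewrite !negb_and !negbK => /orP [] /eqP c0 /orP [] /eqP b0 /orP [] /eqP a0;
    by move: ab ac bc; rewrite ?a0 ?b0 ?c0 eqxx.
have wS0 : w + 1 != 0 by rewrite addr_eq0 nn.
have uw : uniq [:: 0; 1; w; w + 1].
  rewrite /= !inE !negb_or eq_sym oner_neq0 ![0 == _]eq_sym w0 wS0 [1 == w]eq_sym w1.
  rewrite -[X in X != w + 1]add0r (inj_eq (addIr 1)) [0 == w]eq_sym w0.
  by rewrite -[X in X != w + 1]addr0 (inj_eq (addrI w)) eq_sym oner_neq0.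
have allw x : x \in [:: 0; 1; w; w + 1] by rewrite full_list ?s4.
exists w; split=> //; have := allw (w * w); rewrite !inE => /or4P [] /eqP E //.
- by case/domC: E => E; rewrite E eqxx in w0.
- have : (w + 1) * (w + 1) = 0
    by rewrite (_ : _ * _ = w * w + 1 + (1 + 1) * w); [rewrite E two0 mul0r addr0|ring].
  by case/domC => H; rewrite H eqxx in wS0.
- have : w * (w - 1) = 0 by rewrite mulrBr E mulr1 subrr.
  by case/domC => [H|/subr0_eq H]; [rewrite H eqxx in w0|rewrite H eqxx in w1].
Qed.

End SmallRings.

Section Four.
Local Open Scope ring_scope.

(** Coordinates in the basis (1, w); both operations are determined in them. *)
Definition f4_elt (C : comNzRingType) (w : C) (p : bool * bool) : C := p.1%:R + p.2%:R * w.

Lemma f4_elt_inj (C : comNzRingType) (w : C) : uniq [:: 0; 1; w; w + 1] -> injective (f4_elt w).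
Proof.
move=> uw; have E p : f4_elt w p = nth 0 [:: 0; 1; w; w + 1] (p.1 + 2 * p.2).
  by case: p => [[] []]; rewrite /f4_elt /= ?mul1r ?mul0r ?addr0 ?add0r // addrC.
move=> p q; rewrite !E => /eqP; rewrite nth_uniq //; last 2 first.
- by case: p => [[] []].
- by case: q => [[] []].
by case: p q => [[] []] [[] []].
Qed.

Lemma natr_addb (C : comNzRingType) (x y : bool) : 1 + 1 = 0 :> C -> (x (+) y)%:R = x%:R + y%:R :> C.
Proof. by move=> two0; case: x y => [] [] /=; rewrite ?addr0 ?add0r ?two0. Qed.

Lemma natr_andb (C : comNzRingType) (x y : bool) : (x && y)%:R = x%:R * y%:R :> C.
Proof. by case: x y => [] [] /=; rewrite ?mulr0 ?mul0r ?mulr1. Qed.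

Lemma f4_elt_surj (C : comNzRingType) (w : C) : (forall x, x \in [:: 0; 1; w; w + 1]) ->
  forall x, exists p, f4_elt w p = x.
Proof.
move=> allw x; have := allw x; rewrite !inE => /or4P [] /eqP ->.
- by exists (false, false); rewrite /f4_elt mul0r addr0.
- by exists (true, false); rewrite /f4_elt mul0r addr0.
- by exists (false, true); rewrite /f4_elt mul1r add0r.
- by exists (true, true); rewrite /f4_elt mul1r addrC.
Qed.

Lemma f4_eltD (C : comNzRingType) (w : C) p q : 1 + 1 = 0 :> C ->
  f4_elt w p + f4_elt w q = f4_elt w (p.1 (+) q.1, p.2 (+) q.2).
Proof.
by move=> two0; rewrite /f4_elt /= !natr_addb //; ring.
Qed.

Lemma f4_eltM (C : comNzRingType) (w : C) p q : 1 + 1 = 0 :> C -> w * w = w + 1 ->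
  f4_elt w p * f4_elt w q = f4_elt w ((p.1 && q.1) (+) (p.2 && q.2), ((p.1 && q.2) (+) (p.2 && q.1)) (+) (p.2 && q.2)).
Proof.
move=> two0 ww; rewrite /f4_elt /= !natr_addb // !natr_andb.
rewrite (_ : _ * _ = p.1%:R * q.1%:R + (p.1%:R * q.2%:R + p.2%:R * q.1%:R) * w + p.2%:R * q.2%:R * (w * w)).
  by rewrite ww; ring.
by ring.
Qed.

Lemma four_ring_iso (C D : comNzRingType) (w : C) (v : D) :
  1 + 1 = 0 :> C -> w * w = w + 1 -> uniq [:: 0; 1; w; w + 1] -> (forall x, x \in [:: 0; 1; w; w + 1]) ->
  1 + 1 = 0 :> D -> v * v = v + 1 -> uniq [:: 0; 1; v; v + 1] -> (forall x, x \in [:: 0; 1; v; v + 1]) ->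
  ring_iso C D.
Proof.
move=> c2 ww uw allw d2 vv uv allv.
have /choice [pc pcP] := f4_elt_surj allw.
have /choice [pd pdP] := f4_elt_surj allv.
have pcK p : pc (f4_elt w p) = p by apply: (f4_elt_inj uw); rewrite pcP.
have pdK p : pd (f4_elt v p) = p by apply: (f4_elt_inj uv); rewrite pdP.
have one (E : comNzRingType) (u : E) : f4_elt u (true, false) = 1 by rewrite /f4_elt mul0r addr0.
apply: (@mk_ring_iso C D (fun x => f4_elt v (pc x)) (fun y => f4_elt w (pd y))).
- by move=> x; rewrite pdK pcP.
- by move=> x; rewrite pcK pdP.
- by move=> x y; rewrite -{1}(pcP x) -{1}(pcP y) f4_eltD // pcK f4_eltD.
- by move=> x y; rewrite -{1}(pcP x) -{1}(pcP y) f4_eltM // pcK f4_eltM.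
- by rewrite -(one _ w) pcK one.
Qed.

Lemma F4_ring_iso (C : comNzRingType) (s : seq C) : uniq s -> (forall x, x \in s) ->
  (forall x y : C, x * y = 0 -> x = 0 \/ y = 0) -> size s = 4%N -> ring_iso C F4.
Proof.
move=> us alls dom s4; have [w [c2 ww uw allw]] := four_elements us alls dom s4.
have [||||v [d2 vv uv allv]] := @four_elements F4 (enum F4).
- exact: enum_uniq.
- by move=> x; rewrite mem_enum.
- by move=> x y /eqP; rewrite mulf_eq0 => /orP [] /eqP; [left|right].
- by rewrite -cardE card_F4.
exact: four_ring_iso c2 ww uw allw d2 vv uv allv.
Qed.

End Four.

(** * The ring cut out by an idempotent *)

Section Corner.
Local Open Scope ring_scope.
Variables (R : comNzRingType) (e : R).
Hypotheses (ee : e * e = e) (e_neq0 : e != 0).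

Record corner_elt := CornerElt { cval : R; cvalP : e * cval == cval }.

HB.instance Definition _ := [isSub for cval].
HB.instance Definition _ := [Choice of corner_elt by <:].

(** The ring eR, with unit e.  It is only a ring for an idempotent e, and nonzero
    for e != 0, hence the proofs among the parameters of the type. *)
Definition corner of e * e = e & e != 0 : Type := corner_elt.
Local Notation Ce := (corner ee e_neq0).

HB.instance Definition _ := Choice.on Ce.

Fact corner_projP x : e * (e * x) == e * x. Proof. by rewrite mulrA ee. Qed.
Definition cproj (x : R) : Ce := CornerElt (corner_projP x).

Lemma cvalE (c : Ce) : e * cval c = cval c. Proof. exact/eqP/cvalP. Qed.
Lemma cval_inj : injective (cval : Ce -> R). Proof. exact: val_inj. Qed.
Lemma cvalK (c : Ce) : cproj (cval c) = c. Proof. exact/cval_inj/cvalE. Qed.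

Definition c_zero : Ce := cproj 0.
Definition c_one : Ce := cproj 1.
Definition c_opp (c : Ce) : Ce := cproj (- cval c).
Definition c_add (c d : Ce) : Ce := cproj (cval c + cval d).
Definition c_mul (c d : Ce) : Ce := cproj (cval c * cval d).

Lemma c_addE c d : cval (c_add c d) = cval c + cval d.
Proof. by rewrite /= mulrDr !cvalE. Qed.
Lemma c_mulE c d : cval (c_mul c d) = cval c * cval d.
Proof. by rewrite /= mulrA cvalE. Qed.
Lemma c_oppE c : cval (c_opp c) = - cval c.
Proof. by rewrite /= mulrN cvalE. Qed.
Lemma c_zeroE : cval c_zero = 0. Proof. exact: mulr0. Qed.
Lemma c_oneE : cval c_one = e. Proof. exact: mulr1. Qed.

Fact c_addA : associative c_add.
Proof. by move=> x y z; apply: cval_inj; rewrite !c_addE addrA. Qed.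
Fact c_addC : commutative c_add.
Proof. by move=> x y; apply: cval_inj; rewrite !c_addE addrC. Qed.
Fact c_add0 : left_id c_zero c_add.
Proof. by move=> x; apply: cval_inj; rewrite c_addE c_zeroE add0r. Qed.
Fact c_addN : left_inverse c_zero c_opp c_add.
Proof. by move=> x; apply: cval_inj; rewrite c_addE c_oppE c_zeroE addNr. Qed.

HB.instance Definition _ := GRing.isZmodule.Build Ce c_addA c_addC c_add0 c_addN.

Fact c_mulA : associative c_mul.
Proof. by move=> x y z; apply: cval_inj; rewrite !c_mulE mulrA. Qed.
Fact c_mulC : commutative c_mul.
Proof. by move=> x y; apply: cval_inj; rewrite !c_mulE mulrC. Qed.
Fact c_mul1 : left_id c_one c_mul.
Proof. by move=> x; apply: cval_inj; rewrite c_mulE c_oneE cvalE. Qed.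
Fact c_mulD : left_distributive c_mul (@GRing.add Ce).
Proof. by move=> x y z; apply: cval_inj; rewrite c_addE !c_mulE c_addE mulrDl. Qed.
Fact c_one_neq0 : c_one != 0 :> Ce.
Proof.
by apply: contra e_neq0 => /eqP /(congr1 cval); rewrite c_oneE c_zeroE => ->.
Qed.

HB.instance Definition _ :=
  GRing.Zmodule_isComNzRing.Build Ce c_mulA c_mulC c_mul1 c_mulD c_one_neq0.

Lemma cvalD (c d : Ce) : cval (c + d) = cval c + cval d. Proof. exact: c_addE. Qed.
Lemma cvalM (c d : Ce) : cval (c * d) = cval c * cval d. Proof. exact: c_mulE. Qed.
Lemma cval0 : cval (0 : Ce) = 0. Proof. exact: c_zeroE. Qed.
Lemma cprojD x y : cproj (x + y) = cproj x + cproj y.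
Proof. by apply: cval_inj; rewrite cvalD /= mulrDr. Qed.
Lemma cprojM x y : cproj (x * y) = cproj x * cproj y.
Proof. by apply: cval_inj; rewrite cvalM /= mulrACA ee. Qed.
Lemma cproj1 : cproj 1 = 1.
Proof. by []. Qed.

Definition corner_nonzero (x : R) : Prop := x != 0 /\ e * x = x.

Lemma corner_list (s : seq R) : uniq s -> (forall x, corner_nonzero x <-> x \in s) ->
  exists t : seq Ce, [/\ uniq t, forall c, c \in t & size t = (size s).+1].
Proof.
move=> us sP; exists (map cproj (0 :: s)); split; last by rewrite size_map.
  rewrite map_inj_in_uniq; last first.
    have cor x : x \in 0 :: s -> e * x = x.
      by rewrite inE => /orP [/eqP ->|/sP [_ //]]; rewrite mulr0.
    by move=> x y /cor ex /cor ey /(congr1 cval) /=; rewrite ex ey.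
  by rewrite /= us andbT; apply/negP => /sP []; rewrite eqxx.
move=> c; apply/mapP; exists (cval c); last by rewrite cvalK.
rewrite inE; case: (eqVneq (cval c) 0) => //= c0.
by apply/sP; split=> //; exact: cvalE.
Qed.

(** That the corner is a domain, in terms of all elements of R, which avoids
    subtypes in the classification. *)
Definition corner_domain := forall x y : R, e * (x * y) = 0 -> e * x = 0 \/ e * y = 0.

Lemma corner_domainP : corner_domain -> forall c d : Ce, c * d = 0 -> c = 0 \/ d = 0.
Proof.
move=> dom c d /(congr1 cval); rewrite cvalM cval0 => cd.
have : e * (cval c * cval d) = 0 by rewrite cd mulr0.
by case/dom; rewrite cvalE => E; [left|right]; apply: cval_inj; rewrite E cval0.
Qed.

End Corner.

Section CornerProduct.
Local Open Scope ring_scope.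
Variable R : comNzRingType.

Lemma corner_pair_iso (e f : R) (ee : e * e = e) (e0 : e != 0) (ff : f * f = f) (f0 : f != 0) :
  e * f = 0 -> e + f = 1 -> ring_iso R (corner ee e0 * corner ff f0)%type.
Proof.
move=> ef ef1.
apply: (@mk_ring_iso _ _ (fun x => (cproj ee e0 x, cproj ff f0 x)) (fun p => cval p.1 + cval p.2)).
- by move=> x; rewrite /= -mulrDl ef1 mul1r.
- move=> [c d]; congr (_, _); apply: cval_inj; rewrite /= mulrDr.
    by rewrite cvalE -[cval d](cvalE d) mulrA ef mul0r addr0.
  by rewrite cvalE -[cval c](cvalE c) mulrA [f * e]mulrC ef mul0r add0r.
- by move=> x y; congr (_, _); exact: cprojD.
- by move=> x y; congr (_, _); exact: cprojM.
- by congr (_, _); exact: cproj1.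
Qed.

Lemma corner_family_iso (n : nat) (e : 'I_n -> R) (ee : forall i, e i * e i = e i)
  (e0 : forall i, e i != 0) : (forall i j, i != j -> e i * e j = 0) -> \sum_i e i = 1 ->
  ring_iso R (ring_prod (fun i => corner (ee i) (e0 i) : comNzRingType)).
Proof.
move=> orth sum1.
pose g (x : R) : ring_prod (fun i => corner (ee i) (e0 i) : comNzRingType) :=
  [ffun i => cproj (ee i) (e0 i) x].
pose h (p : ring_prod (fun i => corner (ee i) (e0 i) : comNzRingType)) : R := \sum_i cval (p i).
apply: (@mk_ring_iso _ _ g h).
- move=> x; rewrite /h; under eq_bigr => i _ do rewrite ffunE /=.
  by rewrite -mulr_suml sum1 mul1r.
- move=> p; apply/ffunP => i; rewrite ffunE; apply: cval_inj => /=.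
  rewrite mulr_sumr (bigD1 i) //= cvalE big1 ?addr0 // => j ji.
  by rewrite -[cval (p j)](cvalE (p j)) mulrA orth ?mul0r // eq_sym.
- by move=> x y; apply/ffunP => i; rewrite !ffunE cprojD.
- by move=> x y; apply/ffunP => i; rewrite !ffunE cprojM.
- by apply/ffunP => i; rewrite !ffunE cproj1.
Qed.

End CornerProduct.

(** * Decomposing the ring *)

Section Classification.
Local Open Scope ring_scope.
Variables (K : realType) (R : comNzRingType).
Hypothesis redR : reduced R.
Hypothesis onTorus : embeds (AG R) (@sphere_with_handles K 1).
Hypothesis notSphere : ~ embeds (AG R) (@sphere_with_handles K 0).

(** Cardinalities of subsets of an infinite ring enter only through this
    alternative. *)
Lemma many_or_list (T : choiceType) (P : T -> Prop) k :
  (exists s : seq T, [/\ uniq s, size s = k & forall x, x \in s -> P x]) \/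
  (exists s : seq T, [/\ uniq s, (size s < k)%N & forall x, P x <-> x \in s]).
Proof.
elim: k => [|k [[s [us sk sP]]|[s [us sk sP]]]]; first by left; exists [::].
  case: (pselect (exists2 x, x \notin s & P x)) => [[x xs Px]|no].
    left; exists (x :: s); split=> /=; rewrite ?xs ?us ?sk //.
    by move=> y; rewrite inE => /orP [/eqP ->|/sP].
  right; exists s; split; rewrite ?sk // => x; split; last exact: sP.
  by move=> Px; apply: contrapT => /negP xs; apply: no; exists x.
by right; exists s; split=> //; exact: ltn_trans sk _.
Qed.

(** If the ideal generated by a is finite, two powers of a coincide.  Then
    [a - a * a ^+ d] is nilpotent for some positive d, hence zero, and [a ^+ d] is
    idempotent. *)
Lemma power_idempotent (a : R) (s : seq R) : a != 0 -> uniq s ->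
  (forall x, (x != 0 /\ exists c, x = c * a) <-> x \in s) ->
  exists e c, [/\ e * e = e, e != 0 & e = c * a].
Proof.
move=> a0 us sP; pose t := [seq a ^+ i.+1 | i <- iota 0 (size s).+1].
have pow_neq0 i : a ^+ i != 0 by apply: contra a0 => /eqP /redR ->.
have sub : {subset t <= s}.
  by move=> _ /mapP [i _ ->]; apply/sP; split=> //; exists (a ^+ i); rewrite exprSr.
have : ~~ uniq t.
  by apply/negP => /uniq_leq_size /(_ sub); rewrite size_map size_iota ltnn.
case/(uniqPn 0) => i [j [ij]]; rewrite size_map size_iota => js.
rewrite !(nth_map 0%N) ?size_iota ?(ltn_trans ij) // !nth_iota ?(ltn_trans ij) // !add0n => E.
pose d := (j - i)%N; have d_gt0 : (0 < d)%N by rewrite subn_gt0.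
have aad : a * a ^+ d = a.
  apply/eqP; rewrite eq_sym -subr_eq0; apply/eqP/(redR (n := i.+1)).
  rewrite (_ : a - a * a ^+ d = a * (1 - a ^+ d)); last by rewrite mulrBr mulr1.
  rewrite exprMn [(1 - _) ^+ _]exprS mulrA mulrBr mulr1 -exprD.
  by rewrite addSn subnKC ?(ltnW ij) // E subrr mul0r.
exists (a ^+ d), (a ^+ d.-1); split.
- by rewrite -{1}(prednK d_gt0) exprSr -mulrA aad -exprSr prednK.
- exact: pow_neq0.
- by rewrite -exprSr prednK.
Qed.

(** If both ideals were large, their nonzero elements would span a K(7, 7). *)
Lemma annihilating_idempotent (a b : R) : a != 0 -> b != 0 -> a * b = 0 ->
  exists e c, [/\ e * e = e, e != 0 & e = c * a \/ e = c * b].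
Proof.
move=> a0 b0 ab.
case: (many_or_list (fun x : R => x != 0 /\ exists c, x = c * a) 7) => [[A [uA sA AP]]|[s [us _ sP]]]; last first.
  by have [e [c [ee e0 E]]] := power_idempotent a0 us sP; exists e, c; split=> //; left.
case: (many_or_list (fun x : R => x != 0 /\ exists c, x = c * b) 7) => [[B [uB sB BP]]|[s [us _ sP]]]; last first.
  by have [e [c [ee e0 E]]] := power_idempotent b0 us sP; exists e, c; split=> //; right.
case: (bip_obstruction (K := K) redR uA uB) => //; rewrite ?sA ?sB //.
- by move=> x /AP [].
- by move=> x /BP [].
- by move=> x y /AP [_ [c ->]] /BP [_ [d ->]]; rewrite mulrACA ab mulr0.
Qed.

Lemma split_idempotent (e : R) : e * e = e -> ~ corner_domain e ->
  exists e1 e2, [/\ e1 * e1 = e1, e2 * e2 = e2, e1 * e2 = 0, e1 + e2 = e & e1 != 0 /\ e2 != 0].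
Proof.
move=> ee ndom.
have [x [y [xy x0 y0]]] : exists x y, [/\ e * (x * y) = 0, e * x != 0 & e * y != 0].
  apply: contrapT => no; apply: ndom => x y xy.
  case: (eqVneq (e * x) 0) => [|x0]; first by left.
  by case: (eqVneq (e * y) 0) => [|y0]; [right|case: no; exists x, y].
have ab : (e * x) * (e * y) = 0 by rewrite mulrACA ee.
have main a b c e1 : e * a = a -> e * b = b -> b != 0 -> a * b = 0 -> e1 * e1 = e1 -> e1 != 0 -> e1 = c * a ->
    exists e1 e2, [/\ e1 * e1 = e1, e2 * e2 = e2, e1 * e2 = 0, e1 + e2 = e & e1 != 0 /\ e2 != 0].
  move=> ea eb b0 ab0 ee1 e10 E; have ee1' : e * e1 = e1 by rewrite E mulrCA ea.
  exists e1, (e - e1); split=> //.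
  - by rewrite mulrBl !mulrBr ee ee1' [e1 * e]mulrC ee1' ee1 subrr subr0.
  - by rewrite mulrBr mulrC ee1' ee1 subrr.
  - by rewrite addrC subrK.
  - split=> //; apply: contra b0 => /eqP H; have : (e - e1) * b = 0 by rewrite H mul0r.
    by rewrite mulrBl eb E -mulrA ab0 mulr0 subr0 => ->.
have eez z : e * (e * z) = e * z by rewrite mulrA ee.
have [e1 [c [ee1 e10 [E|E]]]] := annihilating_idempotent x0 y0 ab.
  exact: (main _ _ _ _ (eez x) (eez y) y0 ab ee1 e10 E).
exact: (main _ _ _ _ (eez y) (eez x) x0 (etrans (mulrC _ _) ab) ee1 e10 E).
Qed.

Lemma sum1_proj (e f x : R) : e + f = 1 -> e * x + f * x = x.
Proof. by move=> h; rewrite -mulrDl h mul1r. Qed.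

(** Over a product of two domains the annihilator graph is complete bipartite.
    With at most two vertices on one side it is planar, however large the other
    side is. *)
Lemma domains_small_planar (e f : R) : e * e = e -> f * f = f -> e * f = 0 -> e + f = 1 ->
  e != 0 -> f != 0 -> corner_domain e -> corner_domain f ->
  (exists s : seq R, [/\ uniq s, (size s < 3)%N & forall x, corner_nonzero e x <-> x \in s]) -> False.
Proof.
move=> ee ff ef ef1 e0 f0 dome domf [s [us s3 sP]].
have fe : f * e = 0 by rewrite mulrC.
have zero x : e * x = 0 -> f * x = 0 -> x = 0 by move=> h1 h2; rewrite -(sum1_proj x ef1) h1 h2 addr0.
have vertex (u : AG R) : e * sval u = 0 \/ f * sval u = 0.
  case: u => x [[r r0 rx] x0] /=.
  have rx' g : g * (r * x) = 0 by rewrite rx mulr0.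
  case: (dome _ _ (rx' e)) => [er|]; last by left.
  case: (domf _ _ (rx' f)) => [fr|]; last by right.
  by rewrite (zero _ er fr) eqxx in r0.
have nz (u : AG R) : sval u != 0 by case: u => x [].
pose on_e (u : AG R) := f * sval u == 0.
have on_e_fix (u : AG R) : on_e u -> e * sval u = sval u.
  by move=> /eqP fu; rewrite -[RHS](sum1_proj _ ef1) fu addr0.
have off_e_zero (u : AG R) : ~~ on_e u -> e * sval u = 0.
  by case: (vertex u) => // fu; rewrite /on_e fu eqxx.
have off_e_fix (u : AG R) : ~~ on_e u -> f * sval u = sval u.
  by move=> /off_e_zero eu; rewrite -[RHS](sum1_proj _ ef1) eu add0r.
have same g (u v : AG R) : g * g = g -> corner_domain g -> g * sval u = sval u -> g * sval v = sval v -> ~ adj u v.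
  move=> gg domg gu gv; apply: (ann_sub_nadj redR) => r; rewrite /ann /= => ru.
  have : g * (r * sval u) = 0 by rewrite ru mulr0.
  case/domg => [gr|]; last by rewrite gu => u0; have := nz u; rewrite u0 eqxx.
  by rewrite -gv mulrA [r * g]mulrC gr mul0r.
have adj_on_e (u v : AG R) : adj u v -> on_e u = ~~ on_e v.
  move=> uv; case: (boolP (on_e u)) => su; case: (boolP (on_e v)) => sv //.
    by case: (@same e u v) => //; exact: on_e_fix.
  by case: (@same f u v) => //; exact: off_e_fix.
have [phi phi_inj phi01] := space_inj_unit K.
have [pos [_ [pos_inj _ _ _ _]]] := onTorus.
apply: notSphere; apply: (@two_poles_embeds K (AG R) on_e (fun u => sval u == e) (fun u => phi (pos u)) adj_on_e).
- have e_in : e \in s by apply/sP; split.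
  have s_in (u : AG R) : on_e u -> sval u \in s by move=> su; apply/sP; split=> //; exact: on_e_fix.
  move=> u v /s_in us_in /s_in vs_in E; apply: AG_sval_inj; move: E.
  case: (eqVneq (sval u) e) => [->|ue]; first by move=> /esym /eqP ->.
  case: (eqVneq (sval v) e) => // ve _; apply/eqP; apply: contraT => uv.
  have : uniq [:: e; sval u; sval v] by rewrite /= !inE !negb_or ![e == _]eq_sym ue ve uv.
  move=> /uniq_leq_size H; have : (3 <= size s)%N.
    by apply: H => x; rewrite !inE => /or3P [] /eqP ->.
  by rewrite leqNgt s3.
- by move=> u v _ _ /phi_inj /pos_inj.
- by move=> u; exact: phi01.
Qed.

(** Let a and b be the numbers of nonzero elements of the two corners.  Both are at
    least 3 since the graph is not planar, K(3, 7) and K(4, 6) bound them from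
    above, and a domain with finitely many elements does not have six of them. *)
Lemma two_domains (e f : R) (ee : e * e = e) (ff : f * f = f) (e0 : e != 0) (f0 : f != 0) :
  e * f = 0 -> e + f = 1 -> corner_domain e -> corner_domain f ->
  [\/ ring_iso R ('F_7 * F4)%type, ring_iso R ('F_5 * 'F_5)%type,
      ring_iso R ('F_5 * F4)%type | ring_iso R (F4 * F4)%type].
Proof.
move=> ef ef1 dome domf.
have fe : f * e = 0 by rewrite mulrC.
have fe1 : f + e = 1 by rewrite addrC.
have three g h : g * g = g -> h * h = h -> g * h = 0 -> g + h = 1 -> g != 0 -> h != 0 ->
    corner_domain g -> corner_domain h ->
    exists A : seq R, [/\ uniq A, size A = 3%N & forall x, x \in A -> corner_nonzero g x].
  move=> gg hh gh gh1 g0 h0 domg domh.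
  case: (many_or_list (corner_nonzero g) 3) => // on_e.
  by case: (domains_small_planar gg hh gh gh1 g0 h0 domg domh on_e).
have orth g h x y : g * h = 0 -> corner_nonzero g x -> corner_nonzero h y -> x * y = 0.
  by move=> gh [_ <-] [_ <-]; rewrite mulrACA gh mul0r.
have bip (A B : seq R) g h : g * h = 0 -> uniq A -> uniq B ->
   (forall x, x \in A -> corner_nonzero g x) -> (forall x, x \in B -> corner_nonzero h x) ->
   (3 <= size A)%N -> ((7 <= size B) || (4 <= size A) && (6 <= size B))%N -> False.
  move=> gh uA uB AP BP sA sB.
  apply: (bip_obstruction (K := K) redR uA uB _ _ _ sA sB onTorus).
  - by move=> x /AP [].
  - by move=> x /BP [].
  - by move=> x y /AP xP /BP yP; exact: orth gh xP yP.
have full g h : g * g = g -> h * h = h -> g * h = 0 -> g + h = 1 -> g != 0 -> h != 0 ->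
    corner_domain g -> corner_domain h ->
    exists A : seq R, [/\ uniq A, (3 <= size A < 7)%N & forall x, corner_nonzero g x <-> x \in A].
  move=> gg hh gh gh1 g0 h0 domg domh.
  have [B [uB sB BP]] := three h g hh gg (etrans (mulrC _ _) gh) (etrans (addrC _ _) gh1) h0 g0 domh domg.
  have [A [uA sA AP]] := three g h gg hh gh gh1 g0 h0 domg domh.
  case: (many_or_list (corner_nonzero g) 7) => [[D [uD sD DP]]|[D [uD sD DP]]].
    by case: (bip B D h g) => //; rewrite ?sB ?sD // mulrC.
  exists D; split=> //; rewrite sD andbT -sA; apply: uniq_leq_size => // x /AP /DP; done.
have [A [uA /andP [sA3 sA7] AP]] := full e f ee ff ef ef1 e0 f0 dome domf.
have [B [uB /andP [sB3 sB7] BP]] := full f e ff ee fe fe1 f0 e0 domf dome.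
have [tA [utA allA stA]] := corner_list ee e0 uA AP.
have [tB [utB allB stB]] := corner_list ff f0 uB BP.
have A6 : ~~ ((4 <= size A) && (6 <= size B))%N.
  apply/negP => AB; apply: (bip A B e f) => //; last by rewrite AB orbT.
    by move=> x /AP.
  by move=> x /BP.
have B6 : ~~ ((4 <= size B) && (6 <= size A))%N.
  apply/negP => AB; apply: (bip B A f e) => //; last by rewrite AB orbT.
    by move=> x /BP.
  by move=> x /AP.
have A5 : size A <> 5%N.
  by move=> A5; apply: (not_size6 utA allA (corner_domainP dome)); rewrite stA A5.
have B5 : size B <> 5%N.
  by move=> B5; apply: (not_size6 utB allB (corner_domainP domf)); rewrite stB B5.
have RAB := corner_pair_iso ee e0 ff f0 ef ef1.
have RBA := corner_pair_iso ff f0 ee e0 fe fe1.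
have isoA p : prime p -> (size A).+1 = p -> ring_iso (corner ee e0) 'F_p.
  by move=> pp sp; apply: (prime_ring_iso utA allA pp); rewrite stA.
have isoB p : prime p -> (size B).+1 = p -> ring_iso (corner ff f0) 'F_p.
  by move=> pp sp; apply: (prime_ring_iso utB allB pp); rewrite stB.
have fourA : size A = 3%N -> ring_iso (corner ee e0) F4.
  by move=> A3; apply: (F4_ring_iso utA allA (corner_domainP dome)); rewrite stA A3.
have fourB : size B = 3%N -> ring_iso (corner ff f0) F4.
  by move=> B3; apply: (F4_ring_iso utB allB (corner_domainP domf)); rewrite stB B3.
have cases : [\/ size A = 3 /\ size B = 3, size A = 3 /\ size B = 4, size A = 3 /\ size B = 6 | size A = 4 /\ size B = 3]%N \/
   (size A = 4 /\ size B = 4 \/ size A = 6 /\ size B = 3)%N.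
  move: (size A) (size B) sA3 sA7 sB3 sB7 A6 B6 A5 B5; clear.
  by case=> [|[|[|[|[|[|[|a]]]]]]]; case=> [|[|[|[|[|[|[|b]]]]]]] //= _ _ _ _ _ _ A5 B5;
    first [by case: A5|by case: B5|by left; constructor 1|by left; constructor 2|by left; constructor 3
      |by left; constructor 4|by right; left|by right; right].
case: cases => [[[sA sB]|[sA sB]|[sA sB]|[sA sB]]|[[sA sB]|[sA sB]]].
- constructor 4; apply: ring_iso_trans RAB _; apply: ring_iso_prod; [exact: fourA|exact: fourB].
- constructor 3; apply: ring_iso_trans RBA _; apply: ring_iso_prod; [by apply: isoB; rewrite ?sB|exact: fourA].
- constructor 1; apply: ring_iso_trans RBA _; apply: ring_iso_prod; [by apply: isoB; rewrite ?sB|exact: fourA].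
- constructor 3; apply: ring_iso_trans RAB _; apply: ring_iso_prod; [by apply: isoA; rewrite ?sA|exact: fourB].
- constructor 2; apply: ring_iso_trans RAB _; apply: ring_iso_prod; [by apply: isoA; rewrite ?sA|by apply: isoB; rewrite ?sB].
- constructor 1; apply: ring_iso_trans RAB _; apply: ring_iso_prod; [by apply: isoA; rewrite ?sA|exact: fourB].
Qed.

End Classification.

(** * Three factors *)

Section ThreeFactors.
Local Open Scope ring_scope.
Variables (K : realType) (R : comNzRingType).
Hypothesis redR : reduced R.

Definition one_nonzero (e : R) := forall x, e * x = 0 \/ e * x = e.
Definition two_nonzero (e : R) := exists y1 y2, [/\ uniq [:: 0; y1; y2], e * y1 = y1 & e * y2 = y2].

Lemma one_or_two (e : R) : e * e = e -> e != 0 -> one_nonzero e \/ two_nonzero e.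
Proof.
move=> ee e0; case: (many_or_list (corner_nonzero e) 2) => [[[|y1 [|y2 [|y3 s]]] [us // _ sP]]|[s [us s2 sP]]].
  have [y10 ey1] := sP y1 (mem_head _ _).
  have [y20 ey2] : corner_nonzero e y2 by apply: sP; rewrite !inE eqxx orbT.
  right; exists y1, y2; split=> //; move: us; rewrite /= !inE !negb_or andbT => ->.
  by rewrite ![0 == _]eq_sym y10 y20.
left => x; case: (eqVneq (e * x) 0) => [|ex0]; first by left.
have ex : e * x \in s by apply/sP; split=> //; rewrite mulrA ee.
have es : e \in s by apply/sP; split.
by right; case: s s2 ex es {us sP} => [|z [|z' s]] //= _; rewrite !inE => /eqP -> /eqP ->.
Qed.

Lemma bits_inj (a b c a' b' c' : bool) :
  (a + 2 * b + 4 * c = a' + 2 * b' + 4 * c')%N -> [/\ a = a', b = b' & c = c'].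
Proof. by case: a b c a' b' c' => [] [] [] [] [] []. Qed.

(** Here every element is determined by the set of its nonzero components, and a
    larger set means a smaller annihilator. *)
Lemma prism_planar (e1 e2 e3 : R) : e1 * e1 = e1 -> e2 * e2 = e2 -> e3 * e3 = e3 ->
  e1 + e2 + e3 = 1 -> one_nonzero e1 -> one_nonzero e2 -> one_nonzero e3 ->
  embeds (AG R) (@sphere_with_handles K 0).
Proof.
move=> e11 e22 e33 sum1 o1 o2 o3.
have dec x : e1 * x + e2 * x + e3 * x = x by rewrite -!mulrDl sum1 mul1r.
have ext x y : e1 * x = e1 * y -> e2 * x = e2 * y -> e3 * x = e3 * y -> x = y.
  by move=> h1 h2 h3; rewrite -(dec x) -(dec y) h1 h2 h3.
pose bit e (u : AG R) : bool := e * sval u != 0.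
have bitE e (u v : AG R) : one_nonzero e -> bit e u = bit e v -> e * sval u = e * sval v.
  move=> oe; rewrite /bit; case: (oe (sval u)) => ->; case: (oe (sval v)) => -> //.
    by rewrite eqxx => /esym /negbFE /eqP ->.
  by rewrite eqxx => /negbFE /eqP ->.
pose code u := (bit e1 u + 2 * bit e2 u + 4 * bit e3 u)%N.
have sub (u v : AG R) : bit e1 u ==> bit e1 v -> bit e2 u ==> bit e2 v -> bit e3 u ==> bit e3 v ->
    ~ adj u v /\ ~ adj v u.
  move=> b1 b2 b3; suff [h h'] : ~ adj v u /\ ~ adj u v by split.
  apply: (multiple_nadj redR (w := sval u)).
  have comp e : e * e = e -> one_nonzero e -> bit e u ==> bit e v -> e * sval u = e * (sval v * sval u).
    move=> ee oe; have -> : e * (sval v * sval u) = (e * sval v) * (e * sval u) by rewrite mulrACA ee.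
    rewrite /bit; case: (oe (sval u)) => ->; first by rewrite mulr0.
    by case: (oe (sval v)) => -> ; rewrite ?ee // eqxx implybF negbK => /eqP ->; rewrite mulr0.
  by apply: ext; exact: comp.
apply: (@prism_embeds K (AG R) code).
- move=> u v /bits_inj [/(bitE _ _ _ o1) h1 /(bitE _ _ _ o2) h2 /(bitE _ _ _ o3) h3].
  by apply: AG_sval_inj; exact: ext.
- move=> u; have : ~~ [&& bit e1 u, bit e2 u & bit e3 u].
    apply/negP => /and3P [b1 b2 b3].
    have full e : one_nonzero e -> bit e u -> e * sval u = e * 1.
      by move=> oe; rewrite /bit mulr1; case: (oe (sval u)) => // ->; rewrite eqxx.
    have u1 : sval u = 1 by apply: ext; exact: full.
    case: u u1 {b1 b2 b3 full} => x [[r r0 rx] _] /= x1.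
    by move: rx; rewrite x1 mulr1 => r00; rewrite r00 eqxx in r0.
  by rewrite /code; case: (bit e1 u) (bit e2 u) (bit e3 u) => [] [] [].
- move=> u v uv; have h1 := sub u v; have h2 := sub v u; rewrite /code.
  by case: (bit e1 u) (bit e2 u) (bit e3 u) (bit e1 v) (bit e2 v) (bit e3 v) h1 h2 =>
    [] [] [] [] [] [] //= h1 h2 _; first [by case: (h1 isT isT isT)|by case: (h2 isT isT isT)|by []].
Qed.

Lemma corner_triple_iso (e1 e2 e3 : R) (e11 : e1 * e1 = e1) (e22 : e2 * e2 = e2) (e33 : e3 * e3 = e3)
  (n1 : e1 != 0) (n2 : e2 != 0) (n3 : e3 != 0) :
  e1 * e2 = 0 -> e1 * e3 = 0 -> e2 * e3 = 0 -> e1 + e2 + e3 = 1 ->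
  ring_iso R (corner e11 n1 * corner e22 n2 * corner e33 n3)%type.
Proof.
move=> e12 e13 e23 sum1.
have e21 : e2 * e1 = 0 by rewrite mulrC.
have e31 : e3 * e1 = 0 by rewrite mulrC.
have e32 : e3 * e2 = 0 by rewrite mulrC.
apply: (@mk_ring_iso _ _ (fun x => (cproj e11 n1 x, cproj e22 n2 x, cproj e33 n3 x))
  (fun p => cval p.1.1 + cval p.1.2 + cval p.2)).
- by move=> x; rewrite /= -!mulrDl sum1 mul1r.
- move=> [[c d] k]; congr (_, _, _); apply: cval_inj; rewrite /= !mulrDr -(cvalE c) -(cvalE d) -(cvalE k) !mulrA.
  + by rewrite e11 e12 e13 !mul0r !addr0.
  + by rewrite e22 e21 e23 !mul0r addr0 add0r.
  + by rewrite e33 e31 e32 !mul0r !add0r.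
- by move=> x y; congr (_, _, _); exact: cprojD.
- by move=> x y; congr (_, _, _); exact: cprojM.
- by congr (_, _, _); exact: cproj1.
Qed.

Hypothesis onTorus : embeds (AG R) (@sphere_with_handles K 1).
Hypothesis notSphere : ~ embeds (AG R) (@sphere_with_handles K 0).

Lemma third_corner_small (e1 e2 e3 : R) : e1 * e1 = e1 -> e2 * e2 = e2 -> e3 * e3 = e3 ->
  e1 * e2 = 0 -> e1 * e3 = 0 -> e2 * e3 = 0 -> e1 != 0 -> e2 != 0 -> e3 != 0 ->
  exists s : seq R, [/\ uniq s, (size s < 3)%N & forall x, corner_nonzero e3 x <-> x \in s].
Proof.
move=> e11 e22 e33 e12 e13 e23 n1 n2 n3.
case: (many_or_list (corner_nonzero e3) 3) => // -[[|x1 [|x2 [|x3 [|x4 s]]]] [us // _ sP]].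
have [z1 h1] : corner_nonzero e3 x1 by apply: sP; rewrite inE eqxx.
have [z2 h2] : corner_nonzero e3 x2 by apply: sP; rewrite !inE eqxx orbT.
have [z3 h3] : corner_nonzero e3 x3 by apply: sP; rewrite !inE eqxx !orbT.
case: (obstruction_113 (K := K) e11 e22 e33 e12 e13 e23 n1 n2 n3 _ h1 h2 h3 onTorus).
by rewrite cons_uniq us andbT !inE !negb_or ![0 == _]eq_sym z1 z2 z3.
Qed.

Lemma one_nonzero_list (e : R) : e * e = e -> e != 0 -> one_nonzero e ->
  forall x, corner_nonzero e x <-> x \in [:: e].
Proof.
move=> ee e0 oe x; rewrite inE; split=> [[x0 ex]|/eqP ->]; last by split.
by case: (oe x) => E; move: x0; rewrite -{1}ex E ?eqxx // => _; rewrite -ex E.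
Qed.

Lemma two_two_three (e1 e2 e3 : R) : e1 * e1 = e1 -> e2 * e2 = e2 -> e3 * e3 = e3 ->
  e1 * e2 = 0 -> e1 * e3 = 0 -> e2 * e3 = 0 -> e1 + e2 + e3 = 1 -> e1 != 0 -> e2 != 0 -> e3 != 0 ->
  one_nonzero e1 -> one_nonzero e2 -> two_nonzero e3 -> ring_iso R ('Z_2 * 'Z_2 * 'Z_3)%type.
Proof.
move=> e11 e22 e33 e12 e13 e23 sum1 n1 n2 n3 o1 o2 [y1 [y2 [uy ey1 ey2]]].
have [s [us s3 sP]] := third_corner_small e11 e22 e33 e12 e13 e23 n1 n2 n3.
have s2 : size s = 2%N.
  apply/eqP; rewrite eqn_leq -ltnS s3 /=; apply: (@uniq_leq_size _ [:: y1; y2]).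
    by move: uy => /= /andP [].
  move: uy; rewrite /= !inE !negb_or ![0 == _]eq_sym => /andP [/andP [p1 p2] _] x.
  by rewrite !inE => /orP [] /eqP ->; apply/sP; split.
apply: ring_iso_trans (corner_triple_iso e11 e22 e33 n1 n2 n3 e12 e13 e23 sum1) _.
have two e (ee : e * e = e) (e0 : e != 0) : one_nonzero e -> ring_iso (corner ee e0) 'Z_2.
  move=> oe; have [t [ut allt st]] := corner_list ee e0 (isT : uniq [:: e]) (one_nonzero_list ee e0 oe).
  exact: (prime_ring_iso ut allt (isT : prime 2)).
have [t [ut allt st]] := corner_list e33 n3 us sP.
apply: ring_iso_prod; first by apply: ring_iso_prod; exact: two.
by apply: (prime_ring_iso ut allt (isT : prime 3)); rewrite st s2.
Qed.

(** The numbers of nonzero elements of the corners are 1, 1 and 2 in some order: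
    if all are 1 the graph is planar, and in the other cases it contains one of
    the obstructions for the torus. *)
Lemma three_factors (e1 e2 e3 : R) : e1 * e1 = e1 -> e2 * e2 = e2 -> e3 * e3 = e3 ->
  e1 * e2 = 0 -> e1 * e3 = 0 -> e2 * e3 = 0 -> e1 + e2 + e3 = 1 -> e1 != 0 -> e2 != 0 -> e3 != 0 ->
  ring_iso R ('Z_2 * 'Z_2 * 'Z_3)%type.
Proof.
move=> e11 e22 e33 e12 e13 e23 sum1 n1 n2 n3.
have e21 : e2 * e1 = 0 by rewrite mulrC.
have e31 : e3 * e1 = 0 by rewrite mulrC.
have e32 : e3 * e2 = 0 by rewrite mulrC.
have not_two a b c : a * a = a -> b * b = b -> c * c = c -> a * b = 0 -> a * c = 0 -> b * c = 0 ->
    a != 0 -> b != 0 -> c != 0 -> two_nonzero b -> two_nonzero c -> ring_iso R ('Z_2 * 'Z_2 * 'Z_3)%type.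
  move=> aa bb cc ab ac bc a0 b0 c0 [y1 [y2 [uy ey1 ey2]]] [z1 [z2 [uz ez1 ez2]]].
  by case: (obstruction_122 (K := K) aa bb cc ab ac bc a0 b0 c0 uy uz ey1 ey2 ez1 ez2 onTorus).
case: (one_or_two e11 n1) => [d1|t1]; case: (one_or_two e22 n2) => [d2|t2];
case: (one_or_two e33 n3) => [d3|t3].
- by case: notSphere; exact: prism_planar sum1 d1 d2 d3.
- exact: two_two_three e11 e22 e33 e12 e13 e23 sum1 n1 n2 n3 d1 d2 t3.
- apply: two_two_three e11 e33 e22 e13 e12 e32 _ n1 n3 n2 d1 d3 t2; by rewrite addrAC.
- exact: not_two e11 e22 e33 e12 e13 e23 n1 n2 n3 t2 t3.
- apply: two_two_three e22 e33 e11 e23 e21 e31 _ n2 n3 n1 d2 d3 t1; by rewrite addrC addrA.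
- exact: not_two e22 e11 e33 e21 e23 e13 n2 n1 n3 t1 t3.
- exact: not_two e33 e11 e22 e31 e32 e12 n3 n1 n2 t1 t2.
- exact: not_two e11 e22 e33 e12 e13 e23 n1 n2 n3 t2 t3.
Qed.

Lemma three_idempotents_product (e1 e2 e3 : R) : e1 * e1 = e1 -> e2 * e2 = e2 -> e3 * e3 = e3 ->
  e1 * e2 = 0 -> e1 * e3 = 0 -> e2 * e3 = 0 -> e1 + e2 + e3 = 1 -> e1 != 0 -> e2 != 0 -> e3 != 0 ->
  exists (n : nat) (Rs : 'I_n -> comNzRingType),
       [/\ (2 <= n <= 3)%N,
           ring_iso R (ring_prod Rs),
           n = 3%N -> ring_iso R ('Z_2 * 'Z_2 * 'Z_3)%type &
           n = 2%N -> [\/ ring_iso R ('F_7 * F4)%type,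
                          ring_iso R ('F_5 * 'F_5)%type,
                          ring_iso R ('F_5 * F4)%type |
                          ring_iso R (F4 * F4)%type]].
Proof.
move=> e11 e22 e33 e12 e13 e23 sum1 n1 n2 n3.
pose e (i : 'I_3) := nth 0 [:: e1; e2; e3] i.
have ee i : e i * e i = e i by case: i => [[|[|[|i]]] li].
have e0 i : e i != 0 by case: i => [[|[|[|i]]] li].
have orth i j : i != j -> e i * e j = 0.
  by case: i j => [[|[|[|i]]] li] [[|[|[|j]]] lj] //= _; rewrite /e /= // mulrC.
exists 3%N, (fun i => corner (ee i) (e0 i)); split=> //.
  by apply: corner_family_iso => //; rewrite !big_ord_recl big_ord0 addr0 /e /= addrA.
by move=> _; exact: three_factors e11 e22 e33 e12 e13 e23 sum1 n1 n2 n3.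
Qed.

(** Zero divisors give a first idempotent decomposition.  If both corners are
    domains, the ring is a product of two domains; otherwise one of them splits
    again, and three idempotents already determine the ring. *)
Lemma reduced_toroidal_product : ~ integral_domain R ->
  exists (n : nat) (Rs : 'I_n -> comNzRingType),
       [/\ (2 <= n <= 3)%N,
           ring_iso R (ring_prod Rs),
           n = 3%N -> ring_iso R ('Z_2 * 'Z_2 * 'Z_3)%type &
           n = 2%N -> [\/ ring_iso R ('F_7 * F4)%type,
                          ring_iso R ('F_5 * 'F_5)%type,
                          ring_iso R ('F_5 * F4)%type |
                          ring_iso R (F4 * F4)%type]].
Proof.
move=> ndom.
have [a [b [ab a0 b0]]] : exists a b : R, [/\ a * b = 0, a != 0 & b != 0].
  apply: contrapT => no; apply: ndom => x y xy; apply/orP.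
  case: (eqVneq x 0) => [|x0]; first by left.
  by case: (eqVneq y 0) => [|y0]; [right|case: no; exists x, y].
have nd1 : ~ corner_domain (1 : R).
  by move=> /(_ a b); rewrite ab mulr0 !mul1r => /(_ erefl) [] /eqP E; [rewrite E in a0|rewrite E in b0].
have [e [f [ee ff ef ef1 [e0 f0]]]] := split_idempotent redR onTorus (mulr1 1) nd1.
case: (pselect (corner_domain e)) => [dome|nde]; last first.
  have [e1 [e2 [e11 e22 e12 sum [n1 n2]]]] := split_idempotent redR onTorus ee nde.
  have h1 : e * e1 = e1 by rewrite -sum mulrDl e11 [e2 * _]mulrC e12 addr0.
  have h2 : e * e2 = e2 by rewrite -sum mulrDl e22 e12 add0r.
  apply: (@three_idempotents_product e1 e2 f) => //; last by rewrite sum.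
    by rewrite -h1 mulrAC ef mul0r.
  by rewrite -h2 mulrAC ef mul0r.
case: (pselect (corner_domain f)) => [domf|ndf]; last first.
  have [f1 [f2 [f11 f22 f12 sum [n1 n2]]]] := split_idempotent redR onTorus ff ndf.
  have h1 : f * f1 = f1 by rewrite -sum mulrDl f11 [f2 * _]mulrC f12 addr0.
  have h2 : f * f2 = f2 by rewrite -sum mulrDl f22 f12 add0r.
  apply: (@three_idempotents_product e f1 f2) => //; last by rewrite -addrA sum.
    by rewrite -h1 mulrA ef mul0r.
  by rewrite -h2 mulrA ef mul0r.
pose g (i : 'I_2) := nth 0 [:: e; f] i.
have gg i : g i * g i = g i by case: i => [[|[|i]] li].
have g0 i : g i != 0 by case: i => [[|[|i]] li].
have orth i j : i != j -> g i * g j = 0.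
  by case: i j => [[|[|i]] li] [[|[|j]] lj] //= _; rewrite /g /= // mulrC.
exists 2%N, (fun i => corner (gg i) (g0 i)); split=> //.
  by apply: corner_family_iso => //; rewrite !big_ord_recl big_ord0 addr0 /g /=.
by move=> _; exact: two_domains redR onTorus notSphere _ _ ee ff e0 f0 ef ef1 dome domf.
Qed.


End ThreeFactors.

(** * The annihilator graph of Z/2 x Z/2 x Z/3 *)

Section Converse.
Local Open Scope ring_scope.
Variable K : realType.
Local Notation Z223 := ('Z_2 * 'Z_2 * 'Z_3)%type.

Lemma Z2_sqr (a b : 'Z_2) : (b != 0) ==> (a != 0) -> b = a * (a * b).
Proof. by case: a b => [[|[|a]] la] [[|[|b]] lb] //= _; apply/val_inj. Qed.

Lemma Z3_sqr (a b : 'Z_3) : (b != 0) ==> (a != 0) -> b = a * (a * b).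
Proof. by case: a b => [[|[|[|a]]] la] [[|[|[|b]]] lb] //= _; apply/val_inj. Qed.

(** In a product of fields, t is a multiple of t' as soon as its nonzero components
    are among those of t'. *)
Definition Z223_supp_le (t t' : Z223) :=
  [&& (t.1.1 != 0) ==> (t'.1.1 != 0), (t.1.2 != 0) ==> (t'.1.2 != 0) & (t.2 != 0) ==> (t'.2 != 0)].

Lemma Z223_supp_le_mul t t' : Z223_supp_le t t' -> t = t' * (t' * t).
Proof.
case: t t' => [[a b] c] [[a' b'] c'] /and3P [h1 h2 h3].
by congr (_, _, _); [exact: Z2_sqr|exact: Z2_sqr|exact: Z3_sqr].
Qed.

Definition Z223_code (t : Z223) : nat := (t.1.1 + 2 * t.1.2 + 4 * t.2)%N.

Lemma Z223_code_inj : injective Z223_code.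
Proof.
move=> [[[[|[|a]] la] [[|[|b]] lb]] [[|[|[|c]]] lc]] [[[[|[|a']] la'] [[|[|b']] lb']] [[|[|[|c']]] lc']] // _;
  by congr (_, _, _); apply/val_inj.
Qed.

Lemma Z223_code_keys t t' : ~~ Z223_supp_le t t' -> ~~ Z223_supp_le t' t -> (Z223_code t < Z223_code t')%N ->
  (Z223_code t, Z223_code t') \in unzip1 torus_es.
Proof.
by case: t t' => [[[[|[|a]] la] [[|[|b]] lb]] [[|[|[|c]]] lc]] [[[[|[|a']] la'] [[|[|b']] lb']] [[|[|[|c']]] lc']].
Qed.

Lemma Z223_code_lt t : Z223_code t != 11%N -> (Z223_code t < 11)%N.
Proof. by case: t => [[[[|[|a]] la] [[|[|b]] lb]] [[|[|[|c]]] lc]]. Qed.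

Lemma Z223_reduced : reduced Z223.
Proof.
have sq (t : Z223) : t * t = 0 -> t = 0.
  have h : Z223_supp_le t t by rewrite /Z223_supp_le !implybb.
  by move=> tt; rewrite (Z223_supp_le_mul h) tt mulr0.
have pow (t : Z223) k : t ^+ (2 ^ k) = 0 -> t = 0.
  elim: k => [|k IH]; first by rewrite expr1.
  by rewrite expnS mulnC exprM expr2 => /sq /IH.
move=> t n tn; apply: (pow t n); rewrite -(subnK (ltnW (ltn_expl n (ltnSn 1)))) exprD tn mulr0 //.
Qed.

Lemma Z223_torus : embeds (AG Z223) (@sphere_with_handles K 1).
Proof.
have nadj (u v : AG Z223) : Z223_supp_le (sval u) (sval v) -> ~ adj u v /\ ~ adj v u.
  by move=> /Z223_supp_le_mul /(multiple_nadj Z223_reduced) [].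
apply: (@torus_embeds K _ (fun u : AG Z223 => Z223_code (sval u))).
- by move=> u v /Z223_code_inj /AG_sval_inj.
- move=> u; apply: Z223_code_lt; apply/eqP => u11.
  have : sval u * sval u = 1.
    have : Z223_code (sval u) = Z223_code (1, 1, 2%:R) by rewrite u11.
    by move=> /Z223_code_inj ->; congr (_, _, _); apply/val_inj.
  case: u {u11} => x [[r r0 rx] _] /= xx.
  by move/eqP: r0; apply; rewrite -[r]mulr1 -xx mulrA rx mul0r.
- move=> u v uv; apply: Z223_code_keys; apply/negP => /nadj [h1 h2]; [exact: h1|exact: h2].
Qed.

Lemma Z223_not_sphere : ~ embeds (AG Z223) (@sphere_with_handles K 0).
Proof.
apply: (@obstruction_112_sphere K Z223 (1, 0, 0) (0, 1, 0) (0, 0, 1) _ _ _ _ _ _ (0, 0, 1) (0, 0, 2%:R));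
  by [apply/eqP|].
Qed.

Lemma Z223_toroidal : toroidal K (AG Z223).
Proof.
split; first exact: Z223_torus.
by move=> [|k] //; move=> /Z223_not_sphere.
Qed.

End Converse.

Theorem theorem12 (K : realType) :
  (forall R : comNzRingType,
     reduced R -> ~ integral_domain R -> toroidal K (AG R) ->
     exists (n : nat) (Rs : 'I_n -> comNzRingType),
       [/\ (2 <= n <= 3)%N,
           ring_iso R (ring_prod Rs),
           n = 3%N -> ring_iso R ('Z_2 * 'Z_2 * 'Z_3)%type &
           n = 2%N -> [\/ ring_iso R ('F_7 * F4)%type,
                          ring_iso R ('F_5 * 'F_5)%type,
                          ring_iso R ('F_5 * F4)%type |
                          ring_iso R (F4 * F4)%type]])
  /\ toroidal K (AG ('Z_2 * 'Z_2 * 'Z_3)%type).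
Proof.
split; last exact: Z223_toroidal.
move=> R redR ndom [onTorus minimal].
have notSphere : ~ embeds (AG R) (@sphere_with_handles K 0) by move/minimal.
exact: reduced_toroidal_product redR onTorus notSphere ndom.
Qed.
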